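(* Algebras over the terminal $\mathtt{Per}$-operad $\mathsf 1_{\mathtt{Per}}$ are permutads. The operad $\mathsf 1_{\mathtt{Per}}$ is binary quadratic. It is self-dual in the sense that the category of algebras over its Koszul dual $\mathsf 1_{\mathtt{Per}}^!$ is isomorphic to the category of permutads via the functor induced by the suspension of the underlying collection.
   Context: $\Bbbk$ is a field of characteristic $0$; everything takes values in graded $\Bbbk$-vector spaces, with Koszul signs. $\uparrow$ raises degree by one; graded duals are $(V^* )_n=(V_n)^*$. $\underline n=\{1<\dots<n\}$. **The operadic category $\mathtt O=\mathtt{Per}$.** Objects are surjections $\alpha:\underline n\twoheadrightarrow\underline k$, $n\ge1$ (not necessarily order-preserving). A morphism from $\alpha':\underline n\twoheadrightarrow\underline k'$ to $\alpha'':\underline n\twoheadrightarrow\underline k''$ is an order-preserving map $\gamma:\underline k'\to\underline k''$ with $\gamma\alpha'=\alpha''$. The cardinality is $|\alpha|=k$; the $i$-th fiber of $\gamma$ is the surjection $(\gamma\alpha')^{-1}(i)\twoheadrightarrow\gamma^{-1}(i)$ induced by $\alpha'$ (both sets identified with ordinals order-preservingly); induced maps $f_i$ between fibers are restrictions. The local terminal objects are $\underline n\to\underline1$, $n\ge1$, all of them chosen (trivial). The grading is $e(\underline n\twoheadrightarrow\underline k)=k-1$. All isomorphisms are identities. $\pi_0(\mathtt{Per})=\{1,2,\dots\}$. **Markl operads over $\mathtt O$.** A morphism $\phi:T\to S$ is elementary (at $i\in|S|$) if all its fibers are trivial except $F=\phi^{-1}(i)$, and $e(F)\ge1$; notation $F\triangleright_iT\xrightarrow{\phi}S$.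 A (strictly unital) $\mathtt{Per}$-operad $M$ is a family of graded vector spaces $M(T)$, $T\in\mathtt{Per}$, with degree $0$ maps $\circ_\phi:M(S)\otimes M(F)\to M(T)$ for all elementary $F\triangleright T\xrightarrow{\phi}S$ and $\eta_U:\Bbbk\to M(U)$ for trivial $U$, such that: (a) if $F\triangleright_jT\xrightarrow{\phi}S$, $G\triangleright_iS\xrightarrow{\psi}P$, $|\psi|(j)=i$, $\xi=\psi\phi$, then $\circ_\xi(\mathrm{id}\otimes\circ_{\phi_i})=\circ_\phi(\circ_\psi\otimes\mathrm{id})$ on $M(P)\otimes M(G)\otimes M(F)$; (b) if $\psi'\phi'=\psi''\phi'':T\to S$ with $\phi',\psi',\phi'',\psi''$ elementary at $j,i,l,k$ and $|\psi''|(l)=i\ne k=|\psi'|(j)$ (then $\phi',\psi''$ have the same nontrivial fiber $F$, and $\phi'',\psi'$ the same nontrivial fiber $G$), then $\circ_{\phi'}(\circ_{\psi'}\otimes\mathrm{id})(\mathrm{id}\otimes\tau)=\circ_{\phi''}(\circ_{\psi''}\otimes\mathrm{id})$ on $M(S)\otimes M(F)\otimes M(G)$, $\tau$ the symmetry; (u) for $T\triangleright T\xrightarrow{!}U$, $U$ trivial, $\circ_!(\eta_U\otimes\mathrm{id})=\mathrm{id}$. It is $1$-connected if all $\eta_U$ are isomorphisms. The terminal operad $\mathsf 1_{\mathtt{Per}}$ has all components $\Bbbk$ and all structure maps canonical identifications. **Quadratic operads, Koszul duals.** A $1$-connected collection is a family $E(T)$, $T\in\mathtt{Per}$, of graded vector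 spaces with $E(T)=0$ if $e(T)=0$. $\mathbb F(E)$ is the free $1$-connected operad on $E$ (left adjoint to $M\mapsto\{M(T)\text{ if }e(T)\ge1;\,0\text{ otherwise}\}$), with weight grading $\mathbb F(E)=\bigoplus_{k\ge0}\mathbb F^k(E)$ additive under $\circ_\phi$, $\mathbb F^0$ the unit part, $\mathbb F^1(E)=E$. Explicitly $\mathbb F^2(E)(X)\cong\bigoplus_\tau E(t_1)\otimes E(t_2)$ over elementary $\tau:X\to S$ with $e(S)\ge1$, $t_1$ the nontrivial fiber of $\tau$, $t_2=S$, where $x\otimes y$ corresponds to $(-1)^{|x||y|}\circ_\tau(y\otimes x)$. An ideal is a family of subspaces $I$ with $\circ_\phi(a\otimes b)\in I$ if $a\in I$ or $b\in I$; $(R)$ is the smallest ideal containing $R$. A $1$-connected operad is quadratic if it is isomorphic to $\mathbb F(E)/(R)$ with $R\subset\mathbb F^2(E)$, and binary if moreover $E(T)\ne0$ implies $e(T)=1$. Its Koszul dual is $M^!=\mathbb F(\uparrow E^* )/(R^\perp)$, with $R^\perp\subset\mathbb F^2(\uparrow E^* )$ the annihilator of $R$ under the pairing with $\mathbb F^2(E)$ for which summands of distinct $\tau$ are orthogonal and which on the same $\tau$ is the evaluation $\uparrow E^*(t_1)\otimes\uparrow E^*(t_2)\otimes E(t_1)\otimes E(t_2)\to\Bbbk$. The terminal operad is presented by $E(T)=\Bbbk$ if $|T|=2$, $0$ otherwise, and $R$ the kernel of $\mathbb F^2(E)\to\mathsf 1_{\mathtt{Per}}$. **Algebras.** For $T=(\alpha:\underline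 n\twoheadrightarrow\underline k)$ let $n_i=|\alpha^{-1}(i)|$. An $M$-algebra is a family $(P(n))_{n\ge1}$ of graded vector spaces with degree $0$ maps $\alpha_T:M(T)\otimes P(n_1)\otimes\cdots\otimes P(n_k)\to P(n)$ such that $\alpha_U(\eta_U\otimes-)=\mathrm{id}$ for trivial $U$, and for $F\triangleright_iT\xrightarrow{\phi}S$, $\alpha_T(\circ_\phi(m\otimes m')\otimes a_1\otimes\cdots)=\pm\alpha_S(m\otimes\cdots\otimes\alpha_F(m'\otimes\bigotimes_{|\phi|(k)=i}a_k)\otimes\cdots)$ (Koszul sign). **Permutads.** A permutad is a family $(P(n))_{n\ge1}$ of graded vector spaces with degree $0$ operations $\circ_r:P(n_1)\otimes P(n_2)\to P(n_1+n_2)$ for all surjections $r:\underline n\twoheadrightarrow\underline2$, $n_i=|r^{-1}(i)|$, such that for each surjection $\alpha:\underline n\twoheadrightarrow\underline3$, $\circ_t(\circ_s\otimes\mathrm{id})=\circ_u(\mathrm{id}\otimes\circ_v)$, where $s=\alpha|_{\alpha^{-1}\{1,2\}}$, $t=\nu_{\{1,2\}}\alpha$, $u=\nu_{\{2,3\}}\alpha$, $v=\alpha|_{\alpha^{-1}\{2,3\}}$ (domains and codomains of restrictions identified with ordinals order-preservingly), and $\nu_{\{1,2\}},\nu_{\{2,3\}}:\underline3\to\underline2$ are the order-preserving surjections identifying $1,2$, resp. $2,3$. *)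

(* Defs.v *)
From HB Require Import structures.
From mathcomp Require Import all_boot all_order all_algebra.
From mathcomp Require Import generic_quotient boolp functions.

Set Implicit Arguments.
Unset Strict Implicit.
Unset Printing Implicit Defensive.

Import Order.TTheory GRing.Theory.
Local Open Scope ring_scope.
Local Open Scope quotient_scope.

(* [ar] is n, [card] is k; letters and positions are numbered from 0. *)
Record per := Per {
  ar : nat;
  card : nat;
  sur : {ffun 'I_ar -> 'I_card};
  ar_gt0 : (0 < ar)%N;
  sur_surj : [forall i, exists x, sur x == i] }.

Definition grade (T : per) : nat := (card T).-1.

Definition trivial (T : per) : bool := card T == 1%N.

(* [mor_comm] is gamma \o alpha' = alpha'', written for x, y with the same
   value because ['I_(ar T)] and ['I_(ar S)] agree only up to [mor_ar]. *)
Record mor (T S : per) := Mor {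
  mfun :> {ffun 'I_(card T) -> 'I_(card S)};
  mor_mono : {homo mfun : x y / (x <= y)%N};
  mor_ar : ar T = ar S;
  mor_comm : forall (x : 'I_(ar T)) (y : 'I_(ar S)),
    x = y :> nat -> mfun (sur T x) = sur S y }.

Section Restriction.
Variables (T : per) (A : {set 'I_(card T)}).

Let B : {set 'I_(ar T)} := [set x | sur T x \in A].

Lemma restr_mem (x : 'I_#|B|) : sur T (enum_val x) \in A.
Proof. by have := enum_valP x; rewrite inE. Qed.

(* [enum_val] and [enum_rank_in] are the increasing identifications of A and of
   its preimage with ordinals. *)
Definition restr_fun : {ffun 'I_#|B| -> 'I_#|A|} :=
  [ffun x => enum_rank_in (restr_mem x) (sur T (enum_val x))].

Lemma restr_surj : [forall i, exists x, restr_fun x == i].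
Proof.
apply/forallP => i; have iA := enum_valP i.
have /existsP [x /eqP xi] := forallP (sur_surj T) (enum_val i).
have xB : x \in B by rewrite inE xi.
apply/existsP; exists (enum_rank_in xB x); rewrite ffunE.
by apply/eqP/enum_val_inj; rewrite enum_rankK_in ?enum_rankK_in // xi.
Qed.

Lemma restr_gt0 : A != set0 -> (0 < #|B|)%N.
Proof.
case/set0Pn => a aA; apply/card_gt0P.
have /existsP [x /eqP xa] := forallP (sur_surj T) a.
by exists x; rewrite inE xa.
Qed.

Definition restr (A0 : A != set0) : per := Per (restr_gt0 A0) restr_surj.

End Restriction.

Lemma mor_surj T S (f : mor T S) i : exists x, f x = i.
Proof.
have /existsP [y /eqP <-] := forallP (sur_surj S) i.
exists (sur T (cast_ord (esym (mor_ar f)) y)); exact: mor_comm.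
Qed.

Lemma mor_uniq T S (f g : mor T S) : f = g.
Proof.
have fg : mfun f = mfun g.
  apply/ffunP => i; have /existsP [x /eqP <-] := forallP (sur_surj T) i.
  have e := @erefl nat x.
  by rewrite (mor_comm (y := cast_ord (mor_ar f) x) f) // (mor_comm (y := cast_ord (mor_ar f) x) g).
case: f g fg => [f f1 f2 f3] [g g1 g2 g3] /= fg; subst g.
by congr Mor; apply: Prop_irrelevance.
Qed.

Lemma fiber_neq0 T S (f : mor T S) i : [set x | f x == i] != set0.
Proof. by have [x xi] := mor_surj f i; apply/set0Pn; exists x; rewrite inE xi. Qed.

Definition fiber T S (f : mor T S) (i : 'I_(card S)) : per :=
  restr (fiber_neq0 f i).

Definition elementary (F T S : per) (f : mor T S) (i : 'I_(card S)) : Prop :=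
  [/\ F = fiber f i, (0 < grade F)%N & forall l, l != i -> trivial (fiber f l)].

(* The cardinality n_(i+1) of the preimage of the letter i. *)
Definition fib (T : per) (i : nat) : nat := #|[set x | sur T x == i :> nat]|.

Definition ksign (k : fieldType) (p : int) : k := (-1) ^+ `|p|%N.

Section Dual.
Variables (k : fieldType) (V : lmodType k).

Definition linear_form : {pred V -> k^o} := fun f => `[< linear f >].

Lemma linear_form_submod : submod_closed linear_form.
Proof.
split=> [|c f g /asboolP lf /asboolP lg]; apply/asboolP => a u v.
  by rewrite /= scaler0 addr0.
change (c *: f (a *: u + v) + g (a *: u + v) =
        a *: (c *: f u + g u) + (c *: f v + g v)).
by rewrite lf lg !scalerDr !scalerA addrACA [a * c]mulrC.
Qed.

HB.instance Definition _ :=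
  GRing.isSubmodClosed.Build k _ linear_form linear_form_submod.

Record dual := Dual { dual_fun :> V -> k^o; _ : dual_fun \in linear_form }.

HB.instance Definition _ := [isSub for dual_fun].
HB.instance Definition _ := [Choice of dual by <:].
HB.instance Definition _ := [SubChoice_isSubLmodule of dual by <:].

End Dual.

(* A type with operations that satisfy the laws of a vector space up to an
   equivalence relation; [quo] is the vector space of equivalence classes. *)
Record lmod_setoid (k : fieldType) := LmodSetoid {
  lscar : Type;
  lseq : lscar -> lscar -> Prop;
  lszero : lscar;
  lsadd : lscar -> lscar -> lscar;
  lsscale : k -> lscar -> lscar;
  lseq_refl : forall x, lseq x x;
  lseq_sym : forall x y, lseq x y -> lseq y x;
  lseq_trans : forall y x z, lseq x y -> lseq y z -> lseq x z;
  lsadd_eq : forall x x' y y', lseq x x' -> lseq y y' ->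
    lseq (lsadd x y) (lsadd x' y');
  lsscale_eq : forall c x x', lseq x x' -> lseq (lsscale c x) (lsscale c x');
  lsaddA : forall x y z, lseq (lsadd x (lsadd y z)) (lsadd (lsadd x y) z);
  lsaddC : forall x y, lseq (lsadd x y) (lsadd y x);
  lsadd0 : forall x, lseq (lsadd lszero x) x;
  lsscaleA : forall a b x, lseq (lsscale a (lsscale b x)) (lsscale (a * b) x);
  lsscale1 : forall x, lseq (lsscale 1 x) x;
  lsscaleDr : forall a x y,
    lseq (lsscale a (lsadd x y)) (lsadd (lsscale a x) (lsscale a y));
  lsscaleDl : forall a b x,
    lseq (lsscale (a + b) x) (lsadd (lsscale a x) (lsscale b x));
  lsscale0 : forall x, lseq (lsscale 0 x) lszero }.

Section SetoidQuotient.
Variables (k : fieldType) (X : lmod_setoid k).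

Definition lsrel : rel {classic lscar X} := fun x y => `[< lseq x y >].

Lemma lsrel_refl : reflexive lsrel.
Proof. by move=> x; apply/asboolP/lseq_refl. Qed.

Lemma lsrel_sym : symmetric lsrel.
Proof. by move=> x y; apply/asboolP/asboolP; apply: lseq_sym. Qed.

Lemma lsrel_trans : transitive lsrel.
Proof. by move=> y x z /asboolP xy /asboolP yz; apply/asboolP/(lseq_trans xy). Qed.

Canonical lsrel_equiv := EquivRel lsrel lsrel_refl lsrel_sym lsrel_trans.

Definition quo : Type := {eq_quot lsrel_equiv}.
HB.instance Definition _ := Choice.on quo.

Definition cls (x : lscar X) : quo := \pi_({eq_quot lsrel_equiv}) x.
Definition rep (u : quo) : lscar X := repr (u : {eq_quot lsrel_equiv}).

Lemma repK u : cls (rep u) = u.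
Proof. exact: reprK. Qed.

Lemma clsP x y : cls x = cls y <-> lseq x y.
Proof.
split; first by move/eqmodP/asboolP.
by move=> xy; apply/eqmodP/asboolP.
Qed.

Lemma rep_cls x : lseq (rep (cls x)) x.
Proof. by apply/clsP; rewrite repK. Qed.

Lemma clsW (P : quo -> Prop) : (forall x, P (cls x)) -> forall u, P u.
Proof. by move=> Px u; rewrite -(repK u). Qed.

Definition quo_add (u v : quo) : quo := cls (lsadd (rep u) (rep v)).
Definition quo_scale (c : k) (u : quo) : quo := cls (lsscale c (rep u)).

Lemma cls_add_subproof x y : cls (lsadd x y) = quo_add (cls x) (cls y).
Proof. by apply/clsP/lsadd_eq; apply/lseq_sym/rep_cls. Qed.

Lemma cls_scale_subproof c x : cls (lsscale c x) = quo_scale c (cls x).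
Proof. by apply/clsP/lsscale_eq; apply/lseq_sym/rep_cls. Qed.

Let clsE := (cls_add_subproof, cls_scale_subproof).

Lemma quo_addA : associative quo_add.
Proof.
elim/clsW => x; elim/clsW => y; elim/clsW => z.
by rewrite -!clsE; apply/clsP/lsaddA.
Qed.

Lemma quo_addC : commutative quo_add.
Proof. by elim/clsW => x; elim/clsW => y; rewrite -!clsE; apply/clsP/lsaddC. Qed.

Lemma quo_add0 : left_id (cls (lszero X)) quo_add.
Proof. by elim/clsW => x; rewrite -!clsE; apply/clsP/lsadd0. Qed.

Lemma quo_addN : left_inverse (cls (lszero X)) (quo_scale (-1)) quo_add.
Proof.
elim/clsW => x; rewrite -!clsE; apply/clsP.
apply: lseq_trans (lsscale0 x); rewrite -(addNr 1).
apply: lseq_trans (lseq_sym (lsscaleDl _ _ _)).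
by apply: lsadd_eq (lseq_refl _) (lseq_sym (lsscale1 _)).
Qed.

HB.instance Definition _ :=
  GRing.isZmodule.Build quo quo_addA quo_addC quo_add0 quo_addN.

Lemma quo_scaleA a b u : quo_scale a (quo_scale b u) = quo_scale (a * b) u.
Proof. by elim/clsW: u => x; rewrite -!clsE; apply/clsP/lsscaleA. Qed.

Lemma quo_scale1 : left_id 1 quo_scale.
Proof. by elim/clsW => x; rewrite -!clsE; apply/clsP/lsscale1. Qed.

Lemma quo_scaleDr : right_distributive quo_scale +%R.
Proof.
move=> a; elim/clsW => x; elim/clsW => y.
by rewrite /GRing.add /= -!clsE; apply/clsP/lsscaleDr.
Qed.

Lemma quo_scaleDl u : {morph quo_scale^~ u : a b / a + b}.
Proof.
move=> a b; elim/clsW: u => x.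
by rewrite [in RHS]/GRing.add /= -!clsE; apply/clsP/lsscaleDl.
Qed.

HB.instance Definition _ := GRing.Zmodule_isLmodule.Build k quo
  quo_scaleA quo_scale1 quo_scaleDr quo_scaleDl.

Lemma cls0 : cls (lszero X) = 0.
Proof. by []. Qed.

Lemma clsD x y : cls (lsadd x y) = cls x + cls y.
Proof. exact: cls_add_subproof. Qed.

Lemma clsZ c x : cls (lsscale c x) = c *: cls x.
Proof. exact: cls_scale_subproof. Qed.

End SetoidQuotient.

(* Degrees are related by equations p + q == r rather than by computation, so
   that the axioms need no transport. Since Per has at most one morphism between
   two objects, [fi] in [ocompA] is the map that [f] induces on fibers.
   [ounit U] is eta_U(1). *)
Record operad (k : fieldType) := Operad {
  oper :> per -> int -> lmodType k;
  ocomp : forall (F T S : per) (f : mor T S) (i : 'I_(card S)),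
    elementary F f i -> forall p q r : int, p + q == r ->
    oper S p -> oper F q -> oper T r;
  ounit : forall U : per, trivial U -> oper U 0;
  ocomp_linl : forall F T S f i (ef : @elementary F T S f i) p q r
    (h : p + q == r) (y : oper F q), linear (fun x => ocomp ef h x y);
  ocomp_linr : forall F T S f i (ef : @elementary F T S f i) p q r
    (h : p + q == r) (x : oper S p), linear (fun y => ocomp ef h x y);
  ocompA : forall F G H T S P (f : mor T S) (g : mor S P) (gf : mor T P)
    (fi : mor H G) j i j' (ef : elementary F f j) (eg : elementary G g i)
    (egf : elementary H gf i) (efi : elementary F fi j'),
    g j = i -> (forall x, gf x = g (f x)) ->
    forall (p q r pq qr d : int) (hpq : p + q == pq) (hqr : q + r == qr)
      (hl : p + qr == d) (hr : pq + r == d)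
      (x : oper P p) (y : oper G q) (z : oper F r),
    ocomp egf hl x (ocomp efi hqr y z) = ocomp ef hr (ocomp eg hpq x y) z;
  ocompC : forall F G T S1 S2 P (f1 : mor T S1) (g1 : mor S1 P)
    (f2 : mor T S2) (g2 : mor S2 P) j i l m
    (ef1 : elementary F f1 j) (eg1 : elementary G g1 i)
    (ef2 : elementary G f2 l) (eg2 : elementary F g2 m),
    (forall x, g1 (f1 x) = g2 (f2 x)) -> g2 l = i -> g1 j = m -> i != m ->
    forall (p q r pq pr d : int) (hpq : p + q == pq) (hpr : p + r == pr)
      (h1 : pr + q == d) (h2 : pq + r == d)
      (x : oper P p) (y : oper F q) (z : oper G r),
    ksign k (q * r) *: ocomp ef1 h1 (ocomp eg1 hpr x z) y
      = ocomp ef2 h2 (ocomp eg2 hpq x y) z;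
  ocomp1 : forall T U (f : mor T U) i (ef : elementary T f i) (hU : trivial U)
    p (h : 0 + p == p) (x : oper T p), ocomp ef h (ounit hU) x = x }.

Lemma lin0 (k : fieldType) (V W : lmodType k) (f : V -> W) :
  linear f -> f 0 = 0.
Proof. by move=> lf; have := lf (-1) 0 0; rewrite scaler0 addr0 scaleN1r addNr. Qed.

Lemma lin_scale (k : fieldType) (V W : lmodType k) (f : V -> W) :
  linear f -> forall c x, f (c *: x) = c *: f x.
Proof. by move=> lf c x; have := lf c x 0; rewrite (lin0 lf) !addr0. Qed.

Lemma ocompZr k (M : operad k) F T S f i (ef : @elementary F T S f i) p q r
    (h : p + q == r) c (x : M S p) (y : M F q) :
  ocomp ef h x (c *: y) = c *: ocomp ef h x y.
Proof. exact: (lin_scale (ocomp_linr ef h x)). Qed.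

Definition one_connected k (M : operad k) : Prop :=
  forall U (hU : trivial U), bijective (fun c : k => c *: ounit M hU) /\
    forall p (x : M U p), p != 0 -> x = 0.

Record operad_mor k (M N : operad k) := OperadMor {
  omap :> forall T p, M T p -> N T p;
  omap_lin : forall T p, linear (@omap T p);
  omap_comp : forall F T S f i (ef : @elementary F T S f i) p q r
    (h : p + q == r) (x : M S p) (y : M F q),
    omap (ocomp ef h x y) = ocomp ef h (omap x) (omap y);
  omap_unit : forall U (hU : trivial U), omap (ounit M hU) = ounit N hU }.

Definition operad_iso k (M N : operad k) : Prop :=
  exists f : operad_mor M N, forall T p, bijective (@omap _ _ _ f T p).

Definition subspace k (V : lmodType k) (I : V -> Prop) : Prop :=
  I 0 /\ forall c x y, I x -> I y -> I (c *: x + y).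

Record is_ideal k (M : operad k) (I : forall T p, M T p -> Prop) : Prop :=
  IsIdeal {
    ideal_sub : forall T p, subspace (@I T p);
    ideal_l : forall F T S f i (ef : @elementary F T S f i) p q r
      (h : p + q == r) x y, I S p x -> I T r (ocomp ef h x y);
    ideal_r : forall F T S f i (ef : @elementary F T S f i) p q r
      (h : p + q == r) x y, I F q y -> I T r (ocomp ef h x y) }.

Definition ideal_gen k (M : operad k) (R : forall T p, M T p -> Prop) T p
    (x : M T p) : Prop :=
  forall I, is_ideal I -> (forall T p y, R T p y -> I T p y) -> I T p x.

Lemma ideal_genP k (M : operad k) (R : forall T p, M T p -> Prop) :
  is_ideal (ideal_gen R).
Proof.
split=> [T p|F T S f i ef p q r h x y Hx I idI RI|F T S f i ef p q r h x y Hy I idI RI].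
- split=> [I idI RI|c x y Hx Hy I idI RI]; first by case: (ideal_sub idI T p).
  by case: (ideal_sub idI T p) => _; apply; [apply: Hx | apply: Hy].
- exact: (ideal_l idI ef h y (Hx I idI RI)).
- exact: (ideal_r idI ef h x (Hy I idI RI)).
Qed.

Section Quotient.
Variables (k : fieldType) (M : operad k) (I : forall T p, M T p -> Prop).
Hypothesis idI : is_ideal I.

Section Component.
Variables (T : per) (p : int).
Implicit Types x y z : M T p.

Definition ieq x y : Prop := I (x - y).

Let I0 : @I T p 0. Proof. by case: (ideal_sub idI T p). Qed.
Let ID c x y : I x -> I y -> I (c *: x + y).
Proof. by case: (ideal_sub idI T p) => _; apply. Qed.
Let IN x : I x -> I (- x).
Proof. by move=> Ix; have := ID (-1) Ix I0; rewrite addr0 scaleN1r. Qed.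

Lemma ieq_eq x y : x = y -> ieq x y.
Proof. by move=> ->; rewrite /ieq subrr. Qed.
Lemma ieq_sym x y : ieq x y -> ieq y x.
Proof. by move=> /IN; rewrite opprB. Qed.
Lemma ieq_trans y x z : ieq x y -> ieq y z -> ieq x z.
Proof. by move=> xy yz; have := ID 1 xy yz; rewrite scale1r addrA subrK. Qed.
Lemma ieq_add x x' y y' : ieq x x' -> ieq y y' -> ieq (x + y) (x' + y').
Proof.
by move=> xx yy; have := ID 1 xx yy; rewrite /ieq scale1r opprD addrACA.
Qed.
Lemma ieq_scale c x x' : ieq x x' -> ieq (c *: x) (c *: x').
Proof. by move=> xx; have := ID c xx I0; rewrite addr0 scalerBr. Qed.

Definition quotient_setoid : lmod_setoid k :=
  @LmodSetoid k (M T p) ieq 0 +%R *:%R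
    (fun x => ieq_eq (erefl x)) ieq_sym ieq_trans ieq_add ieq_scale
    (fun x y z => ieq_eq (addrA x y z)) (fun x y => ieq_eq (addrC x y))
    (fun x => ieq_eq (add0r x)) (fun a b x => ieq_eq (scalerA a b x))
    (fun x => ieq_eq (scale1r x)) (fun a x y => ieq_eq (scalerDr a x y))
    (fun a b x => ieq_eq (scalerDl x a b)) (fun x => ieq_eq (scale0r x)).

End Component.

Definition qoper (T : per) (p : int) : lmodType k := quo (quotient_setoid T p).

Definition qcls T p (x : M T p) : qoper T p := cls (X := quotient_setoid T p) x.
Definition qrep T p (u : qoper T p) : M T p := rep (X := quotient_setoid T p) u.

Definition qcomp F T S f i (ef : @elementary F T S f i) p q r (h : p + q == r)
    (u : qoper S p) (v : qoper F q) : qoper T r :=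
  qcls (ocomp ef h (qrep u) (qrep v)).

Definition qunit U (hU : trivial U) : qoper U 0 := qcls (ounit M hU).

Lemma qclsL T p : linear (@qcls T p).
Proof. by move=> c x y; rewrite -clsZ -clsD. Qed.

Lemma qclsZ T p c (x : M T p) : qcls (c *: x) = c *: qcls x.
Proof. by rewrite -clsZ. Qed.

Lemma qclsW T p (P : qoper T p -> Prop) : (forall x, P (qcls x)) -> forall u, P u.
Proof. exact (@clsW k (quotient_setoid T p) P). Qed.

Lemma qclsP T p (x y : M T p) : qcls x = qcls y <-> I (x - y).
Proof. exact: clsP. Qed.

Lemma qcompE F T S f i (ef : @elementary F T S f i) p q r (h : p + q == r) x y :
  qcomp ef h (qcls x) (qcls y) = qcls (ocomp ef h x y).
Proof.
have subl u v z : ocomp ef h (u - v) z = ocomp ef h u z - ocomp ef h v z.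
  have /= := ocomp_linl ef h z (-1) v u; rewrite !scaleN1r => E.
  by rewrite addrC E addrC.
have subr u v z : ocomp ef h z (u - v) = ocomp ef h z u - ocomp ef h z v.
  have /= := ocomp_linr ef h z (-1) v u; rewrite !scaleN1r => E.
  by rewrite addrC E addrC.
have hx : I (qrep (qcls x) - x) by apply/qclsP/repK.
have hy : I (qrep (qcls y) - y) by apply/qclsP/repK.
apply: (@etrans _ _ (qcls (ocomp ef h x (qrep (qcls y))))); apply/qclsP.
  by rewrite -subl; apply: (ideal_l idI ef h _ hx).
by rewrite -subr; apply: (ideal_r idI ef h _ hy).
Qed.

Definition quotient_operad : operad k.
Proof.
apply: (@Operad k qoper qcomp qunit).
- move=> F T S f i ef p q r h; elim/qclsW => y c; elim/qclsW => x; elim/qclsW => x'.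
  by rewrite -qclsL !qcompE (ocomp_linl ef h y c x x') qclsL.
- move=> F T S f i ef p q r h; elim/qclsW => x c; elim/qclsW => y; elim/qclsW => y'.
  by rewrite -qclsL !qcompE (ocomp_linr ef h x c y y') qclsL.
- move=> F G H T S P f g gf fi j i j' ef eg egf efi gj gfE p q r pq qr d.
  move=> hpq hqr hl hr; elim/qclsW => x; elim/qclsW => y; elim/qclsW => z.
  by rewrite !qcompE (ocompA ef eg egf efi gj gfE hpq hqr hl hr).
- move=> F G T S1 S2 P f1 g1 f2 g2 j i l m ef1 eg1 ef2 eg2 E gi gj im.
  move=> p q r pq pr d hpq hpr h1 h2.
  elim/qclsW => x; elim/qclsW => y; elim/qclsW => z.
  by rewrite !qcompE -(ocompC ef1 eg1 ef2 eg2 E gi gj im hpq hpr h1 h2) qclsZ.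
- move=> T U f i ef hU p h; elim/qclsW => x.
  by rewrite qcompE (ocomp1 ef hU h).
Defined.

End Quotient.

(* The free operad on E: formal linear combinations of formal composites of
   units and elements of E, modulo the least congruence that contains the axioms
   of vector spaces, the linearity of the inclusion of E and the axioms of
   operads. [free_ext_gen] and [free_ext_uniq] are its universal property, and
   [free_one_connected] shows that it is 1-connected if E is. *)
Section Free.
Variables (k : fieldType) (E : per -> int -> lmodType k).

Inductive fterm : per -> int -> Type :=
| FZero T p : fterm T p
| FAdd T p : fterm T p -> fterm T p -> fterm T p
| FScale T p : k -> fterm T p -> fterm T p
| FGen T p : E T p -> fterm T p
| FUnit U : trivial U -> fterm U 0
| FComp F T S (f : mor T S) i : elementary F f i ->
    forall p q r : int, p + q == r -> fterm S p -> fterm F q -> fterm T r.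

Inductive feq : forall T p, fterm T p -> fterm T p -> Prop :=
| feq_refl T p (x : fterm T p) : feq x x
| feq_sym T p (x y : fterm T p) : feq x y -> feq y x
| feq_trans T p (y x z : fterm T p) : feq x y -> feq y z -> feq x z
| feq_add T p (x x' y y' : fterm T p) :
    feq x x' -> feq y y' -> feq (FAdd x y) (FAdd x' y')
| feq_scale T p c (x x' : fterm T p) : feq x x' -> feq (FScale c x) (FScale c x')
| feq_comp F T S f i (ef : @elementary F T S f i) p q r (h : p + q == r)
    x x' y y' : feq x x' -> feq y y' -> feq (FComp ef h x y) (FComp ef h x' y')
| feq_addA T p (x y z : fterm T p) : feq (FAdd x (FAdd y z)) (FAdd (FAdd x y) z)
| feq_addC T p (x y : fterm T p) : feq (FAdd x y) (FAdd y x)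
| feq_add0 T p (x : fterm T p) : feq (FAdd (FZero T p) x) x
| feq_scaleA T p a b (x : fterm T p) :
    feq (FScale a (FScale b x)) (FScale (a * b) x)
| feq_scale1 T p (x : fterm T p) : feq (FScale 1 x) x
| feq_scaleDr T p a (x y : fterm T p) :
    feq (FScale a (FAdd x y)) (FAdd (FScale a x) (FScale a y))
| feq_scaleDl T p a b (x : fterm T p) :
    feq (FScale (a + b) x) (FAdd (FScale a x) (FScale b x))
| feq_scale0 T p (x : fterm T p) : feq (FScale 0 x) (FZero T p)
| feq_gen T p c (x y : E T p) :
    feq (FGen (c *: x + y)) (FAdd (FScale c (FGen x)) (FGen y))
| feq_compl F T S f i (ef : @elementary F T S f i) p q r (h : p + q == r)
    c x x' y : feq (FComp ef h (FAdd (FScale c x) x') y)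
      (FAdd (FScale c (FComp ef h x y)) (FComp ef h x' y))
| feq_compr F T S f i (ef : @elementary F T S f i) p q r (h : p + q == r)
    c x y y' : feq (FComp ef h x (FAdd (FScale c y) y'))
      (FAdd (FScale c (FComp ef h x y)) (FComp ef h x y'))
| feq_compA F G H T S P (f : mor T S) (g : mor S P) (gf : mor T P)
    (fi : mor H G) j i j' (ef : elementary F f j) (eg : elementary G g i)
    (egf : elementary H gf i) (efi : elementary F fi j')
    (p q r pq qr d : int) (hpq : p + q == pq) (hqr : q + r == qr)
    (hl : p + qr == d) (hr : pq + r == d)
    (x : fterm P p) (y : fterm G q) (z : fterm F r) :
    g j = i -> (forall a, gf a = g (f a)) ->
    feq (FComp egf hl x (FComp efi hqr y z)) (FComp ef hr (FComp eg hpq x y) z)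
| feq_compC F G T S1 S2 P (f1 : mor T S1) (g1 : mor S1 P)
    (f2 : mor T S2) (g2 : mor S2 P) j i l m
    (ef1 : elementary F f1 j) (eg1 : elementary G g1 i)
    (ef2 : elementary G f2 l) (eg2 : elementary F g2 m)
    (p q r pq pr d : int) (hpq : p + q == pq) (hpr : p + r == pr)
    (h1 : pr + q == d) (h2 : pq + r == d)
    (x : fterm P p) (y : fterm F q) (z : fterm G r) :
    (forall a, g1 (f1 a) = g2 (f2 a)) -> g2 l = i -> g1 j = m -> i != m ->
    feq (FScale (ksign k (q * r)) (FComp ef1 h1 (FComp eg1 hpr x z) y))
      (FComp ef2 h2 (FComp eg2 hpq x y) z)
| feq_comp1 T U (f : mor T U) i (ef : elementary T f i) (hU : trivial U) p
    (h : 0 + p == p) (x : fterm T p) : feq (FComp ef h (FUnit hU) x) x.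

Definition fterm_setoid (T : per) (p : int) : lmod_setoid k :=
  @LmodSetoid k (fterm T p) (@feq T p) (FZero T p) (@FAdd T p) (@FScale T p)
    (@feq_refl T p) (@feq_sym T p) (@feq_trans T p) (@feq_add T p)
    (@feq_scale T p) (@feq_addA T p) (@feq_addC T p) (@feq_add0 T p)
    (@feq_scaleA T p) (@feq_scale1 T p) (@feq_scaleDr T p) (@feq_scaleDl T p)
    (@feq_scale0 T p).

Definition foper (T : per) (p : int) : lmodType k := quo (fterm_setoid T p).

Definition fcls T p (x : fterm T p) : foper T p := cls (X := fterm_setoid T p) x.
Definition frep T p (u : foper T p) : fterm T p := rep (X := fterm_setoid T p) u.

Definition fcomp F T S f i (ef : @elementary F T S f i) p q r (h : p + q == r)
    (u : foper S p) (v : foper F q) : foper T r :=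
  fcls (FComp ef h (frep u) (frep v)).

Definition funit U (hU : trivial U) : foper U 0 := fcls (FUnit hU).

Definition fgen T p (x : E T p) : foper T p := fcls (FGen x).

Lemma fclsP T p (x y : fterm T p) : fcls x = fcls y <-> feq x y.
Proof. exact: clsP. Qed.

Lemma fclsW T p (P : foper T p -> Prop) : (forall x, P (fcls x)) -> forall u, P u.
Proof. exact (@clsW k (fterm_setoid T p) P). Qed.

Lemma fclsL T p c (x y : fterm T p) :
  fcls (FAdd (FScale c x) y) = c *: fcls x + fcls y.
Proof. by rewrite -clsZ -clsD. Qed.

Lemma fcompE F T S f i (ef : @elementary F T S f i) p q r (h : p + q == r) x y :
  fcomp ef h (fcls x) (fcls y) = fcls (FComp ef h x y).
Proof. by apply/fclsP/feq_comp; apply/fclsP/repK. Qed.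

Lemma fgen_lin T p : linear (@fgen T p).
Proof. by move=> c x y; rewrite -fclsL; apply/fclsP/feq_gen. Qed.

Definition free_operad : operad k.
Proof.
apply: (@Operad k foper fcomp funit).
- move=> F T S f i ef p q r h; elim/fclsW => y c; elim/fclsW => x; elim/fclsW => x'.
  by rewrite -fclsL !fcompE -fclsL; apply/fclsP/feq_compl.
- move=> F T S f i ef p q r h; elim/fclsW => x c; elim/fclsW => y; elim/fclsW => y'.
  by rewrite -fclsL !fcompE -fclsL; apply/fclsP/feq_compr.
- move=> F G H T S P f g gf fi j i j' ef eg egf efi gj gfE p q r pq qr d.
  move=> hpq hqr hl hr; elim/fclsW => x; elim/fclsW => y; elim/fclsW => z.
  by rewrite !fcompE; apply/fclsP/feq_compA.
- move=> F G T S1 S2 P f1 g1 f2 g2 j i l m ef1 eg1 ef2 eg2 E0 gi gj im.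
  move=> p q r pq pr d hpq hpr h1 h2.
  elim/fclsW => x; elim/fclsW => y; elim/fclsW => z.
  by rewrite !fcompE -clsZ; apply/fclsP/feq_compC.
- move=> T U f i ef hU p h; elim/fclsW => x.
  by rewrite fcompE; apply/fclsP/feq_comp1.
Defined.

Section Extension.
Variables (M : operad k) (g : forall T p, E T p -> M T p).
Hypothesis g_lin : forall T p, linear (@g T p).

Fixpoint finterp T p (x : fterm T p) : M T p :=
  match x with
  | FZero T p => 0
  | FAdd T p x y => finterp x + finterp y
  | FScale T p c x => c *: finterp x
  | FGen T p x => g x
  | FUnit U hU => ounit M hU
  | FComp F T _ f i ef p q r h x y => ocomp ef h (finterp x) (finterp y)
  end.

Lemma finterp_eq T p (x y : fterm T p) : feq x y -> finterp x = finterp y.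
Proof.
elim=> {T p x y} //=.
- by move=> T p y x z _ -> _ ->.
- by move=> T p x x' y y' _ -> _ ->.
- by move=> T p c x x' _ ->.
- by move=> F T S f i ef p q r h x x' y y' _ -> _ ->.
- by move=> *; rewrite addrA.
- by move=> *; rewrite addrC.
- by move=> *; rewrite add0r.
- by move=> *; rewrite scalerA.
- by move=> *; rewrite scale1r.
- by move=> *; rewrite scalerDr.
- by move=> *; rewrite scalerDl.
- by move=> *; rewrite scale0r.
- by move=> F T S f i ef p q r h c x x' y; apply: (ocomp_linl ef h _ c).
- by move=> F T S f i ef p q r h c x y y'; apply: (ocomp_linr ef h _ c).
- by move=> *; apply: ocompA.
- by move=> *; apply: ocompC.
- by move=> *; apply: ocomp1.
Qed.

Definition fext T p (u : free_operad T p) : M T p := finterp (frep u).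

Lemma fextE T p (x : fterm T p) : fext (fcls x) = finterp x.
Proof. by apply/finterp_eq/fclsP/repK. Qed.

Definition free_ext : operad_mor free_operad M.
Proof.
apply: (@OperadMor k free_operad M fext).
- move=> T p c; elim/fclsW => x; elim/fclsW => y.
  by rewrite -fclsL !fextE.
- move=> F T S f i ef p q r h; elim/fclsW => x; elim/fclsW => y.
  by rewrite [ocomp _ _ _ _]fcompE !fextE.
- by move=> U hU; rewrite [ounit _ _]/(fcls _) fextE.
Defined.

Lemma free_ext_gen T p (x : E T p) : free_ext T p (fgen x) = g x.
Proof. exact: fextE. Qed.

Lemma free_ext_uniq (f : operad_mor free_operad M) :
  (forall T p (x : E T p), f T p (fgen x) = g x) ->
  forall T p u, f T p u = free_ext T p u.
Proof.
move=> fg T p; elim/fclsW => x; rewrite [RHS]fextE.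
elim: x => {T p} /=.
- by move=> T p; apply: (lin0 (omap_lin f (T := T) (p := p))).
- move=> T p x IHx y IHy; rewrite -IHx -IHy -[f _ _ (fcls x)]scale1r.
  by rewrite -omap_lin scale1r -clsD.
- move=> T p c x IHx; rewrite -IHx.
  by rewrite -(lin_scale (omap_lin f (T := T) (p := p))) -clsZ.
- by move=> T p x; apply: fg.
- by move=> U hU; rewrite -(omap_unit f).
- move=> F T S f0 i ef p q r h x IHx y IHy.
  by rewrite -IHx -IHy -omap_comp [ocomp _ _ _ _]fcompE.
Qed.

End Extension.

Inductive fweight : nat -> forall T p, free_operad T p -> Prop :=
| fweight_zero n T p : fweight n (0 : free_operad T p)
| fweight_lin n T p c (x y : free_operad T p) :
    fweight n x -> fweight n y -> fweight n (c *: x + y)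
| fweight_unit U (hU : trivial U) : fweight 0 (ounit free_operad hU)
| fweight_gen T p (x : E T p) : fweight 1 (fgen x : free_operad T p)
| fweight_comp n m F T S f i (ef : @elementary F T S f i) p q r (h : p + q == r)
    (x : free_operad S p) (y : free_operad F q) :
    fweight n x -> fweight m y -> fweight (n + m) (ocomp ef h x y).

End Free.

Record collection1 (k : fieldType) := Collection1 {
  coll1 :> per -> int -> lmodType k;
  coll1_triv : forall T p (x : coll1 T p), grade T = 0%N -> x = 0 }.

Record quadratic_data (k : fieldType) := QuadraticData {
  qgen : collection1 k;
  qrel : forall T p, free_operad qgen T p -> Prop;
  qrel_sub : forall T p, subspace (@qrel T p);
  qrel_weight : forall T p (x : free_operad qgen T p), qrel x -> fweight 2 x }.

Definition presented k (D : quadratic_data k) : operad k :=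
  quotient_operad (ideal_genP (@qrel k D)).

Definition presents k (D : quadratic_data k) (M : operad k) : Prop :=
  operad_iso (presented D) M.

Definition binary k (D : quadratic_data k) : Prop :=
  forall T p (x : qgen D T p), x <> 0 -> grade T = 1%N.

Definition binary_quadratic k (M : operad k) : Prop :=
  one_connected M /\ exists D, binary D /\ presents D M.

Section WeightTwo.
Variables (k : fieldType) (E : collection1 k).

(* The elementary tensor x (x) y in the summand of F^2(E)(X) indexed by the
   elementary morphism [t2map]. *)
Record tens2 (X : per) (p : int) := Tens2 {
  t2fib : per;
  t2tgt : per;
  t2map : mor X t2tgt;
  t2idx : 'I_(card t2tgt);
  t2elem : elementary t2fib t2map t2idx;
  t2tgt_grade : (0 < grade t2tgt)%N;
  t2degx : int;
  t2degy : int;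
  t2deg : t2degy + t2degx == p;
  t2x : E t2fib t2degx;
  t2y : E t2tgt t2degy }.

(* F^2(E)(X) is the direct sum of the E(t_1) (x) E(t_2), and x (x) y stands for
   (-1)^(|x||y|) o_tau(y (x) x). *)
Definition realize X p (u : seq (tens2 X p)) : free_operad E X p :=
  \sum_(t <- u) ksign k (t2degx t * t2degy t) *:
    ocomp (o := free_operad E) (t2elem t) (t2deg t) (fgen (t2y t)) (fgen (t2x t)).

End WeightTwo.

Section KoszulDual.
Variable k : fieldType.

(* The suspension of the graded dual: (^E* )_p = (E_(p-1))^*. *)
Definition sdual_fun (E : collection1 k) (T : per) (p : int) : lmodType k :=
  dual (E T (p - 1)).

Lemma sdual_triv (E : collection1 k) T p (x : sdual_fun E T p) :
  grade T = 0%N -> x = 0.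
Proof.
move=> T0; apply/val_inj/funext => y.
rewrite (coll1_triv y T0) [RHS]/=.
case: x => x /= /asboolP lx.
exact: (lin0 lx).
Qed.

Definition sdual (E : collection1 k) : collection1 k :=
  Collection1 (@sdual_triv E).

(* Evaluation of a suspended form on a vector, zero unless they live on the same
   component of E. *)
Definition seval (E : collection1 k) T p (f : sdual E T p) S q (x : E S q) : k :=
  match pselect ((S, q) = (T, p - 1)) with
  | left e => (f : dual (E T (p - 1)))
      (ecast z (E z.1 z.2 : Type) e x)
  | right _ => 0
  end.

(* [t2tgt] determines the elementary morphism, so summands of distinct
   morphisms are orthogonal. The sign is the one that moves x past g in
   (f (x) g) (x (x) y). *)
Definition pair1 (E : collection1 k) X p q
    (u : tens2 (sdual E) X p) (v : tens2 E X q) : k :=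
  ksign k (t2degy u * t2degx v) *
    (seval (t2x u) (t2x v) * seval (t2y u) (t2y v)).

Definition pairing (E : collection1 k) X p q
    (u : seq (tens2 (sdual E) X p)) (v : seq (tens2 E X q)) : k :=
  \sum_(s <- u) \sum_(t <- v) pair1 s t.

Definition annihilator (D : quadratic_data k) X p
    (w : free_operad (sdual (qgen D)) X p) : Prop :=
  exists2 u : seq (tens2 (sdual (qgen D)) X p), w = realize u &
    forall q (v : seq (tens2 (qgen D) X q)), qrel (realize v) -> pairing u v = 0.

End KoszulDual.

Section QuadraticDual.
Variables (k : fieldType).

Definition tens2_scale (E : collection1 k) X p (c : k) (t : tens2 E X p) :
    tens2 E X p :=
  Tens2 (t2elem t) (t2tgt_grade t) (t2deg t) (c *: t2x t) (t2y t).

Lemma realize_scale (E : collection1 k) X p c (u : seq (tens2 E X p)) :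
  realize (map (tens2_scale c) u) = c *: realize u.
Proof.
rewrite /realize big_map scaler_sumr; apply: eq_bigr => t _ /=.
have Z T q (x : E T q) : fgen (c *: x) = c *: fgen x :> free_operad E T q.
  exact: (lin_scale (@fgen_lin k E T q)).
rewrite Z; have E1 := ocompZr (M := free_operad E) (t2elem t) (t2deg t) c.
by apply: (etrans (congr1 _ (E1 _ _))); rewrite !scalerA mulrC.
Qed.

Lemma realize_cat (E : collection1 k) X p (u v : seq (tens2 E X p)) :
  realize (u ++ v) = realize u + realize v.
Proof. exact: big_cat. Qed.

Lemma realize_weight (E : collection1 k) X p (u : seq (tens2 E X p)) :
  fweight 2 (realize u).
Proof.
rewrite /realize; elim: u => [|t u IHu]; first by rewrite big_nil; constructor.
rewrite big_cons; apply: fweight_lin => //.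
by apply: (fweight_comp (n := 1) (m := 1)); constructor.
Qed.

Lemma pairing_scale (E : collection1 k) X p q c
    (u : seq (tens2 (sdual E) X p)) (v : seq (tens2 E X q)) :
  pairing (map (tens2_scale c) u) v = c * pairing u v.
Proof.
rewrite /pairing big_map big_distrr; apply: eq_bigr => s _ /=.
rewrite big_distrr; apply: eq_bigr => t _ /=; rewrite /pair1 /= [RHS]mulrCA.
congr (_ * _); rewrite mulrA; congr (_ * _); rewrite /seval.
by case: pselect => [e|_]; rewrite ?mulr0.
Qed.

Lemma pairing_cat (E : collection1 k) X p q
    (u v : seq (tens2 (sdual E) X p)) (w : seq (tens2 E X q)) :
  pairing (u ++ v) w = pairing u w + pairing v w.
Proof. exact: big_cat. Qed.

Lemma annihilator_sub (D : quadratic_data k) X p :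
  subspace (@annihilator k D X p).
Proof.
split=> [|c x y [u -> Hu] [v -> Hv]].
  by exists [::] => [|q v _]; rewrite /realize /pairing big_nil.
exists (map (tens2_scale c) u ++ v); first by rewrite realize_cat realize_scale.
by move=> q w Rw; rewrite pairing_cat pairing_scale Hu // Hv // mulr0 addr0.
Qed.

Lemma annihilator_weight (D : quadratic_data k) X p
    (x : free_operad (sdual (qgen D)) X p) : annihilator x -> fweight 2 x.
Proof. by case=> u -> _; apply: realize_weight. Qed.

Definition dual_data (D : quadratic_data k) : quadratic_data k :=
  QuadraticData (@annihilator_sub D) (@annihilator_weight D).

Definition koszul_dual (D : quadratic_data k) : operad k :=
  presented (dual_data D).

End QuadraticDual.

(* [line b] is k if b and 0 otherwise. *)
Section Line.
Variable k : fieldType.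

Definition line (b : bool) : lmodType k := 'rV[k]_b.
Definition coef b (x : line b) : k := \sum_j (x : 'rV_b) 0 j.
Definition scal b (c : k) : line b := const_mx c : 'rV_b.

Lemma coefK b : cancel (@coef b) (@scal b).
Proof.
case: b => x; apply/rowP => j; last by case: j.
by rewrite mxE /coef big_ord1 (ord1 j).
Qed.

Lemma scalK (c : k) : coef (scal true c) = c.
Proof. by rewrite /coef big_ord1 mxE. Qed.

Lemma coef_false (x : line false) : coef x = 0.
Proof. exact: big_ord0. Qed.

Lemma coef_scal0 b : coef (scal b 0) = 0.
Proof. by rewrite /coef big1 // => j _; rewrite mxE. Qed.

Lemma coef_lin b : linear (@coef b : line b -> k^o).
Proof.
move=> c x y; rewrite /coef scaler_sumr -big_split.
by apply: eq_bigr => j _; rewrite !mxE.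
Qed.

Lemma scal_lin b : linear (@scal b : k^o -> line b).
Proof. by move=> c x y; apply/rowP => j; rewrite !mxE. Qed.

End Line.

Section Terminal.
Variable k : fieldType.

Definition toper (T : per) (p : int) : lmodType k := line k (p == 0).

Definition tcomp F T S f i (ef : @elementary F T S f i) p q r (h : p + q == r)
    (x : toper S p) (y : toper F q) : toper T r := scal _ (coef x * coef y).

Definition tunit U (hU : trivial U) : toper U 0 := scal _ 1.

Lemma coef_scal_comp (p q r : int) (h : p + q == r) (x : line k (p == 0))
    (y : line k (q == 0)) :
  coef (scal (r == 0) (coef x * coef y)) = coef x * coef y.
Proof.
move: x y; case: (p =P 0) => [p0|_] x y; last by rewrite coef_false mul0r coef_scal0.
case: (q =P 0) y => [q0|_] y; last by rewrite coef_false mulr0 coef_scal0.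
by rewrite -(eqP h) p0 q0 addr0 eqxx scalK.
Qed.

Lemma coef_deg (p : int) (p0 : p != 0) (x : line k (p == 0)) : coef x = 0.
Proof. by move: x; rewrite (negPf p0) => x; apply: coef_false. Qed.

Definition terminal : operad k.
Proof.
apply: (@Operad k toper tcomp tunit).
- move=> F T S f i ef p q r h y c x x'; rewrite /tcomp.
  by have -> := coef_lin c x x'; rewrite mulrDl -mulrA; apply: scal_lin.
- move=> F T S f i ef p q r h x c y y'; rewrite /tcomp.
  by have -> := coef_lin c y y'; rewrite mulrDr mulrCA; apply: scal_lin.
- move=> F G H T S P f g gf fi j i j' ef eg egf efi gj gfE p q r pq qr d.
  move=> hpq hqr hl hr x y z; rewrite /tcomp.
  by rewrite (coef_scal_comp hpq) (coef_scal_comp hqr) mulrA.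
- move=> F G T S1 S2 P f1 g1 f2 g2 j i l m ef1 eg1 ef2 eg2 E0 gi gj im.
  move=> p q r pq pr d hpq hpr h1 h2 x y z; rewrite /tcomp.
  rewrite (coef_scal_comp hpq) (coef_scal_comp hpr).
  have [q0|/eqP q0] := pselect (q = 0); first
    by rewrite [q in ksign k (q * r)]q0 mul0r scale1r mulrAC.
  have -> := coef_deg q0 y.
  by rewrite !mulr0 mul0r; apply/rowP => a; rewrite !mxE mulr0.
- move=> T U f i ef hU p h x; rewrite /tcomp /tunit scalK mul1r; exact: coefK.
Defined.

Definition tone (T : per) : terminal T 0 := scal _ 1.

Definition tgen_fun (T : per) (p : int) : lmodType k :=
  line k ((card T == 2%N) && (p == 0)).

Lemma tgen_triv T p (x : tgen_fun T p) : grade T = 0%N -> x = 0.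
Proof.
rewrite /grade => T0; apply/rowP => -[j jp]; exfalso; move: jp.
by case: (card T) T0 => [|[|?]].
Qed.

Definition tgen : collection1 k := Collection1 tgen_triv.

Definition tincl T p (x : tgen T p) : terminal T p := scal _ (coef x).

Lemma tincl_lin T p : linear (@tincl T p).
Proof. by move=> c x y; rewrite /tincl; have -> := coef_lin c x y; apply: scal_lin. Qed.

Definition tproj : operad_mor (free_operad tgen) terminal := free_ext tincl_lin.

Definition trel T p (x : free_operad tgen T p) : Prop :=
  fweight 2 x /\ tproj T p x = 0.

Lemma trel_sub T p : subspace (@trel T p).
Proof.
split=> [|c x y [wx x0] [wy y0]].
  split; first by constructor.
  exact: (lin0 (omap_lin tproj (T := T) (p := p))).
split; first by constructor.
by rewrite (omap_lin tproj) x0 y0 scaler0 addr0.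
Qed.

Lemma trel_weight T p (x : free_operad tgen T p) : trel x -> fweight 2 x.
Proof. by case. Qed.

Definition terminal_data : quadratic_data k :=
  QuadraticData trel_sub trel_weight.

(* The generator ^1* of the Koszul dual, where 1* : k -> k is the identity. *)
Definition one_dual (T : per) : sdual tgen T 1.
Proof.
apply: (@Dual k (tgen T (1 - 1)) (@coef k _)).
by apply/asboolP/coef_lin.
Defined.

Definition dual_gen (T : per) : koszul_dual terminal_data T 1 :=
  qcls (ideal_genP (@annihilator k terminal_data)) (fgen (one_dual T)).

End Terminal.

Lemma elementary_trivial F T S (f : mor T S) i : elementary F f i -> ~~ trivial T.
Proof.
case=> -> g0 _; apply/negP => /eqP T1; move: g0; rewrite /grade /=.
set A := [set x | f x == i]; have := max_card (mem A); rewrite card_ord.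
by move: #|A| => m; rewrite T1; case: m => [|[|?]].
Qed.

Lemma free_one_connected k (E : collection1 k) : one_connected (free_operad E).
Proof.
move=> U hU; pose W p (u : free_operad E U p) := (p != 0 -> u = 0) /\
  forall e : 0 = p, exists c : k,
    u = ecast z (free_operad E U z : Type) e (c *: ounit (free_operad E) hU).
have Wsub p : subspace (@W p).
  split=> [|c x y [x0 xc] [y0 yc]].
    split=> // e; exists 0; case: p / e; rewrite scale0r //.
  split=> [p0|e]; first by rewrite x0 // y0 // scaler0 addr0.
  have [a ->] := xc e; have [b ->] := yc e; exists (c * a + b).
  by case: p / e {x0 xc y0 yc x y} => /=; rewrite scalerDl scalerA.
have gen T p (u : fterm E T p) : trivial T ->
    forall V : forall p, free_operad E T p -> Prop, (forall p, subspace (@V p)) ->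
    (forall hT : trivial T, V 0 (ounit (free_operad E) hT)) -> V p (fcls u).
  elim: u => {T p}.
  - by move=> T p hT V Vsub _; case: (Vsub p).
  - move=> T p x IHx y IHy hT V Vsub V1; case: (Vsub p) => _ VD.
    by have := VD 1 _ _ (IHx hT V Vsub V1) (IHy hT V Vsub V1); rewrite scale1r -clsD.
  - move=> T p c x IHx hT V Vsub V1; case: (Vsub p) => V0 VD.
    by have := VD c _ _ (IHx hT V Vsub V1) V0; rewrite addr0 -clsZ.
  - move=> T p x hT V Vsub V1.
    have -> : x = 0 by apply: coll1_triv; rewrite /grade (eqP hT).
    rewrite (_ : fcls _ = 0 :> free_operad E T p); first by case: (Vsub p).
    exact: (lin0 (@fgen_lin k E T p)).
  - by move=> T hT _ V Vsub V1; apply: V1.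
  - move=> F T S f i ef p q r h x _ y _ hT.
    by case/negP: (elementary_trivial ef).
have WP p (u : free_operad E U p) : W p u.
  rewrite -[u]repK; apply: (gen U p (frep u) hU W Wsub) => hT; split=> // e.
  exists 1; rewrite scale1r (eq_irrelevance e (erefl _)) /=.
  by rewrite (bool_irrelevance hT hU).
split=> [|p u p0]; last by case: (WP p u) => ->.
have inj c : c *: ounit (free_operad E) hU = 0 -> c = 0.
  pose z T p (x : E T p) : terminal k T p := 0.
  have zl T p : linear (@z T p) by move=> a x y; rewrite /z scaler0 addr0.
  move/(congr1 (free_ext zl U 0)).
  rewrite (lin_scale (omap_lin (free_ext zl) (T := U) (p := 0))) omap_unit.
  rewrite (lin0 (omap_lin (free_ext zl) (T := U) (p := 0))).
  move/(congr1 (@coef k _)); rewrite (lin_scale (@coef_lin k _)).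
  by rewrite (lin0 (@coef_lin k _)) scalK [c *: _]mulr1.
have surj (u : free_operad E U 0) : exists c : k, u = c *: ounit (free_operad E) hU.
  by case: (WP 0 u) => _ /(_ (erefl 0)).
exists (fun u => projT1 (cid (surj u))) => [c|u].
  case: cid => a /= E1; apply/eqP; rewrite -subr_eq0; apply/eqP/inj.
  by rewrite scalerBl -E1 subrr.
by case: cid.
Qed.

Record category := Category {
  obj :> Type;
  hom : obj -> obj -> Type;
  idm : forall A, hom A A;
  cmp : forall A B C, hom A B -> hom B C -> hom A C;
  cmp_idl : forall A B (f : hom A B), cmp (idm A) f = f;
  cmp_idr : forall A B (f : hom A B), cmp f (idm B) = f;
  cmpA : forall A B C D (f : hom A B) (g : hom B C) (h : hom C D),
    cmp f (cmp g h) = cmp (cmp f g) h }.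

Record functor (C D : category) := Functor {
  fobj :> C -> D;
  fmap : forall A B, hom A B -> hom (fobj A) (fobj B);
  fmap_id : forall A, fmap (idm A) = idm (fobj A);
  fmap_cmp : forall A B E (f : hom A B) (g : hom B E),
    fmap (cmp f g) = cmp (fmap f) (fmap g) }.

(* Isomorphism in the strict sense, not equivalence. *)
Definition cat_iso (C D : category) (F : functor C D) : Prop :=
  bijective F /\ forall A B, bijective (@fmap C D F A B).

Definition posn : Type := {n : nat | (0 < n)%N}.

Section Collections.
Variable k : fieldType.

Definition coll : Type := posn -> int -> lmodType k.

Record cmap (P Q : coll) := Cmap {
  cfun :> forall n d, P n d -> Q n d;
  cfun_lin : forall n d, linear (@cfun n d) }.

Lemma cmap_eq (P Q : coll) (f g : cmap P Q) :
  (forall n d x, f n d x = g n d x) -> f = g.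
Proof.
move=> fg; have fg' : cfun f = cfun g.
  by apply: functional_extensionality_dep => n;
     apply: functional_extensionality_dep => d; apply/funext.
by case: f g {fg} fg' => [f lf] [g lg] /= E; subst g;
   congr Cmap; apply: Prop_irrelevance.
Qed.

Definition cmap_id (P : coll) : cmap P P.
Proof. by exists (fun n d x => x). Defined.

Definition cmap_cmp (P Q S : coll) (f : cmap P Q) (g : cmap Q S) : cmap P S.
Proof.
exists (fun n d x => g n d (f n d x)) => n d c x y.
by rewrite (cfun_lin f) (cfun_lin g).
Defined.

Definition coll_cat : category.
Proof.
by apply: (@Category coll cmap cmap_id cmap_cmp) => *; apply: cmap_eq.
Defined.

Definition id_functor : functor coll_cat coll_cat.
Proof. by apply: (@Functor coll_cat coll_cat id (fun P Q f => f)). Defined.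

(* Suspension (^P)(n)_d = P(n)_(d-1); an element x of P(n)_(d-1) is the same as
   the element ^x of (^P)(n)_d. *)
Definition susp (P : coll) : coll := fun n d => P n (d - 1).

Definition susp_map (P Q : coll) (f : cmap P Q) : cmap (susp P) (susp Q) :=
  @Cmap (susp P) (susp Q) (fun n d => f n (d - 1)) (fun n d => cfun_lin f (d := d - 1)).

Definition susp_functor : functor coll_cat coll_cat.
Proof.
by apply: (@Functor coll_cat coll_cat susp susp_map) => *; apply: cmap_eq.
Defined.

Record structure := Structure {
  str : coll -> Type;
  smor : forall P Q : coll, str P -> str Q -> cmap P Q -> Prop;
  smor_id : forall P (s : str P), smor s s (cmap_id P);
  smor_cmp : forall P Q S (s : str P) (t : str Q) (u : str S) f g,
    smor s t f -> smor t u g -> smor s u (cmap_cmp f g) }.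

Record sobj (C : structure) := Sobj { scoll : coll; sstr : str C scoll }.

Record shom (C : structure) (A B : sobj C) := Shom {
  shom_map : cmap (scoll A) (scoll B);
  shomP : smor (sstr A) (sstr B) shom_map }.

Lemma shom_eq (C : structure) (A B : sobj C) (f g : shom A B) :
  shom_map f = shom_map g -> f = g.
Proof.
by case: f g => [f hf] [g hg] /= E; subst g; congr Shom; apply: Prop_irrelevance.
Qed.

Definition cat_of (C : structure) : category.
Proof.
apply: (@Category (sobj C) (@shom C) (fun A => Shom (smor_id (sstr A)))
  (fun A B D f g => Shom (smor_cmp (shomP f) (shomP g)))) => *;
by apply: shom_eq; apply: cmap_eq.
Defined.

(* A functor between categories of structures that is K on the underlying
   collections and maps. *)
Definition struct_functor (K : functor coll_cat coll_cat) (C D : structure)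
    (phi : forall P, str C P -> str D (K P))
    (phiP : forall P Q (s : str C P) (t : str C Q) (f : cmap P Q),
      smor s t f -> smor (phi P s) (phi Q t) (@fmap _ _ K P Q f)) :
  functor (cat_of C) (cat_of D).
Proof.
pose F0 (A : sobj C) : sobj D := Sobj (phi (scoll A) (sstr A)).
pose F1 (A B : sobj C) (f : shom A B) : shom (F0 A) (F0 B) :=
  @Shom D (F0 A) (F0 B) (@fmap _ _ K _ _ (shom_map f)) (phiP _ _ _ _ _ (shomP f)).
apply: (@Functor (cat_of C) (cat_of D) F0 F1) => *.
- by apply: shom_eq; apply: (fmap_id K).
- by apply: shom_eq; apply: (fmap_cmp K).
Defined.

Record elt (P : coll) := Elt { earity : posn; edeg : int; evec : P earity edeg }.

Definition emap (P Q : coll) (f : cmap P Q) (e : elt P) : elt Q :=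
  Elt (f (earity e) (edeg e) (evec e)).

Definition tdeg (P : coll) (a : seq (elt P)) : int := \sum_(e <- a) edeg e.

(* [a] lies in P(n_1) (x) ... (x) P(n_k) and n is the arity of T. *)
Definition fits (T : per) (P : coll) (a : seq (elt P)) (n : posn) : bool :=
  ([seq sval (earity e) | e <- a] == [seq fib T i | i <- iota 0 (card T)])
    && (ar T == sval n).

(* [act] is the value of alpha_T on m (x) a_1 (x) ... (x) a_k. In [act_comp],
   the fibers of f over l != i are singletons and f is monotone, so the preimage
   of i consists of the |F| letters that follow the first i letters. *)
Record alg_str (M : operad k) (P : coll) := AlgStr {
  act : forall (T : per) (a : seq (elt P)) (n : posn), fits T a n ->
    forall p d : int, p + tdeg a == d -> M T p -> P n d;
  act_linl : forall T a n (ha : fits T a n) p d (hd : p + tdeg a == d),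
    linear (act ha hd);
  act_linr : forall T a1 a2 n n' d' c (x y : P n' d')
    (hxy : fits T (a1 ++ Elt (c *: x + y) :: a2) n)
    (hx : fits T (a1 ++ Elt x :: a2) n) (hy : fits T (a1 ++ Elt y :: a2) n)
    p d (dxy : p + tdeg (a1 ++ Elt (c *: x + y) :: a2) == d)
    (dx : p + tdeg (a1 ++ Elt x :: a2) == d)
    (dy : p + tdeg (a1 ++ Elt y :: a2) == d) (m : M T p),
    act hxy dxy m = c *: act hx dx m + act hy dy m;
  act_unit : forall U (hU : trivial U) n d (x : P n d)
    (hx : fits U [:: Elt x] n) (hd : 0 + tdeg [:: Elt x] == d),
    act hx hd (ounit M hU) = x;
  act_comp : forall F T S (f : mor T S) i (ef : elementary F f i)
    p q r (h : p + q == r) (m : M S p) (m' : M F q)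
    a1 b a2 n nF d dF (hT : fits T (a1 ++ b ++ a2) n) (hF : fits F b nF)
    (dT : r + tdeg (a1 ++ b ++ a2) == d) (dF' : q + tdeg b == dF)
    (hS : fits S (a1 ++ Elt (act hF dF' m') :: a2) n)
    (dS : p + tdeg (a1 ++ Elt (act hF dF' m') :: a2) == d),
    size a1 = i ->
    act hT dT (ocomp ef h m m')
      = ksign k (q * tdeg a1) *: act hS dS m }.

Definition alg_mor (M : operad k) (P Q : coll) (s : alg_str M P)
    (t : alg_str M Q) (f : cmap P Q) : Prop :=
  forall T a n (ha : fits T a n) (hfa : fits T (map (emap f) a) n)
    p d (hd : p + tdeg a == d) (hfd : p + tdeg (map (emap f) a) == d) (m : M T p),
    f n d (act s ha hd m) = act t hfa hfd m.

Lemma emap_fits (P Q : coll) (f : cmap P Q) T a n :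
  fits T (map (emap f) a) n = fits T a n.
Proof. by rewrite /fits -map_comp. Qed.

Lemma emap_tdeg (P Q : coll) (f : cmap P Q) a :
  tdeg (map (emap f) a) = tdeg a.
Proof. by rewrite /tdeg big_map. Qed.

Lemma act_eq (M : operad k) (P : coll) (s : alg_str M P) T a a' n
    (ha : fits T a n) (ha' : fits T a' n) p d (hd : p + tdeg a == d)
    (hd' : p + tdeg a' == d) (m : M T p) :
  a = a' -> act s ha hd m = act s ha' hd' m.
Proof.
move=> E; subst a'; by rewrite (bool_irrelevance ha ha') (bool_irrelevance hd hd').
Qed.

Definition alg (M : operad k) : structure.
Proof.
apply: (@Structure (alg_str M) (@alg_mor M)).
- move=> P s T a n ha hfa p d hd hfd m; apply: act_eq.
  by rewrite -[LHS]map_id; apply: eq_map => -[].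
- move=> P Q S s t u f g sf tg T a n ha hfa p d hd hfd m.
  have ha' : fits T (map (emap f) a) n by rewrite emap_fits.
  have hd' : p + tdeg (map (emap f) a) == d by rewrite emap_tdeg.
  have ha2 : fits T (map (emap g) (map (emap f) a)) n by rewrite emap_fits.
  have hd2 : p + tdeg (map (emap g) (map (emap f) a)) == d by rewrite emap_tdeg.
  rewrite /= (sf _ _ _ _ ha' _ _ _ hd') (tg _ _ _ _ ha2 _ _ _ hd2).
  by apply: act_eq; rewrite -map_comp.
Defined.

Definition binary_arity (r : per) (n1 n2 n : posn) : bool :=
  [&& card r == 2%N, fib r 0 == sval n1, fib r 1 == sval n2 & ar r == sval n].

Definition is_composite (h : nat -> nat) (a t : per) : Prop :=
  ar t = ar a /\
  forall (x : 'I_(ar a)) (y : 'I_(ar t)), x = y :> nat -> sur t y = h (sur a x) :> nat.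

(* In [pcircA], [predn] and [minn 1] are the maps 3 -> 2 that identify the first
   two letters 0, 1 and the last two letters 1, 2. *)
Record perm_str (P : coll) := PermStr {
  pcirc : forall (r : per) (n1 n2 n : posn), binary_arity r n1 n2 n ->
    forall p q d : int, p + q == d -> P n1 p -> P n2 q -> P n d;
  pcirc_linl : forall r n1 n2 n (hr : binary_arity r n1 n2 n) p q d
    (hd : p + q == d) (y : P n2 q), linear (fun x => pcirc hr hd x y);
  pcirc_linr : forall r n1 n2 n (hr : binary_arity r n1 n2 n) p q d
    (hd : p + q == d) (x : P n1 p), linear (fun y => pcirc hr hd x y);
  pcircA : forall (a s t u v : per)
    (a12 : [set i : 'I_(card a) | (i < 2)%N] != set0)
    (a23 : [set i : 'I_(card a) | (0 < i)%N] != set0)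
    n1 n2 n3 n12 n23 n
    (hs : binary_arity s n1 n2 n12) (ht : binary_arity t n12 n3 n)
    (hu : binary_arity u n1 n23 n) (hv : binary_arity v n2 n3 n23)
    p q r pq qr d (hpq : p + q == pq) (hqr : q + r == qr)
    (hl : pq + r == d) (hr : p + qr == d)
    (x : P n1 p) (y : P n2 q) (z : P n3 r),
    card a = 3%N -> s = restr a12 -> is_composite predn a t ->
    is_composite (minn 1) a u -> v = restr a23 ->
    pcirc ht hl (pcirc hs hpq x y) z = pcirc hu hr x (pcirc hv hqr y z) }.

Definition perm_mor (P Q : coll) (s : perm_str P) (t : perm_str Q)
    (f : cmap P Q) : Prop :=
  forall r n1 n2 n (hr : binary_arity r n1 n2 n) p q d (hd : p + q == d) x y,
    f n d (pcirc s hr hd x y) = pcirc t hr hd (f n1 p x) (f n2 q y).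

Definition permutad : structure.
Proof.
apply: (@Structure perm_str perm_mor) => //.
by move=> P Q S s t u f g sf tg r n1 n2 n hr p q d hd x y; rewrite /= sf tg.
Defined.

End Collections.

(* Main.v *)
(* Writing an object n ->> k of Per as a word of length n in the letters
   0, ..., k - 1, an elementary map collapses an interval of letters, and all
   identities between such maps become identities between maps of nat.

   An algebra over M is an operad morphism from M to the endomorphism operad of
   the collection, so algebras over M are determined by the universal property
   of M. For a family g of elements indexed by the objects with two letters,
   the only condition that matters is the comparison, for each object T with
   three letters, of the composites along its two elementary quotients:
   o_0 (g, g) = (-1)^e o_1 (g, g), where e is the degree of g.

   The terminal operad is freely generated subject to this condition with e = 0.
   This is a coherence theorem: modulo the condition every composite of
   generators equals a left-nested one, by induction on the number of letters.
   For the Koszul dual e = 1, because the relations of the terminal operad on T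
   are spanned by the difference of the two composites, so that the annihilator
   is spanned by their sum. In the endomorphism operad the condition is
   associativity, with the sign (-1)^(e (1 + |x|)) that is absorbed, for e = 1,
   by x o y = (-1)^|x| m(x, y) on the suspended collection. *)

From HB Require Import structures.
From mathcomp Require Import all_boot all_order all_algebra.
From mathcomp Require Import boolp zify.
Require Import Defs.

Set Implicit Arguments.
Unset Strict Implicit.
Unset Printing Implicit Defensive.

Import GRing.Theory.

(** * Objects as words *)

(** Both operads enter only through two properties. By [generates], the operations with two letters
    determine algebra structures and detect morphisms of algebras; this gives injectivity on
    structures and bijectivity on morphisms. By [free_on_binary], every family with the relation
    extends to an algebra; this gives surjectivity on structures. Freeness of the terminal operad
    also yields an inverse of the projection from the presented operad, so no ideal has to be
    computed.

    The obstacle throughout is dependent typing: composites of morphisms, sums of degrees and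
    arities agree with the expected ones only by proof. Words turn morphisms into maps of [nat],
    lists constrained by [fits] replace tensor products, and total evaluations with value zero
    elsewhere keep proofs out of the formulas. *)

Definition squash i m x :=
  if (x < i)%N then x else if (x < i + m)%N then i else (x - m.-1)%N.

Ltac squash_lia := rewrite /squash; repeat (case: ifP => ?); lia.

Section Words.
Local Open Scope nat_scope.

Definition word (T : per) : seq nat := [seq val (sur T x) | x <- enum 'I_(ar T)].

Lemma size_word T : size (word T) = ar T.
Proof. by rewrite size_map size_enum_ord. Qed.

Lemma nth_word T (x : 'I_(ar T)) : nth 0 (word T) x = sur T x.
Proof. by rewrite (nth_map x) ?size_enum_ord // nth_ord_enum. Qed.

Lemma mem_word T l : (l \in word T) = (l < card T).
Proof.
apply/mapP/idP => [[x _ ->]|lT]; first exact: ltn_ord.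
have /existsP [x /eqP xl] := forallP (sur_surj T) (Ordinal lT).
by exists x; rewrite ?mem_enum // xl.
Qed.

Lemma letters_gt0 T : 0 < card T.
Proof. exact: leq_ltn_trans (ltn_ord (sur T (Ordinal (ar_gt0 T)))). Qed.

(** By surjectivity the letters that occur are exactly those below [card T], so the word also
    determines the number of letters. *)
Lemma word_inj T S : word T = word S -> T = S.
Proof.
move=> E; have En : ar T = ar S by rewrite -!size_word E.
have Ec : card T = card S.
  have h l : (l < card T) = (l < card S) by rewrite -!mem_word E.
  by have := h (card T); have := h (card S); rewrite !ltnn; lia.
case: T S E En Ec => [n c s n0 h] [n' c' s' n0' h'] /= E En Ec; subst n' c'.
have Es : s = s'.
  apply/ffunP => x; apply/val_inj.
  by have := congr1 (fun w => nth 0 w x) E;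
    rewrite (@nth_word (Per n0 h)) (@nth_word (Per n0' h')).
by subst s'; rewrite (bool_irrelevance n0 n0') (bool_irrelevance h h').
Qed.

Lemma per_of_word w c : 0 < size w -> (forall l, (l \in w) = (l < c)) ->
  exists2 T, word T = w & card T = c.
Proof.
move=> w0 wc; case: c wc => [|c] wc.
  by case: w w0 wc => // x w _ /(_ x); rewrite mem_head.
have hs : [forall i, exists x, [ffun x : 'I_(size w) => inord (nth 0 w x) : 'I_c.+1] x == i].
  apply/forallP => i; apply/existsP.
  have iw : val i \in w by rewrite wc; exact: ltn_ord.
  have ix : index (val i) w < size w by rewrite index_mem.
  exists (Ordinal ix); apply/eqP/val_inj.
  by rewrite ffunE /= nth_index // inordK.
exists (Per w0 hs) => //.
apply: (@eq_from_nth _ 0) => [|x]; rewrite size_word //= => xw.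
rewrite (@nth_word (Per w0 hs) (Ordinal xw)) /= ffunE /= inordK //.
by rewrite -wc mem_nth.
Qed.

(** The word of the nontrivial fiber when the m letters from i on are collapsed. *)
Definition window i m w := [seq l - i | l <- w & i <= l < i + m].

Lemma card_count n (a : pred 'I_n) : #|[set x | a x]| = count a (enum 'I_n).
Proof.
rewrite cardE {1}/enum_mem size_filter -enumT.
by apply: eq_count => x; rewrite /= !inE.
Qed.

Lemma fibE T l : fib T l = count_mem l (word T).
Proof. by rewrite /fib card_count [in RHS]count_map. Qed.

(* F is the fiber of an elementary map T -> S that collapses the letters
   i, ..., i + |F| - 1. *)
Definition elem F T S i : Prop :=
  [/\ word S = map (squash i (card F)) (word T),
      word F = window i (card F) (word T), 1 < card F & i + card F <= card T].

Lemma elem_card F T S i : elem F T S i -> (card S + card F = (card T).+1)%N.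
Proof.
move=> [eS _ F1 iF].
have h l : (l < card S) = (l < (card T).+1 - card F).
  rewrite -mem_word eS; apply/mapP/idP => [[x]|hl].
    by rewrite mem_word => xT ->; squash_lia.
  (* A section of [squash]: it sends i to the first letter of the collapsed interval. *)
  exists (if l <= i then l else l + (card F).-1); last by case: (leqP l i) => ?; squash_lia.
  by rewrite mem_word; case: ifP; lia.
by have := h (card S); have := h ((card T).+1 - card F); rewrite !ltnn; lia.
Qed.

Lemma val_enum_set n (A : {set 'I_n}) (a : pred nat) :
  (forall x, (x \in A) = a x) -> map val (enum A) = filter a (iota 0 n).
Proof.
move=> hA; rewrite -val_enum_ord filter_map [in RHS]enumT; congr map.
by apply: eq_filter => x; rewrite /= -hA.
Qed.

Lemma filter_iota_interval i m n : i + m <= n ->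
  [seq l <- iota 0 n | i <= l < i + m] = iota i m.
Proof.
move=> im; apply: (irr_sorted_eq ltn_trans ltnn).
- exact: sorted_filter ltn_trans _ _ (iota_ltn_sorted _ _).
- exact: iota_ltn_sorted.
- by move=> l; rewrite mem_filter !mem_iota; lia.
Qed.

(** On an interval of letters the increasing identification with an ordinal is subtraction of the
    first letter. *)
Lemma word_restr (T : per) (A : {set 'I_(card T)}) (A0 : A != set0) i m :
  (forall x, (x \in A) = (i <= x < i + m)) -> i + m <= card T ->
  word (restr A0) = window i m (word T).
Proof.
move=> hA im.
have eA : map val (enum A) = iota i m.
  by rewrite -(filter_iota_interval im); apply: (val_enum_set (a := fun x => i <= x < i + m)).
have rk y (yA : y \in A) x : x \in A -> val (enum_rank_in yA x) = val x - i.
  move=> xA; rewrite -{2}(enum_rankK_in yA xA).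
  set j := enum_rank_in yA x.
  rewrite (enum_val_nth x) -(nth_map _ 0 val) -?cardE // eA nth_iota ?addKn //.
  by rewrite -(size_iota i m) -eA size_map -cardE.
have wB : word (restr A0) = [seq val (sur T y) - i | y <- enum [set y | sur T y \in A]].
  apply: (@eq_from_nth _ 0); first by rewrite size_word size_map -cardE.
  move=> x; rewrite size_word => xB.
  rewrite (@nth_word (restr A0) (Ordinal xB)) /= ffunE /= rk; last exact: restr_mem.
  have x0 := enum_val (Ordinal xB : 'I_(#|_|)).
  by rewrite (nth_map x0) -?cardE //= (enum_val_nth x0).
rewrite wB /window /word filter_map -map_comp /= enumT; congr map.
by apply: eq_filter => x; rewrite /= inE hA.
Qed.

Lemma squash_homo i m : {homo squash i m : x y / x <= y}.
Proof.
by move=> x y ?; squash_lia.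
Qed.

(** Together with [elem_of] this makes [elem] equivalent to the existence of an elementary morphism,
    which is unique by [mor_uniq]. *)
Lemma elemP F T S i : elem F T S i ->
  exists (f : mor T S) (i' : 'I_(card S)), val i' = i /\ elementary F f i'.
Proof.
move=> h; have cd := elem_card h; case: h => eS eF F1 iF.
have sq x : x < card T -> squash i (card F) x < card S.
  by rewrite -(mem_word T) -(mem_word S) eS => /(map_f (squash i (card F))).
pose f : {ffun 'I_(card T) -> 'I_(card S)} :=
  [ffun x : 'I_(card T) => Ordinal (sq x (ltn_ord x))].
have fE x : val (f x) = squash i (card F) x by rewrite ffunE.
have f_mono : {homo f : x y / (x <= y)%N}.
  by move=> x y xy; rewrite !fE squash_homo.
have f_ar : ar T = ar S by rewrite -!size_word eS size_map.
have f_comm (x : 'I_(ar T)) (y : 'I_(ar S)) : x = y :> nat -> f (sur T x) = sur S y.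
  move=> xy; apply/val_inj; apply: etrans (fE _) _ => /=.
  by rewrite -(nth_word x) -(nth_word y) eS -xy (nth_map 0) // size_word.
have iS : i < card S by lia.
exists (Mor f_mono f_ar f_comm), (Ordinal iS); split=> //; split.
- apply: word_inj; rewrite eF; symmetry; apply: word_restr => // x.
  by rewrite inE -val_eqE fE /=; apply/eqP/idP; squash_lia.
- by rewrite /grade; lia.
- move=> l; rewrite -val_eqE /= => /eqP li; rewrite /trivial /=.
  (* The only letter over l; beyond the interval letters are shifted by |F| - 1. *)
  have lT : (if l < i then nat_of_ord l else l + (card F).-1) < card T.
    by move: (ltn_ord l); case: ifP; lia.
  apply/eqP; rewrite -[RHS](cards1 (Ordinal lT)); apply: eq_card => x.
  have xT := ltn_ord x; have lS := ltn_ord l; rewrite !inE -!val_eqE /= fE.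
  by case: (ltnP l i) => ?; apply/eqP/eqP; squash_lia.
Qed.

(** An order-preserving map is determined by the cardinalities of its fibers: its list of values is
    sorted, and sorted lists with equal multiplicities coincide. Here the multiplicity is |F| at i
    and 1 at every other letter of S. *)
Lemma elementary_squash F T S (f : mor T S) i : elementary F f i ->
  i + card F <= card T /\ forall x, val (f x) = squash i (card F) x.
Proof.
move=> [-> F0 Ft].
set m := card (fiber f i); have mE : m = #|[set x | f x == i]| by [].
have m1 : 1 < m by move: F0; rewrite /grade -/m; lia.
pose w := [seq val (f x) | x <- enum 'I_(card T)].
have wcount l : count_mem l w = if l == i :> nat then m else (l < card S : nat).
  rewrite count_map -card_count /=.
  case: eqP => [->|li].
    by rewrite mE; apply: eq_card => x; rewrite !inE val_eqE.
  case: ltnP => lS.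
    have lj : Ordinal lS != i by apply/eqP => e; apply: li; rewrite -e.
    have /eqP e1 := Ft _ lj; apply: etrans e1.
    by apply: eq_card => x; rewrite !inE.
  apply: eq_card0 => x; rewrite !inE; apply/eqP => e.
  by have := ltn_ord (f x); rewrite e; lia.
pose u := iota 0 i ++ nseq m (nat_of_ord i) ++ iota i.+1 (card S - i.+1).
have wu : w = u.
  apply: (sorted_eq leq_trans anti_leq).
  - rewrite /w; have := iota_sorted 0 (card T); rewrite -val_enum_ord.
    rewrite !sorted_map; apply: sub_sorted => x y /=; exact: mor_mono.
  - rewrite /u sorted_pairwise ?pairwise_cat; last exact: leq_trans.
    rewrite -!sorted_pairwise; try exact: leq_trans.
    rewrite !iota_sorted /=.
    have -> : sorted leq (nseq m (nat_of_ord i))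
      by case: (m) => //= n; elim: n => //= n ->; rewrite leqnn.
    rewrite !andbT /=; apply/andP; split; last first.
      by apply/allrelP => x y; rewrite mem_nseq mem_iota => /andP [_ /eqP ->]; lia.
    apply/allrelP => x y; rewrite mem_cat mem_nseq !mem_iota.
    by move=> h /orP [/andP [_ /eqP ->]|]; lia.
  - apply/allP => l _ /=; rewrite wcount /u !count_cat count_nseq /=.
    rewrite !count_uniq_mem ?iota_uniq // !mem_iota.
    by have iS := ltn_ord i; case: ifP => /eqP li; lia.
have sw : size w = card T by rewrite size_map size_enum_ord.
have sT : card T = i + (m + (card S - i.+1)).
  by rewrite -sw wu !size_cat !size_iota size_nseq.
have iS := ltn_ord i.
split=> [|x]; first by lia.
have -> : val (f x) = nth 0 w x by rewrite (nth_map x) ?size_enum_ord // nth_ord_enum.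
have xT := ltn_ord x; rewrite wu /u !nth_cat size_iota size_nseq nth_nseq.
case: ltnP => h1; first by rewrite nth_iota //; squash_lia.
case: ltnP => h2; first by squash_lia.
by rewrite nth_iota; squash_lia.
Qed.

Lemma elem_of F T S (f : mor T S) i : elementary F f i -> elem F T S i.
Proof.
move=> ef; have [iF fE] := elementary_squash ef; case: ef => eF F0 _; split=> //.
- apply: (@eq_from_nth _ 0); first by rewrite size_map !size_word (mor_ar f).
  move=> x; rewrite size_word => xS.
  have xT : x < ar T by rewrite (mor_ar f).
  rewrite (nth_map 0) ?size_word // (@nth_word S (Ordinal xS)).
  rewrite -(@mor_comm _ _ f (Ordinal xT)) //= fE.
  by rewrite -(@nth_word T (Ordinal xT)).
- rewrite {1}eF; apply: word_restr => // x; rewrite inE -val_eqE fE /=.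
  have h : 1 < card F by move: F0; rewrite /grade; lia.
  by apply/eqP/idP; squash_lia.
- by move: F0; rewrite /grade; lia.
Qed.

Lemma elem_squash F T S i : elem F T S i ->
  exists (f : mor T S) (i' : 'I_(card S)), [/\ val i' = i, elementary F f i' &
    forall x, f x = squash i (card F) x :> nat].
Proof.
move=> /elemP [f [i' [i'E ef]]]; exists f, i'; split=> // x.
by have [_ fE] := elementary_squash ef; rewrite -i'E; apply: fE.
Qed.

Lemma ex_elem T i m : 1 < m -> i + m <= card T ->
  exists F S, elem F T S i /\ card F = m.
Proof.
move=> m1 im.
have [||F wF cF] := @per_of_word (window i m (word T)) m _ _.
- rewrite size_map size_filter -has_count; apply/hasP; exists i; last lia.
  by rewrite mem_word; lia.
- move=> l; apply/mapP/idP => [[x]|lm]; first by rewrite mem_filter => ? ->; lia.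
  by exists (i + l); rewrite ?mem_filter ?mem_word; lia.
have [||S wS cS] := @per_of_word (map (squash i m) (word T)) ((card T).+1 - m).
- by rewrite size_map size_word ar_gt0.
- move=> l; apply/mapP/idP => [[x]|hl]; first by rewrite mem_word => ? ->; squash_lia.
  exists (if l <= i then l else l + m.-1); last by case: (leqP l i) => ?; squash_lia.
  by rewrite mem_word; case: ifP; lia.
by exists F, S; split=> //; split; rewrite ?cF.
Qed.

Lemma elem_uniq F T S F' S' i : elem F T S i -> elem F' T S' i ->
  card F = card F' -> F = F' /\ S = S'.
Proof. by move=> [a b _ _] [c d _ _] e; split; apply: word_inj; rewrite ?a ?b ?c ?d e. Qed.

Lemma map_filter_map (h f f' : nat -> nat) (p q : pred nat) w :
  (forall l, p (h l) = q l) -> (forall l, q l -> f (h l) = f' l) ->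
  [seq f l | l <- map h w & p l] = [seq f' l | l <- w & q l].
Proof.
move=> pq ff; rewrite filter_map -map_comp (eq_filter pq).
by apply/eq_in_map => l; rewrite mem_filter => /andP [/ff].
Qed.

(** * Collapses of nested and of disjoint intervals *)

Section Identities.
Variables (f g i j : nat) (w : seq nat).
Hypotheses (f0 : 0 < f) (g0 : 0 < g).

Lemma squash_nested x : i <= j < i + g ->
  squash i g (squash j f x) = squash i (g + f).-1 x.
Proof. by move=> ?; rewrite [squash j f x]/squash; repeat case: ifP => ?; squash_lia. Qed.

Lemma squash_disjoint x : i < j ->
  squash j g (squash i f x) = squash i f (squash (j + f.-1) g x).
Proof.
move=> ?; rewrite [squash i f x]/squash [squash (j + f.-1) g x]/squash.
by repeat case: ifP => ?; squash_lia.
Qed.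

Lemma window_nested : i <= j < i + g ->
  window i g (map (squash j f) w) = map (squash (j - i) f) (window i (g + f).-1 w).
Proof.
move=> ij; rewrite /window -map_comp.
by apply: map_filter_map => l; [|move=> ? /=]; squash_lia.
Qed.

Lemma window_window : j + g <= f -> window j g (window i f w) = window (i + j) g w.
Proof.
move=> ij; rewrite /window filter_map -map_comp -filter_predI.
have E : predI (preim (subn^~ i) (fun l => j <= l < j + g)) (fun l => i <= l < i + f)
  =1 (fun l => i + j <= l < i + j + g) by move=> l /=; lia.
by rewrite (eq_filter E); apply: eq_map => l /=; lia.
Qed.

Lemma window_squashl : i + g <= j -> window i g (map (squash j f) w) = window i g w.
Proof.
by move=> ij; apply: map_filter_map => l; [|move=> ?]; squash_lia.
Qed.

Lemma window_squashr : j < i -> window i g (map (squash j f) w) = window (i + f.-1) g w.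
Proof.
by move=> ij; apply: map_filter_map => l; [|move=> ?]; squash_lia.
Qed.

End Identities.

(** The situation of axiom (a). Collapsing F inside what becomes G amounts to collapsing one
    interval of |G| + |F| - 1 letters; its fiber is H. *)
Lemma elem_nested F T S G P i j : elem F T S j -> elem G S P i ->
  i <= j < i + card G -> exists2 H, elem H T P i & elem F H G (j - i).
Proof.
move=> eF eG ij; have cF := elem_card eF; have cG := elem_card eG.
case: (eF) (eG) => wS wF F1 iF [wP wG G1 iG].
have [||H [P' [eH cH]]] := @ex_elem T i (card G + card F).-1; try lia.
have EP : P' = P.
  apply: word_inj; case: eH => -> _ _ _; rewrite wP wS -map_comp cH.
  by apply: eq_map => x /=; rewrite squash_nested; lia.
subst P'; exists H => //; case: eH => _ wH _ _; split; try lia.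
  by rewrite wG wS wH cH window_nested //; lia.
by rewrite wF wH window_window ?subnKC //; lia.
Qed.

(** Axiom (a) read in the other direction: the collapse of H is factored by first collapsing the
    part F of H. *)
Lemma elem_unnest F H G T P i j : elem H T P i -> elem F H G j ->
  1 < card G -> exists2 S, elem F T S (i + j) & elem G S P i.
Proof.
move=> eH eF G1; have cH := elem_card eH; have cF := elem_card eF.
case: (eH) (eF) => _ wH H1 iH [_ wF F1 jF].
have [||F' [S [eS cF']]] := @ex_elem T (i + j) (card F); try lia.
have EF : F' = F.
  by apply: word_inj; case: eS => _ -> _ _; rewrite wF wH cF' window_window //; lia.
subst F'; exists S => //; have cS := elem_card eS.
case: eS eH eF => wS _ _ _ [wP _ _ _] [wG _ _ _].
split; try lia.
  rewrite wP wS -map_comp; apply: eq_map => x /=.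
  by rewrite squash_nested; try lia; congr squash; lia.
rewrite wG wS wH window_nested; try lia.
by congr (map (squash _ _) (window _ _ _)); lia.
Qed.

(** The square of axiom (b), with F to the left of G. Collapsing F first shifts the position of G by
    |F| - 1. *)
Lemma elem_disjoint F G T S1 S2 i j : elem F T S1 i -> elem G T S2 j ->
  i + card F <= j ->
  exists2 P, elem G S1 P (j - (card F).-1) & elem F S2 P i.
Proof.
move=> eF eG ij; have cF := elem_card eF; have cG := elem_card eG.
case: (eF) (eG) => wS1 wF F1 iF [wS2 wG G1 jG].
have [||G' [P [eP cG']]] := @ex_elem S1 (j - (card F).-1) (card G); try lia.
have EG : G' = G.
  apply: word_inj; case: eP => _ -> _ _; rewrite wG cG' wS1 window_squashr; try lia.
  by congr window; lia.
subst G'; exists P => //; case: eP => wP _ _ _; split; try lia.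
  rewrite wP wS1 wS2 -!map_comp; apply: eq_map => x /=.
  by rewrite squash_disjoint; try lia; congr (squash _ _ (squash _ _ _)); lia.
by rewrite wF wS2 window_squashl //; lia.
Qed.

(** The same square, completed from one of its two paths instead of from the two maps out of T. *)
Lemma elem_swapr F G T S1 P i j : elem F T S1 j -> elem G S1 P i ->
  i + card G <= j ->
  exists2 S2, elem G T S2 i & elem F S2 P (j - (card G).-1).
Proof.
move=> eF eG ij; have cF := elem_card eF; have cG := elem_card eG.
case: (eF) (eG) => wS1 wF F1 iF [wP wG G1 jG].
have [||G' [S2 [eS cG']]] := @ex_elem T i (card G); try lia.
have EG : G' = G.
  by apply: word_inj; case: eS => _ -> _ _; rewrite wG cG' wS1 window_squashl //; lia.
subst G'; exists S2 => //.
have [P' eP1 eP2] := elem_disjoint eS eF ij.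
suff <- : P' = P by [].
apply: word_inj; case: eP2 (eG) => -> _ _ _ [-> _ _ _]; by [].
Qed.

(** If i < j, the letter i + 1 is sent to i by the collapse at i, whose interval has at least two
    letters, but is kept by the collapse at j. *)
Lemma elem_index F G T S i j : elem F T S i -> elem G T S j -> i = j.
Proof.
move=> eF eG; have [cF cG] := conj (elem_card eF) (elem_card eG).
have FG : card G = card F by lia.
case: eF eG => wS _ F1 iF [wS' _ _]; rewrite {}FG in wS' * => jF.
have sq x : x < card T -> squash i (card F) x = squash j (card F) x.
  rewrite -mem_word => /(nthP 0) [l lT <-].
  by rewrite -!(nth_map 0 0) // -wS -wS'.
case: (ltngtP i j) => // ij; [have := sq i.+1 | have := sq j.+1];
  by move/(_ ltac:(lia)); squash_lia.
Qed.

(** The degenerate collapse of all letters, to which the unit axiom applies. *)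
Lemma elem_full F T S i : elem F T S i -> (card S <= 1)%N -> i = 0 /\ F = T.
Proof.
move=> e S1; have cF := elem_card e; have S0 := letters_gt0 S; case: e => _ wF F1 iF.
have i0 : i = 0 by lia.
split=> //; apply: word_inj; rewrite wF i0 /window (_ : filter _ _ = word T).
  by rewrite -[RHS]map_id; apply: eq_map => l; rewrite subn0.
by apply/all_filterP/allP => l; rewrite mem_word; lia.
Qed.

Definition fibs T := [seq fib T l | l <- iota 0 (card T)].

(** This matches the arities of arguments in a composite: the inner operation takes the block of
    arguments of F and returns one argument of arity [ar F]. *)
Lemma elem_fibs F T S i : elem F T S i -> exists A C,
  [/\ size A = i, fibs T = A ++ fibs F ++ C & fibs S = A ++ ar F :: C].
Proof.
move=> eF; have cF := elem_card eF; case: eF => wS wF F1 iF.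
exists [seq fib T l | l <- iota 0 i],
  [seq fib T l | l <- iota (i + card F) (card T - (i + card F))].
split; first by rewrite size_map size_iota.
- rewrite /fibs -{1}(subnKC iF) -addnA iotaD map_cat add0n; congr (_ ++ _).
  rewrite iotaD map_cat; congr (_ ++ _).
  rewrite -[X in iota X _]addn0 iotaDl -map_comp; apply/eq_in_map => l.
  rewrite mem_iota /= !fibE wF; move: (word T) => w hl.
  by rewrite count_map count_filter; apply: eq_count => x /=; lia.
have cS : card S = i + (1 + (card T - (i + card F))) by lia.
rewrite /fibs cS iotaD map_cat add0n; congr (_ ++ _).
  apply/eq_in_map => l; rewrite mem_iota !fibE wS; move: (word T) => w hl.
  by rewrite count_map; apply: eq_count => x /=; apply/eqP/eqP; squash_lia.
rewrite /=; congr (_ :: _).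
  rewrite fibE -(size_word F) wS wF; move: (word T) => w.
  rewrite count_map size_map size_filter.
  by apply: eq_count => x /=; apply/eqP/idP; squash_lia.
rewrite (_ : i + card F = (card F).-1 + i.+1); last lia.
rewrite iotaDl -map_comp; apply/eq_in_map => l; rewrite mem_iota /= !fibE wS.
move: (word T) => w hl; rewrite count_map.
by apply: eq_count => x /=; apply/eqP/eqP; squash_lia.
Qed.

End Words.

Local Open Scope ring_scope.

(** * Coherence *)

Section Oc.
Variables (k : fieldType) (M : operad k).

(* [ocomp] indexed by the position i : nat of the collapsed interval instead of
   the morphism, which [elem] determines. *)
Definition oc F T S i (h : elem F T S i) p q r (hd : p + q == r)
    (x : M S p) (y : M F q) : M T r :=
  let f := cid (elemP h) in
  let j := cid (svalP f) in ocomp (proj2 (svalP j)) hd x y.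

Lemma ocE F T S (f : mor T S) j (ef : elementary F f j) i (h : elem F T S i)
    p q r (hd : p + q == r) (x : M S p) (y : M F q) :
  val j = i -> ocomp ef hd x y = oc h hd x y.
Proof.
rewrite /oc; case: cid => g hg; case: cid => l hl /= ji.
have [li eg] := hl; have lj : j = l by apply: val_inj; rewrite [LHS]ji.
subst l; have fg := mor_uniq f g; subst g.
by rewrite [proj2 _](Prop_irrelevance _ ef).
Qed.

Lemma ocomp_oc F T S (f : mor T S) j (ef : elementary F f j) p q r
    (hd : p + q == r) (x : M S p) (y : M F q) :
  ocomp ef hd x y = oc (elem_of ef) hd x y.
Proof. exact: ocE. Qed.

Lemma oc_linl F T S i (h : elem F T S i) p q r (hd : p + q == r) (y : M F q) :
  linear (fun x => oc h hd x y).
Proof. exact: ocomp_linl. Qed.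

Lemma oc_linr F T S i (h : elem F T S i) p q r (hd : p + q == r) (x : M S p) :
  linear (oc h hd x).
Proof. exact: ocomp_linr. Qed.

Lemma ocA F G H T S P j i j' (eF : elem F T S j) (eG : elem G S P i)
    (eH : elem H T P i) (eFH : elem F H G j') p q r pq qr d
    (hpq : p + q == pq) (hqr : q + r == qr) (hl : p + qr == d) (hr : pq + r == d)
    (x : M P p) (y : M G q) (z : M F r) :
  j = (i + j')%N ->
  oc eH hl x (oc eFH hqr y z) = oc eF hr (oc eG hpq x y) z.
Proof.
move=> ij.
have [f [j1 [j1E ef fE]]] := elem_squash eF.
have [g [i1 [i1E eg gE]]] := elem_squash eG.
have [gf [i2 [i2E egf gfE]]] := elem_squash eH.
have [fi [j2 [j2E efi _]]] := elem_squash eFH.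
have ei : i2 = i1 by apply: val_inj; rewrite i1E i2E.
subst i2.
rewrite -(ocE egf eH) // -(ocE efi eFH) // -(ocE ef eF) // -(ocE eg eG) //.
have cG := elem_card eG; have cF := elem_card eF; have cH := elem_card eFH.
case: eFH eG => _ _ F1 jF [_ _ G1 _].
apply: ocompA => [|a]; apply: ord_inj; rewrite !(gE, gfE, fE).
  by have -> := i1E; have -> := j1E; squash_lia.
rewrite squash_nested; try lia.
by congr squash; lia.
Qed.

Lemma ocC F G T S1 S2 P j l i (eF : elem F T S1 j) (eG : elem G S1 P i)
    (eG' : elem G T S2 l) (eF' : elem F S2 P j) p q r pq pr d
    (hpq : p + q == pq) (hpr : p + r == pr) (h1 : pr + q == d) (h2 : pq + r == d)
    (x : M P p) (y : M F q) (z : M G r) :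
  (j < i)%N -> l = (i + (card F).-1)%N ->
  ksign k (q * r) *: oc eF h1 (oc eG hpr x z) y = oc eG' h2 (oc eF' hpq x y) z.
Proof.
move=> ji li.
have [f1 [j1 [j1E ef1 f1E]]] := elem_squash eF.
have [g1 [i1 [i1E eg1 g1E]]] := elem_squash eG.
have [f2 [l1 [l1E ef2 f2E]]] := elem_squash eG'.
have [g2 [m1 [m1E eg2 g2E]]] := elem_squash eF'.
rewrite -(ocE ef1 eF) // -(ocE eg1 eG) // -(ocE ef2 eG') // -(ocE eg2 eF') //.
case: (eF) (eG) => _ _ F1 jF [_ _ G1 _].
apply: ocompC.
- by move=> a; apply: ord_inj; rewrite !(g1E, f1E, g2E, f2E) li squash_disjoint //; lia.
- by apply: ord_inj; rewrite g2E; have -> := l1E; have -> := i1E; squash_lia.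
- by apply: ord_inj; rewrite g1E; have -> := j1E; have -> := m1E; squash_lia.
- by rewrite -val_eqE; have -> := i1E; have -> := m1E; apply/eqP; lia.
Qed.

Lemma oc1 T U i (e : elem T T U i) (hU : trivial U) p (h : 0 + p == p) (x : M T p) :
  oc e h (ounit M hU) x = x.
Proof. have [f [j [jE ef]]] := elemP e; rewrite -(ocE ef e) //; exact: ocomp1. Qed.

Lemma ounit_eq U (hU hU' : trivial U) : ounit M hU = ounit M hU'.
Proof. by rewrite (bool_irrelevance hU hU'). Qed.

End Oc.

Lemma omap_oc (k : fieldType) (M N : operad k) (f : operad_mor M N) F T S i
    (h : elem F T S i) p q r (hd : p + q == r) (x : M S p) (y : M F q) :
  f T r (oc h hd x y) = oc h hd (f S p x) (f F q y).
Proof. exact: omap_comp. Qed.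

Section Coherence.
Variables (k : fieldType) (M : operad k) (g : forall r, M r 0).

Hypothesis g_rel : forall F G T S P (eF : elem F T S 0) (eG : elem G T P 1)
  (h : 0 + 0 == 0 :> int), card T = 3%N -> card F = 2%N -> card G = 2%N ->
  oc eF h (g S) (g F) = oc eG h (g P) (g G).

(** The values of all formal composites of units and generators, without sums or scalars. Coherence
    says that each object carries exactly one such value. *)
Inductive canon : forall T, M T 0 -> Prop :=
| canon_unit U (hU : trivial U) : canon (ounit M hU)
| canon_gen r : card r = 2%N -> canon (g r)
| canon_comp F T S i (e : elem F T S i) (h : 0 + 0 == 0 :> int) x y :
    @canon S x -> @canon F y -> canon (oc e h x y).

Let h0 : 0 + 0 == 0 :> int. Proof. by []. Qed.

(** As S has two letters, F contains all letters of T but the last, so the root generator adds the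
    last letter. *)
Definition left_nested T (x : M T 0) : Prop :=
  exists F S (e : elem F T S 0) y, [/\ card S = 2%N, canon y & x = oc e h0 (g S) y].

Lemma ex_canon T : exists x : M T 0, canon x.
Proof.
have [n] := ubnP (card T); elim: n T => // n IH T Tn.
have T0 := letters_gt0 T.
case: (ltngtP (card T) 2) => T2; last by exists (g T); constructor.
  have hT : trivial T by apply/eqP; lia.
  by exists (ounit M hT); constructor.
have [||F [S [e cF]]] := @ex_elem T 0 (card T).-1; try lia.
have cS := elem_card e.
have [y cy] : exists y : M F 0, canon y by apply: IH; lia.
by exists (oc e h0 (g S) y); apply: canon_comp cy; constructor; lia.
Qed.

Lemma canon_trivial T (x : M T 0) : canon x -> forall hT : trivial T, x = ounit M hT.
Proof.
elim=> {T x} [U hU hU'|r r2 hr|F T S i e h x y _ _ _ _ hT].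
- exact: ounit_eq.
- by exfalso; move/eqP: (hr); rewrite r2.
- by exfalso; move/eqP: (hT); have := elem_card e; case: e => _ _; have := letters_gt0 S; lia.
Qed.

(** Since |S| + |F| = |T| + 1 and |F| > 1, a composite on two letters has a trivial outer object,
    hence is a composite with a unit. *)
Lemma canon_card2 T (x : M T 0) : canon x -> card T = 2%N -> x = g T.
Proof.
elim=> {T x} [U hU U2|//|F T S i e h x y cx _ _ IHy T2].
  by exfalso; move/eqP: (hU); rewrite U2.
have cF := elem_card e; have [_ _ F1 iF] := e.
have S1 : (card S <= 1)%N by lia.
have [i0 E] := elem_full e S1.
subst F i; have hS : trivial S by apply/eqP; have := letters_gt0 S; lia.
by rewrite (canon_trivial cx hS) oc1; apply: IHy.
Qed.

Section Step.
Variable n : nat.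
Hypothesis IH : forall T (x y : M T 0), (card T < n)%N -> canon x -> canon y -> x = y.

(** Below n uniqueness is available, so it is enough to exhibit some left-nested composite on T. *)
Lemma canon_left_nested T (x : M T 0) : canon x -> (2 < card T < n)%N -> left_nested x.
Proof.
move=> cx Tn; have [||F [S [e cF]]] := @ex_elem T 0 (card T).-1; try lia.
have cS := elem_card e; have [y cy] := ex_canon F.
exists F, S, e, y; split=> //; first by lia.
by apply: IH => //; [lia | apply: canon_comp cy; apply: canon_gen; lia].
Qed.

(** The outer factor has fewer letters than T unless it is everything, so it is left-nested by
    induction, or a generator. What has to be done depends on whether the inner factor touches the
    last letter. *)
Lemma left_nestedP T (x : M T 0) : canon x -> card T = n -> (2 < n)%N -> left_nested x.
Proof.
elim=> {T x} [U hU cT n2|r r2 cT n2|F T S i e h x y cx _ cy IHy cT n2]; try lia.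
  by exfalso; move/eqP: (hU); lia.
rewrite (bool_irrelevance h h0) {h}.
have cF := elem_card e; have [_ _ F1 iF] := e.
case: (leqP (card S) 1) => S1.
  have [i0 E] := elem_full e S1; subst F i.
  have hS : trivial S by apply/eqP; have := letters_gt0 S; lia.
  by rewrite (canon_trivial cx hS) oc1; apply: IHy.
(* If F misses the last letter, the root generator of x stays at the root and y is absorbed into its
   first argument. *)
have [iFn|iFn] : (i + card F < n \/ i + card F = n)%N by lia.
  case: (eqVneq (card S) 2%N) => S2.
    have i0 : i = 0%N by lia.
    by subst i; exists F, S, e, y; rewrite (canon_card2 cx).
  have [|F' [R [e' [y' [cR cy' xE]]]]] := canon_left_nested cx; first by lia.
  have cF' := elem_card e'.
  have [|H eH eFH] := elem_nested e e'; first by lia.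
  exists H, R, eH, (oc eFH h0 y' y); split=> //; first exact: canon_comp.
  by rewrite xE; symmetry; apply: ocA; lia.
(* Now y sits at the last letter of S. If S has more than two letters, y is disjoint from the first
   argument y' of the root of x. Axiom (b) composes y with the root first, on an object T' with
   fewer than n letters, where the induction hypothesis applies. *)
case: (eqVneq (card S) 2%N) => S2; last first.
  have [|F' [R [e' [y' [cR cy' xE]]]]] := canon_left_nested cx; first by lia.
  have cF' := elem_card e'.
  have [|T' e1 e2] := elem_swapr e e'; first by lia.
  have i1 : (i - (card F').-1)%N = 1%N by lia.
  rewrite i1 in e2; have cT' := elem_card e1; have cT'' := elem_card e2.
  have -> : oc e h0 x y = oc e1 h0 (oc e2 h0 (g R) y) y'.
    by rewrite xE -(ocC e1 e2 e e' h0 h0 h0 h0) ?mul0r ?scale1r //; lia.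
  have cz : canon (oc e2 h0 (g R) y) by apply: canon_comp cy; apply: canon_gen.
  have [|G [R' [e3 [z [cR' cz' zE]]]]] := canon_left_nested cz; first by lia.
  have [|H eH eFH] := elem_nested e1 e3; first by have := elem_card e3; lia.
  exists H, R', eH, (oc eFH h0 z y'); split=> //; first exact: canon_comp.
  by rewrite zE; symmetry; apply: ocA.
(* The remaining composite is a generator with y in its second argument. Only here is [g_rel]
   needed. *)
have i1 : i = 1%N by lia.
subst i; rewrite (canon_card2 cx S2).
case: (eqVneq (card F) 2%N) => F2.
  have [||G [R [e' cG]]] := @ex_elem T 0 2; try lia.
  exists G, R, e', (g G); split; [by have := elem_card e'; lia|exact: canon_gen|].
  by rewrite (canon_card2 cy F2) (g_rel e' e) //; lia.
have [|F' [R [e' [y' [cR cy' yE]]]]] := canon_left_nested cy; first by lia.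
(* T' is the three-letter quotient on which the root generator and the root generator of y are
   composed; [g_rel] on T' moves the bracket to the left. *)
have [|T' e3 e4] := elem_unnest e e'; first by lia.
have cF' := elem_card e'; have cT' := elem_card e4.
have [||G [R' [e5 cG]]] := @ex_elem T' 0 2; try lia.
have cR' := elem_card e5.
have [|H eH eFH] := elem_nested e3 e5; first by lia.
exists H, R', eH, (oc eFH h0 (g G) y'); split; first by lia.
  by apply: canon_comp cy'; apply: canon_gen.
rewrite yE (ocA e3 e4 e e' h0 h0 h0 h0) // -(g_rel e5 e4) //; last by lia.
by symmetry; apply: ocA.
Qed.

End Step.

(** In two left-nested forms the collapsed interval is the same, all letters but the last, so F and
    S agree and induction compares the inner factors. *)
Lemma canon_uniq T (x y : M T 0) : canon x -> canon y -> x = y.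
Proof.
have [n] := ubnP (card T); elim: n T x y => // n IH T x y Tn cx cy.
have T0 := letters_gt0 T; case: (ltngtP (card T) 2) => T2.
- have hT : trivial T by apply/eqP; lia.
  by rewrite (canon_trivial cx hT) (canon_trivial cy hT).
- have IH' S (u v : M S 0) : (card S < card T)%N -> canon u -> canon v -> u = v.
    by move=> ST; apply: IH; lia.
  have [F [S [e [u [S2 cu ->]]]]] := left_nestedP IH' cx erefl T2.
  have [F' [S' [e' [v [S2' cv ->]]]]] := left_nestedP IH' cy erefl T2.
  have cF := elem_card e; have cF' := elem_card e'.
  have [|E1 E2] := elem_uniq e e'; first by lia.
  subst F' S'; rewrite (Prop_irrelevance e e') (IH' _ u v) //; lia.
- by rewrite (canon_card2 cx T2) (canon_card2 cy T2).
Qed.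

Definition canonical T : M T 0 := sval (cid (ex_canon T)).

Lemma canonicalP T : canon (canonical T).
Proof. exact: svalP. Qed.

Definition canonical_deg T p : M T p :=
  if 0 =P p is ReflectT e then ecast p (M T p) e (canonical T) else 0.

Lemma canonical_deg0 T : canonical_deg T 0 = canonical T.
Proof. by rewrite /canonical_deg; case: eqP => // e; rewrite (eq_irrelevance e erefl). Qed.

Lemma terminal_ext : exists f : operad_mor (terminal k) M,
  forall r, card r = 2%N -> f r 0 (tone k r) = g r.
Proof.
unshelve eexists (@OperadMor k (terminal k) M
  (fun T p c => coef c *: canonical_deg T p) _ _ _).
- by move=> T p c x y; rewrite (coef_lin c) scalerDl scalerA.
- move=> F T S f i ef p q r h x y /=.
  rewrite ocomp_oc /tcomp (coef_scal_comp h).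
  have [p0|/eqP p0] := pselect (p = 0); last first.
    by rewrite (coef_deg p0) mul0r !scale0r (lin0 (oc_linl (elem_of ef) h _)).
  have [q0|/eqP q0] := pselect (q = 0); last first.
    by rewrite (coef_deg q0) mulr0 !scale0r (lin0 (oc_linr (elem_of ef) h _)).
  subst p q; have r0 : r = 0 by rewrite -(eqP h).
  subst r; rewrite (lin_scale (oc_linl (elem_of ef) h _)).
  rewrite (lin_scale (oc_linr (elem_of ef) h _)) scalerA !canonical_deg0.
  by congr (_ *: _); apply: canon_uniq; do ?apply: canon_comp; apply: canonicalP.
- move=> U hU; rewrite /= /tunit scalK scale1r canonical_deg0.
  by apply: canon_trivial; apply: canonicalP.
- move=> r r2 /=; rewrite /tone scalK scale1r canonical_deg0.
  by apply: canon_card2 => //; apply: canonicalP.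
Qed.

End Coherence.

(** * The endomorphism operad *)

Section Signs.
Variable k : fieldType.

Lemma ksignE (p : int) : ksign k p = (-1) ^+ odd (absz p).
Proof. by rewrite signr_odd. Qed.

Lemma odd_absD (p q : int) : odd (absz (p + q)) = odd (absz p) (+) odd (absz q).
Proof. lia. Qed.

Lemma odd_absM (p q : int) : odd (absz (p * q)) = odd (absz p) && odd (absz q).
Proof. by rewrite abszM oddM. Qed.

Lemma ksignD p q : ksign k (p + q) = ksign k p * ksign k q.
Proof. by rewrite !ksignE odd_absD signr_addb. Qed.

Lemma ksignK p : ksign k p * ksign k p = 1.
Proof. by rewrite -ksignD ksignE odd_absD addbb. Qed.

End Signs.

(** The exponents are polynomials in the degrees, so an equality of signs becomes a Boolean identity
    between parities. *)
Ltac ksign_tac :=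
  rewrite ?scalerA -?ksignD !ksignE ?(odd_absD, odd_absM);
  congr (_ ^+ (nat_of_bool _));
  repeat match goal with |- context [odd ?x] => case: (odd x) end; done.

Section Elements.
Variables (k : fieldType) (P : coll k).
Implicit Types (a : seq (elt P)) (z : elt P).

Definition arp T : posn := exist _ (ar T) (ar_gt0 T).

(* The vector of z, transported along the equations earity z = n and edeg z = d;
   zero if one of them fails. *)
Definition eproj n d z : P n d :=
  match earity z =P n, edeg z =P d with
  | ReflectT e, ReflectT e' =>
      ecast m (P m d) e (ecast j (P (earity z) j) e' (evec z))
  | _, _ => 0
  end.

Lemma eprojK n d (x : P n d) : eproj n d (Elt x) = x.
Proof.
rewrite /eproj /=; case: eqP => // e; case: eqP => // e'.
by rewrite (eq_irrelevance e erefl) (eq_irrelevance e' erefl).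
Qed.

Lemma eproj_lin n d n' d' c (x y : P n' d') :
  eproj n d (Elt (c *: x + y)) = c *: eproj n d (Elt x) + eproj n d (Elt y).
Proof.
rewrite /eproj /=; case: eqP => [e|_]; last by rewrite scaler0 addr0.
case: eqP => [e'|_]; last by rewrite scaler0 addr0.
by subst n' d'.
Qed.

Lemma tdeg_cat a a' : tdeg (a ++ a') = tdeg a + tdeg a'.
Proof. exact: big_cat. Qed.

Lemma tdeg_cons z a : tdeg (z :: a) = edeg z + tdeg a.
Proof. exact: big_cons. Qed.

Lemma tdeg_nil : tdeg ([::] : seq (elt P)) = 0.
Proof. exact: big_nil. Qed.

Definition arities a : seq nat := [seq sval (earity z) | z <- a].

Lemma fitsE T a n : fits T a n = (arities a == fibs T) && (ar T == sval n).
Proof. by []. Qed.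

Lemma fits_size T a n : fits T a n -> size a = card T.
Proof.
by case/andP=> /eqP /(congr1 size); rewrite !size_map size_iota.
Qed.

Lemma fits_arp T a n : fits T a n -> n = arp T.
Proof. by case/andP=> _ /eqP e; apply: val_inj. Qed.

Section Split.
Variables (F T S : per) (i : nat) (e : elem F T S i).

Lemma fits_split a n : fits T a n ->
  exists a1 b a2, [/\ a = a1 ++ b ++ a2, size a1 = i & size b = card F].
Proof.
move=> /fits_size sa; case: e => _ _ _ iF.
exists (take i a), (take (card F) (drop i a)), (drop (card F) (drop i a)).
by rewrite !cat_take_drop !size_takel ?size_drop ?sa //; lia.
Qed.

Lemma fits_fiber a1 b a2 n : fits T (a1 ++ b ++ a2) n -> size a1 = i ->
  size b = card F -> fits F b (arp F).
Proof.
have [A [C [sA fT _]]] := elem_fibs e.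
rewrite !fitsE eqxx andbT fT /arities !map_cat => /andP [h _] sa sb.
move: h; rewrite eqseq_cat ?size_map ?sA // => /andP [_].
by rewrite eqseq_cat ?size_map ?size_iota // => /andP [].
Qed.

Lemma fits_base a1 b a2 n z : fits T (a1 ++ b ++ a2) n -> size a1 = i ->
  size b = card F -> earity z = arp F -> fits S (a1 ++ z :: a2) n.
Proof.
have [A [C [sA fT fS]]] := elem_fibs e.
rewrite !fitsE fT fS /arities !map_cat => /andP [h nT] sa sb zF.
have arS : ar S = ar T by case: e => wS _ _ _; rewrite -!size_word wS size_map.
move: h; rewrite arS nT eqseq_cat ?size_map ?sA // => /andP [/eqP -> h].
move: h; rewrite eqseq_cat ?size_map ?size_iota // => /andP [_ /eqP h'].
by rewrite /= h' zF eqxx.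
Qed.

End Split.

Definition multilinear T (p : int)
    (f : forall a n, fits T a n -> forall d : int, p + tdeg a == d -> P n d) : Prop :=
  forall a1 a2 n n' d' c (x y : P n' d')
    (hxy : fits T (a1 ++ Elt (c *: x + y) :: a2) n)
    (hx : fits T (a1 ++ Elt x :: a2) n) (hy : fits T (a1 ++ Elt y :: a2) n)
    d (dxy : p + tdeg (a1 ++ Elt (c *: x + y) :: a2) == d)
    (dx : p + tdeg (a1 ++ Elt x :: a2) == d)
    (dy : p + tdeg (a1 ++ Elt y :: a2) == d),
  f _ _ hxy _ dxy = c *: f _ _ hx _ dx + f _ _ hy _ dy.

(** Degree p maps from the tensor product of the P(n_i) to P(n), encoded as multilinear functions of
    a list of arguments. Arities and degrees are constrained by equations, which avoids
    transports. *)
Record endo T (p : int) := Endo {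
  ev :> forall a n, fits T a n -> forall d : int, p + tdeg a == d -> P n d;
  ev_lin : multilinear ev }.

Section Endo.
Variables (T : per) (p : int).
Implicit Types f g h : endo T p.

Lemma endo_eq f g :
  (forall a n (ha : fits T a n) d (hd : p + tdeg a == d), f a n ha d hd = g a n ha d hd) ->
  f = g.
Proof.
move=> fg; have E : ev f = ev g.
  apply: functional_extensionality_dep => a; apply: functional_extensionality_dep => n.
  apply: functional_extensionality_dep => ha; apply: functional_extensionality_dep => d.
  by apply: functional_extensionality_dep => hd.
case: f g E {fg} => [f lf] [g lg] /= E; subst g; congr Endo; exact: Prop_irrelevance.
Qed.

Lemma ev_congr f a a' n (ha : fits T a n) (ha' : fits T a' n) d
    (hd : p + tdeg a == d) (hd' : p + tdeg a' == d) :
  a = a' -> f a n ha d hd = f a' n ha' d hd'.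
Proof.
by move=> E; subst a'; rewrite (bool_irrelevance ha ha') (bool_irrelevance hd hd').
Qed.

Lemma ev_lin_eq f a ax ay a1 a2 n n' d' c (x y : P n' d')
    (ha : fits T a n) (hx : fits T ax n) (hy : fits T ay n) d
    (da : p + tdeg a == d) (dx : p + tdeg ax == d) (dy : p + tdeg ay == d) :
  a = a1 ++ Elt (c *: x + y) :: a2 -> ax = a1 ++ Elt x :: a2 ->
  ay = a1 ++ Elt y :: a2 ->
  f a n ha d da = c *: f ax n hx d dx + f ay n hy d dy.
Proof. by move=> *; subst a ax ay; apply: ev_lin. Qed.

HB.instance Definition _ := gen_eqMixin (endo T p).
HB.instance Definition _ := gen_choiceMixin (endo T p).

Definition endo_zero : endo T p.
Proof.
exists (fun a n _ d _ => 0) => a1 a2 n n' d' c x y *.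
by rewrite scaler0 addr0.
Defined.

Definition endo_add f g : endo T p.
Proof.
exists (fun a n ha d hd => f a n ha d hd + g a n ha d hd).
move=> a1 a2 n n' d' c x y hxy hx hy d dxy dx dy.
by rewrite (ev_lin f hxy hx hy dxy dx dy) (ev_lin g hxy hx hy dxy dx dy) scalerDr addrACA.
Defined.

Definition endo_scale (b : k) f : endo T p.
Proof.
exists (fun a n ha d hd => b *: f a n ha d hd).
move=> a1 a2 n n' d' c x y hxy hx hy d dxy dx dy.
by rewrite (ev_lin f hxy hx hy dxy dx dy) scalerDr !scalerA mulrC.
Defined.

Lemma endo_addA : associative endo_add.
Proof. by move=> f g h; apply: endo_eq => *; apply: addrA. Qed.
Lemma endo_addC : commutative endo_add.
Proof. by move=> f g; apply: endo_eq => *; apply: addrC. Qed.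
Lemma endo_add0 : left_id endo_zero endo_add.
Proof. by move=> f; apply: endo_eq => *; apply: add0r. Qed.
Lemma endo_addN : left_inverse endo_zero (endo_scale (-1)) endo_add.
Proof. by move=> f; apply: endo_eq => * /=; rewrite scaleN1r addNr. Qed.

HB.instance Definition _ :=
  GRing.isZmodule.Build (endo T p) endo_addA endo_addC endo_add0 endo_addN.

Lemma endo_scaleA (u v : k) f : endo_scale u (endo_scale v f) = endo_scale (u * v) f.
Proof. by apply: endo_eq => *; apply: scalerA. Qed.
Lemma endo_scale1 : left_id 1 endo_scale.
Proof. by move=> f; apply: endo_eq => *; apply: scale1r. Qed.
Lemma endo_scaleDr : right_distributive endo_scale +%R.
Proof. by move=> a f g; apply: endo_eq => *; apply: scalerDr. Qed.
Lemma endo_scaleDl f : {morph endo_scale^~ f : u v / u + v}.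
Proof. by move=> a b; apply: endo_eq => *; apply: scalerDl. Qed.

HB.instance Definition _ := GRing.Zmodule_isLmodule.Build k (endo T p)
  endo_scaleA endo_scale1 endo_scaleDr endo_scaleDl.

Lemma evL f g c a n (ha : fits T a n) d (hd : p + tdeg a == d) :
  (c *: f + g : endo T p) a n ha d hd = c *: f a n ha d hd + g a n ha d hd.
Proof. by []. Qed.

Lemma evZ f c a n (ha : fits T a n) d (hd : p + tdeg a == d) :
  (c *: f : endo T p) a n ha d hd = c *: f a n ha d hd.
Proof. by []. Qed.

End Endo.
End Elements.

Section EndOperad.
Variables (k : fieldType) (P : coll k).

(* Junk value: zero on arguments that do not fit or have the wrong degree. *)
Definition tev T (p : int) (f : endo P T p) a n (d : int) : P n d :=
  match pselect (fits T a n), pselect (p + tdeg a == d) with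
  | left ha, left hd => f a n ha d hd
  | _, _ => 0
  end.

Lemma tevE T p (f : endo P T p) a n (ha : fits T a n) d (hd : p + tdeg a == d) :
  tev f a n d = f a n ha d hd.
Proof.
rewrite /tev; case: pselect => // ha'; case: pselect => // hd'; exact: ev_congr.
Qed.

Section Comp.
Variables (F T S : per) (i : nat) (e : elem F T S i).
Variables (p q r : int) (hd : p + q == r) (x : endo P S p) (y : endo P F q).

(** The sign moves the inner operation, of degree q, past the arguments to its left. With [tev] the
    formula contains no proofs about the shortened lists. *)
Definition endo_comp_fun (a : seq (elt P)) n (_ : fits T a n) d (_ : r + tdeg a == d) :
    P n d :=
  let b := take (card F) (drop i a) in
  ksign k (q * tdeg (take i a)) *:
    tev x (take i a ++ Elt (tev y b (arp F) (q + tdeg b)) :: drop (card F) (drop i a)) n d.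

Lemma fits_collapse (a1 b a2 : seq (elt P)) n z : fits T (a1 ++ b ++ a2) n -> size a1 = i ->
  fits F b (earity z) -> fits S (a1 ++ z :: a2) n.
Proof.
move=> ha sa hF; apply: (fits_base e ha sa (fits_size hF)); exact: fits_arp hF.
Qed.

Lemma tdeg_collapse (a1 b a2 : seq (elt P)) z d : r + tdeg (a1 ++ b ++ a2) == d ->
  q + tdeg b == edeg z -> p + tdeg (a1 ++ z :: a2) == d.
Proof.
move=> hd' /eqP zd; rewrite -(eqP hd') -(eqP hd) !tdeg_cat tdeg_cons -zd.
by apply/eqP; lia.
Qed.

(** The evaluation rule for composites: any splitting of the arguments and any proofs are allowed,
    so that [take], [drop] and [tev] disappear from later computations. *)
Lemma endo_comp_funE a n (ha : fits T a n) d (hd' : r + tdeg a == d) a1 b a2 nF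
    (hF : fits F b nF) dF (hdF : q + tdeg b == dF)
    (hS : fits S (a1 ++ Elt (y b nF hF dF hdF) :: a2) n)
    (hdS : p + tdeg (a1 ++ Elt (y b nF hF dF hdF) :: a2) == d) :
  a = a1 ++ b ++ a2 -> size a1 = i ->
  endo_comp_fun ha hd' = ksign k (q * tdeg a1) *: x _ n hS d hdS.
Proof.
move=> aE sa; have sb := fits_size hF; rewrite /endo_comp_fun.
have -> : take i a = a1 by rewrite aE -sa take_size_cat.
have -> : drop i a = b ++ a2 by rewrite aE -sa drop_size_cat.
rewrite -sb take_size_cat // drop_size_cat //; congr (_ *: _).
have nFE := fits_arp hF; subst nF; move/eqP: (hdF) => dFE; subst dF.
by rewrite -(tevE x) -(tevE y).
Qed.

Lemma ex_split (a : seq (elt P)) n (ha : fits T a n) d (hd' : r + tdeg a == d) :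
  exists a1 b a2, [/\ a = a1 ++ b ++ a2, size a1 = i & fits F b (arp F)].
Proof.
have [a1 [b [a2 [aE sa sb]]]] := fits_split e ha.
exists a1, b, a2; split=> //.
by apply: (fits_fiber e (n := n) (a2 := a2) _ sa sb); rewrite -aE; exact: ha.
Qed.

Lemma fits_same_arity a1 a2 n (z z' : elt P) : earity z = earity z' ->
  fits T (a1 ++ z :: a2) n = fits T (a1 ++ z' :: a2) n.
Proof. by move=> zz; rewrite /fits !map_cat /= zz. Qed.

Lemma tdeg_same (a1 a2 : seq (elt P)) z z' : edeg z = edeg z' ->
  tdeg (a1 ++ z :: a2) = tdeg (a1 ++ z' :: a2).
Proof. by move=> zz; rewrite !tdeg_cat !tdeg_cons zz. Qed.

End Comp.

Lemma endo_comp_multilinear F T S i (e : elem F T S i) p q r (hd : p + q == r)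
  (x : endo P S p) (y : endo P F q) : multilinear (endo_comp_fun (T := T) i (r := r) x y).
Proof.
move=> l1 l2 n n' d' c u v hw hu hv d dw du dv.
set w := c *: u + v in hw dw *.
have iF : (i + card F <= card T)%N by case: e.
have sT : (size l1 + (size l2).+1 = card T)%N by rewrite -(fits_size hw) size_cat.
(* The varying argument is to the left of, among or to the right of those that
   the inner operation takes. *)
case: (ltnP (size l1) i) => h1.
  pose l2' := take (i - (size l1).+1) l2.
  pose b := take (card F) (drop (i - (size l1).+1) l2).
  pose a2 := drop (card F) (drop (i - (size l1).+1) l2).
  have E z : l1 ++ z :: l2 = (l1 ++ z :: l2') ++ b ++ a2.
    by rewrite -catA /= /l2' /b /a2 !cat_take_drop.
  have sz z : size (l1 ++ z :: l2') = i by rewrite size_cat /= size_takel; lia.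
  have sb : size b = card F by rewrite size_takel ?size_drop; lia.
  have hF : fits F b (arp F).
    apply: (fits_fiber e (n := n) (a2 := a2) _ (sz (Elt w)) sb).
    by rewrite -E; exact: hw.
  have hS z : fits T (l1 ++ z :: l2) n ->
      fits S ((l1 ++ z :: l2') ++ Elt (y b _ hF _ (eqxx _)) :: a2) n.
    by rewrite E => h; apply: (fits_collapse e h (sz z)).
  have hdS z : r + tdeg (l1 ++ z :: l2) == d ->
      p + tdeg ((l1 ++ z :: l2') ++ Elt (y b _ hF _ (eqxx _)) :: a2) == d.
    by rewrite E => h; apply: (tdeg_collapse hd h) => /=.
  rewrite (endo_comp_funE x hw dw (hS _ hw) (hdS _ dw) (E _) (sz _)).
  rewrite (endo_comp_funE x hu du (hS _ hu) (hdS _ du) (E _) (sz _)).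
  rewrite (endo_comp_funE x hv dv (hS _ hv) (hdS _ dv) (E _) (sz _)).
  have -> : tdeg (l1 ++ Elt w :: l2') = tdeg (l1 ++ Elt v :: l2') by apply: tdeg_same.
  have -> : tdeg (l1 ++ Elt u :: l2') = tdeg (l1 ++ Elt v :: l2') by apply: tdeg_same.
  rewrite scalerA [c * _]mulrC -scalerA -scalerDr; congr (_ *: _).
  by apply: ev_lin_eq; rewrite -catA.
case: (ltnP (size l1) (i + card F)) => h2.
  pose a1 := take i l1; pose b1 := drop i l1.
  pose b2 := take (i + card F - (size l1).+1) l2.
  pose a2 := drop (i + card F - (size l1).+1) l2.
  have E z : l1 ++ z :: l2 = a1 ++ (b1 ++ z :: b2) ++ a2.
    by rewrite -catA /= catA /a1 /b1 cat_take_drop /b2 /a2 cat_take_drop.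
  have sa : size a1 = i by rewrite size_takel.
  have sb z : size (b1 ++ z :: b2) = card F.
    by rewrite size_cat size_drop /= size_takel; lia.
  have hF z : fits T (l1 ++ z :: l2) n -> fits F (b1 ++ z :: b2) (arp F).
    by rewrite E => h; apply: (fits_fiber e h sa (sb z)).
  pose dF := q + tdeg (b1 ++ Elt w :: b2).
  have dE z : edeg z = d' -> q + tdeg (b1 ++ z :: b2) == dF.
    by move=> zd; apply/eqP; congr (_ + _); apply: tdeg_same.
  have hS z (h : fits T (l1 ++ z :: l2) n) (zd : edeg z = d') :
      fits S (a1 ++ Elt (y _ _ (hF z h) _ (dE z zd)) :: a2) n.
    by have h' := h; rewrite E in h'; apply: (fits_collapse e h' sa); apply: hF.
  have hdS z (h : fits T (l1 ++ z :: l2) n) (zd : edeg z = d') :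
      r + tdeg (l1 ++ z :: l2) == d ->
      p + tdeg (a1 ++ Elt (y _ _ (hF z h) _ (dE z zd)) :: a2) == d.
    by rewrite E => h'; apply: (tdeg_collapse hd h'); exact (dE z zd).
  rewrite (endo_comp_funE x hw dw (hS _ hw erefl) (hdS _ hw erefl dw) (E _) sa).
  rewrite (endo_comp_funE x hu du (hS _ hu erefl) (hdS _ hu erefl du) (E _) sa).
  rewrite (endo_comp_funE x hv dv (hS _ hv erefl) (hdS _ hv erefl dv) (E _) sa).
  rewrite scalerA [c * _]mulrC -scalerA -scalerDr; congr (_ *: _).
  apply: ev_lin_eq; [|reflexivity|reflexivity].
  by congr (_ ++ Elt _ :: _); apply: ev_lin_eq; reflexivity.
pose a1 := take i l1; pose b := take (card F) (drop i l1).
pose l1' := drop (card F) (drop i l1).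
have E z : l1 ++ z :: l2 = a1 ++ b ++ (l1' ++ z :: l2).
  by rewrite !catA -[(a1 ++ b) ++ l1']catA /a1 /b /l1' !cat_take_drop.
have sa : size a1 = i by rewrite size_takel //; lia.
have sb : size b = card F by rewrite size_takel ?size_drop; lia.
have hF : fits F b (arp F).
  apply: (fits_fiber e (n := n) (a2 := l1' ++ Elt w :: l2) _ sa sb).
  by rewrite -E; exact: hw.
have hS z : fits T (l1 ++ z :: l2) n ->
    fits S (a1 ++ Elt (y b _ hF _ (eqxx _)) :: (l1' ++ z :: l2)) n.
  by rewrite E => h; apply: (fits_collapse e h sa).
have hdS z : r + tdeg (l1 ++ z :: l2) == d ->
    p + tdeg (a1 ++ Elt (y b _ hF _ (eqxx _)) :: (l1' ++ z :: l2)) == d.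
  by rewrite E => h; apply: (tdeg_collapse hd h) => /=.
rewrite (endo_comp_funE x hw dw (hS _ hw) (hdS _ dw) (E _) sa).
rewrite (endo_comp_funE x hu du (hS _ hu) (hdS _ du) (E _) sa).
rewrite (endo_comp_funE x hv dv (hS _ hv) (hdS _ dv) (E _) sa).
rewrite scalerA [c * _]mulrC -scalerA -scalerDr; congr (_ *: _).
by apply: (ev_lin_eq _ (a1 := a1 ++ Elt (y b _ hF _ (eqxx _)) :: l1')); rewrite -catA.
Qed.

Definition endo_comp F T S i (e : elem F T S i) p q r (hd : p + q == r)
    (x : endo P S p) (y : endo P F q) : endo P T r :=
  Endo (endo_comp_multilinear e hd x y).

Lemma endo_compE F T S i (e : elem F T S i) p q r (hd : p + q == r)
    (x : endo P S p) (y : endo P F q) a n (ha : fits T a n) d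
    (hd' : r + tdeg a == d) a1 b a2 nF
    (hF : fits F b nF) dF (hdF : q + tdeg b == dF)
    (hS : fits S (a1 ++ Elt (y b nF hF dF hdF) :: a2) n)
    (hdS : p + tdeg (a1 ++ Elt (y b nF hF dF hdF) :: a2) == d) :
  a = a1 ++ b ++ a2 -> size a1 = i ->
  endo_comp e hd x y a n ha d hd' = ksign k (q * tdeg a1) *: x _ n hS d hdS.
Proof. exact: endo_comp_funE. Qed.

Lemma endo_comp_linl F T S i (e : elem F T S i) p q r (hd : p + q == r) (y : endo P F q) :
  linear (fun x => endo_comp e hd x y).
Proof.
move=> c u v; apply: endo_eq => a n ha d hd'; rewrite evL /=.
rewrite scalerA [c * _]mulrC -scalerA -scalerDr; congr (_ *: _).
rewrite /tev; case: pselect => [h|_]; last by rewrite scaler0 addr0.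
by case: pselect => [h'|_]; rewrite ?evL // scaler0 addr0.
Qed.

Lemma endo_comp_linr F T S i (e : elem F T S i) p q r (hd : p + q == r) (x : endo P S p) :
  linear (endo_comp e hd x).
Proof.
move=> c u v; apply: endo_eq => a n ha d hd'; rewrite evL.
have [a1 [b [a2 [aE sa hF]]]] := ex_split e ha hd'.
have hS (y : endo P F q) : fits S (a1 ++ Elt (y b _ hF _ (eqxx _)) :: a2) n.
  by have h := ha; rewrite aE in h; apply: (fits_collapse e h sa).
have hdS (y : endo P F q) : p + tdeg (a1 ++ Elt (y b _ hF _ (eqxx _)) :: a2) == d.
  by have h := hd'; rewrite aE in h; apply: (tdeg_collapse hd h) => /=.
rewrite !(endo_compE e hd x ha hd' (hS _) (hdS _) aE sa).
rewrite scalerA [c * _]mulrC -scalerA -scalerDr; congr (_ *: _).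
exact: ev_lin_eq.
Qed.

End EndOperad.

(** The axiom leaves j' free, but nesting produces an elementary map from H to G with fiber F at j -
    i, and source and target determine the position. *)
Lemma elem_nested_index F G H T S P (f : mor T S) (g : mor S P) (gf : mor T P)
    (fi : mor H G) j i j' : elementary F f j -> elementary G g i ->
  elementary H gf i -> elementary F fi j' -> g j = i -> (j = i + j' :> nat)%N.
Proof.
move=> ef eg egf efi gj.
have [eF eG eH eFH] := And4 (elem_of ef) (elem_of eg) (elem_of egf) (elem_of efi).
have [_ gE] := elementary_squash eg.
have cF := elem_card eF; have cG := elem_card eG; have cH := elem_card eH.
have ij : (i <= j < i + card G)%N.
  have h : (squash i (card G) j = i)%N by rewrite -[LHS]gE gj.
  by have [_ _ G1 _] := eG; move: h; squash_lia.
have [H' eH' eF'] := elem_nested eF eG ij.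
have cH' := elem_card eH'.
have [EH _] : H' = H /\ P = P by apply: elem_uniq eH' eH _; lia.
by subst H'; have := elem_index eF' eFH; lia.
Qed.

Section EndOperad.
Variables (k : fieldType) (P : coll k).

Lemma ev0 T p (f : endo P T p) a1 a2 n n' d'
    (h0 : fits T (a1 ++ Elt (0 : P n' d') :: a2) n) d
    (d0 : p + tdeg (a1 ++ Elt (0 : P n' d') :: a2) == d) :
  f _ n h0 d d0 = 0.
Proof.
have E : a1 ++ Elt (0 : P n' d') :: a2 = a1 ++ Elt (-1 *: 0 + 0 : P n' d') :: a2.
  by rewrite scaler0 addr0.
by rewrite (ev_lin_eq f h0 h0 h0 d0 d0 d0 E) // scaleN1r addNr.
Qed.

Lemma ev_scale T p (f : endo P T p) a a' a1 a2 c n n' d' (x : P n' d')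
    (ha : fits T a n) (ha' : fits T a' n) d (hd : p + tdeg a == d)
    (hd' : p + tdeg a' == d) :
  a = a1 ++ Elt (c *: x) :: a2 -> a' = a1 ++ Elt x :: a2 ->
  f a n ha d hd = c *: f a' n ha' d hd'.
Proof.
move=> E E'; subst a'.
have E0 : a = a1 ++ Elt (c *: x + 0) :: a2 by rewrite addr0.
have h0 : fits T (a1 ++ Elt (0 : P n' d') :: a2) n.
  by rewrite (fits_same_arity _ _ _ _ (z' := Elt x)).
have d0 : p + tdeg (a1 ++ Elt (0 : P n' d') :: a2) == d.
  by rewrite (tdeg_same _ _ (z' := Elt x)).
by rewrite (ev_lin_eq f ha ha' h0 hd hd' d0 E0) // ev0 addr0.
Qed.

(** Both sides are the same nested value. The operation y passes a1, while z passes a1 and b1; on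
    the left z passes a1 as part of the composite of y and z, of degree q + r. *)
Lemma endo_compA F G H T S Q j i j' (eF : elem F T S j) (eG : elem G S Q i)
    (eH : elem H T Q i) (eFH : elem F H G j') p q r pq qr d
    (hpq : p + q == pq) (hqr : q + r == qr) (hl : p + qr == d) (hr : pq + r == d)
    (x : endo P Q p) (y : endo P G q) (z : endo P F r) :
  j = (i + j')%N ->
  endo_comp eH hl x (endo_comp eFH hqr y z) = endo_comp eF hr (endo_comp eG hpq x y) z.
Proof.
move=> ij; apply: endo_eq => a n ha e he.
have [a1 [b [a2 [aE sa hH]]]] := ex_split eH ha he; subst a.
have hb : qr + tdeg b == qr + tdeg b by [].
have [b1 [c [b2 [bE sb hF]]]] := ex_split eFH hH hb; subst b.
pose vz := Elt (z c _ hF _ (eqxx _)).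
have hG : fits G (b1 ++ vz :: b2) (arp H) by apply: (fits_collapse eFH hH sb).
have dG : q + tdeg (b1 ++ vz :: b2) == qr + tdeg (b1 ++ c ++ b2).
  exact: (tdeg_collapse hqr hb).
pose vy := Elt (y _ _ hG _ dG).
have hP : fits Q (a1 ++ vy :: a2) n by apply: (fits_collapse eH ha sa).
have dP : p + tdeg (a1 ++ vy :: a2) == e by apply: (tdeg_collapse hl he).
pose vyz := Elt (endo_comp eFH hqr y z _ _ hH _ hb).
have hP' : fits Q (a1 ++ vyz :: a2) n by apply: (fits_collapse eH ha sa).
have dP' : p + tdeg (a1 ++ vyz :: a2) == e by apply: (tdeg_collapse hl he).
rewrite (endo_compE eH hl _ ha he hP' dP' erefl sa).
have vyzE : vyz = Elt (ksign k (r * tdeg b1) *: y _ _ hG _ dG).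
  by rewrite /vyz (endo_compE eFH hqr _ hH hb hG dG erefl sb).
have aE : a1 ++ vyz :: a2 = a1 ++ Elt (ksign k (r * tdeg b1) *: y _ _ hG _ dG) :: a2.
  by rewrite vyzE.
rewrite (ev_scale x hP' hP dP' dP aE erefl).
have E : a1 ++ (b1 ++ c ++ b2) ++ a2 = (a1 ++ b1) ++ c ++ (b2 ++ a2).
  by rewrite -!catA.
have E' : (a1 ++ b1) ++ vz :: (b2 ++ a2) = a1 ++ (b1 ++ vz :: b2) ++ a2.
  by rewrite -!catA.
have hS : fits S ((a1 ++ b1) ++ vz :: (b2 ++ a2)) n.
  have ha' := ha; rewrite E in ha'; apply: (fits_collapse eF ha') => //.
  by rewrite size_cat sa sb ij.
have dS : pq + tdeg ((a1 ++ b1) ++ vz :: (b2 ++ a2)) == e.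
  by have he' := he; rewrite E in he'; apply: (tdeg_collapse hr he').
rewrite (endo_compE eF hr _ ha he hS dS E); last by rewrite size_cat sa sb ij.
rewrite (endo_compE eG hpq _ hS dS hP dP E' sa) tdeg_cat.
by rewrite !scalerA; congr (_ *: _); rewrite -(eqP hqr); ksign_tac.
Qed.

(** On one side z passes the arguments b of y, on the other the value of y on b. The degrees differ
    by q, which accounts for the sign (-1)^(q r). *)
Lemma endo_compC F G T S1 S2 Q j l i m (eF : elem F T S1 j) (eG : elem G S1 Q i)
    (eG' : elem G T S2 l) (eF' : elem F S2 Q m) p q r pq pr d
    (hpq : p + q == pq) (hpr : p + r == pr) (h1 : pr + q == d) (h2 : pq + r == d)
    (x : endo P Q p) (y : endo P F q) (z : endo P G r) :
  m = j -> (j < i)%N -> l = (i + (card F).-1)%N ->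
  ksign k (q * r) *: endo_comp eF h1 (endo_comp eG hpr x z) y =
  endo_comp eG' h2 (endo_comp eF' hpq x y) z.
Proof.
move=> mj ji li; apply: endo_eq => a n ha e he; rewrite evZ.
have [_ _ F1 jF] := eF.
have [e1 [c [a3 [aE se hG]]]] := ex_split eG' ha he; subst a.
pose a1 := take j e1; pose b := take (card F) (drop j e1).
pose a2 := drop (card F) (drop j e1).
have e1E : e1 = a1 ++ b ++ a2 by rewrite !cat_take_drop.
have sa : size a1 = j by rewrite size_takel //; lia.
have sb : size b = card F by rewrite size_takel // size_drop; lia.
have sa2 : (size e1 = j + (card F + size a2))%N by rewrite e1E !size_cat sa sb.
have E : e1 ++ c ++ a3 = a1 ++ b ++ (a2 ++ c ++ a3) by rewrite e1E -!catA.
have hF : fits F b (arp F).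
  by have ha' := ha; rewrite E in ha'; apply: (fits_fiber eF ha').
pose vy := Elt (y b _ hF _ (eqxx _)); pose vz := Elt (z c _ hG _ (eqxx _)).
have hS1 : fits S1 (a1 ++ vy :: (a2 ++ c ++ a3)) n.
  by have ha' := ha; rewrite E in ha'; apply: (fits_collapse eF ha').
have dS1 : pr + tdeg (a1 ++ vy :: (a2 ++ c ++ a3)) == e.
  by have he' := he; rewrite E in he'; apply: (tdeg_collapse h1 he').
have E1 : a1 ++ vy :: (a2 ++ c ++ a3) = (a1 ++ vy :: a2) ++ c ++ a3 by rewrite -!catA.
have s1 : size (a1 ++ vy :: a2) = i by rewrite size_cat /= sa; lia.
have hQ : fits Q ((a1 ++ vy :: a2) ++ vz :: a3) n.
  by have h := hS1; rewrite E1 in h; apply: (fits_collapse eG h).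
have dQ : p + tdeg ((a1 ++ vy :: a2) ++ vz :: a3) == e.
  by have h := dS1; rewrite E1 in h; apply: (tdeg_collapse hpr h).
rewrite (endo_compE eF h1 _ ha he hS1 dS1 E sa) (endo_compE eG hpr _ hS1 dS1 hQ dQ E1 s1).
have hS2 : fits S2 (e1 ++ vz :: a3) n by apply: (fits_collapse eG' ha).
have dS2 : pq + tdeg (e1 ++ vz :: a3) == e by apply: (tdeg_collapse h2 he).
have E2 : e1 ++ vz :: a3 = a1 ++ b ++ (a2 ++ vz :: a3) by rewrite e1E -!catA.
have EQ : (a1 ++ vy :: a2) ++ vz :: a3 = a1 ++ vy :: (a2 ++ vz :: a3) by rewrite -!catA.
have hQ' := hQ; have dQ' := dQ; rewrite EQ in hQ' dQ'.
have sj : size a1 = m by rewrite mj.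
rewrite (endo_compE eG' h2 _ ha he hS2 dS2 erefl se).
rewrite (endo_compE eF' hpq _ hS2 dS2 hQ' dQ' E2 sj).
rewrite (ev_congr x hQ hQ' dQ dQ' EQ) !scalerA e1E !tdeg_cat tdeg_cons /=.
by congr (_ *: _); ksign_tac.
Qed.

Definition unit_fun U a n (_ : fits U a n) d (_ : 0 + tdeg a == d) : P n d :=
  if a is [:: z] then eproj n d z else 0.

Lemma unit_multilinear U : trivial U -> multilinear (@unit_fun U).
Proof.
move=> /eqP hU a1 a2 n n' d' c x y hxy hx hy d dxy dx dy; rewrite /unit_fun.
have := fits_size hxy; rewrite hU size_cat /=.
by case: a1 a2 {hxy hx hy dxy dx dy} => [|? l] [|? ?] /= h; try lia; apply: eproj_lin.
Qed.

Definition endo_unit U (hU : trivial U) : endo P U 0 := Endo (unit_multilinear hU).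

Lemma endo_comp1 T U i (e : elem T T U i) (hU : trivial U) p (h : 0 + p == p)
    (x : endo P T p) : endo_comp e h (endo_unit hU) x = x.
Proof.
have [|i0 _] := elem_full e; first by rewrite (eqP hU).
apply: endo_eq => a n ha d hd; subst i.
have E : a = [::] ++ a ++ [::] by rewrite cats0.
have hS : fits U ([::] ++ Elt (x a n ha d hd) :: [::]) n.
  by have ha' := ha; rewrite E in ha'; apply: (fits_collapse e ha').
have dS : 0 + tdeg ([::] ++ Elt (x a n ha d hd) :: [::]) == d.
  by have h' := hd; rewrite E in h'; apply: (tdeg_collapse h h').
rewrite (endo_compE e h _ ha hd hS dS E) //.
by rewrite tdeg_nil mulr0 scale1r [LHS]eprojK.
Qed.

Definition end_operad : operad k.
Proof.
apply: (@Operad k (fun T p => endo P T p)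
  (fun F T S f i ef p q r h x y => endo_comp (elem_of ef) h x y) endo_unit).
- by move=> *; apply: endo_comp_linl.
- by move=> *; apply: endo_comp_linr.
- move=> F G H T S Q f g gf fi j i j' ef eg egf efi gj _ p q r pq qr d *.
  exact: endo_compA (elem_nested_index ef eg egf efi gj).
- move=> F G T S1 S2 Q f1 g1 f2 g2 j i l m ef1 eg1 ef2 eg2 _ gi gj im.
  move=> p q r pq pr d hpq hpr h1 h2 x y z.
  have [[iG g1E] [mF g2E]] := conj (elementary_squash eg1) (elementary_squash eg2).
  have [[_ _ G1 _] [_ _ F1 _]] := conj (elem_of eg1) (elem_of eg2).
  have hj : squash i (card G) j = m by rewrite -[LHS]g1E gj.
  have hl : squash m (card F) l = i by rewrite -[LHS]g2E gi.
  have im' : (i : nat) <> m by apply/eqP.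
  (* Axiom (b) does not say which interval lies on the left. The second order is the first one with
     the roles exchanged, and the sign is its own inverse. *)
  case: (ltnP m i) => mi.
    by apply: endo_compC; move: hj hl; squash_lia.
  rewrite -(endo_compC (elem_of ef2) (elem_of eg2) (elem_of ef1) (elem_of eg1) hpr hpq h2 h1).
  + by rewrite scalerA [r * q]mulrC ksignK scale1r.
  + by move: hl; squash_lia.
  + by move: hl; squash_lia.
  + by move: hj; squash_lia.
- by move=> *; apply: endo_comp1.
Defined.

Variable M : operad k.

Definition alg_of_mor (f : operad_mor M end_operad) : alg_str M P.
Proof.
apply: (@AlgStr k M P (fun T a n ha p d hd m => (f T p m : endo P T p) a n ha d hd)).
- by move=> T a n ha p d hd c x y; rewrite (omap_lin f) evL.
- by move=> *; apply: ev_lin.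
- by move=> U hU n d x hx hd; rewrite (omap_unit f) [LHS]eprojK.
- move=> F T S g i ef p q r h m m' a1 b a2 n nF d dF hT hF dT dF' hS dS sa.
  by rewrite (omap_comp f); apply: endo_compE.
Defined.

Definition mor_of_alg (s : alg_str M P) : operad_mor M end_operad.
Proof.
apply: (@OperadMor k M end_operad
  (fun T p m => @Endo k P T p (fun a n ha d hd => act s ha hd m)
     (fun a1 a2 n n' d' c x y hxy hx hy d dxy dx dy =>
        act_linr s hxy hx hy dxy dx dy m))).
- by move=> T p c x y; apply: endo_eq => a n ha d hd /=; rewrite (act_linl s).
- move=> F T S f i ef p q r h x y; apply: endo_eq => a n ha d hd.
  have e := elem_of ef; have [a1 [b [a2 [aE sa hF]]]] := ex_split e ha hd; subst a.
  pose v := Elt (act s hF (eqxx (q + tdeg b)) y).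
  have hS : fits S (a1 ++ v :: a2) n by apply: (fits_collapse e ha).
  have dS : p + tdeg (a1 ++ v :: a2) == d by apply: (tdeg_collapse h hd).
  rewrite [LHS](act_comp ef h x ha hd hS dS sa).
  by rewrite (endo_compE (y := Endo _) (elem_of ef) h _ ha hd hS dS erefl sa).
- move=> U hU; apply: endo_eq => a n ha d hd /=.
  have := fits_size ha; rewrite (eqP hU) /unit_fun.
  case: a ha hd => [|[m j x] [|? ?]] //= ha hd _.
  have mn : m = n.
    case/andP: (ha) => /eqP; rewrite (eqP hU) /= => -[hm] /eqP hn; apply: val_inj.
    rewrite /= hm -hn fibE -(size_word U); apply/eqP; rewrite -all_count.
    by apply/allP => l; rewrite mem_word (eqP hU) /=; case: l.
  have jd : j = d by rewrite -(eqP hd) tdeg_cons tdeg_nil addr0 add0r.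
  by subst m j; rewrite eprojK; apply: act_unit.
Defined.

End EndOperad.

(** * Operads generated by operations with two letters *)

Section Generation.
Variables (k : fieldType) (e : int) (M : operad k) (g : forall r, M r e).

Definition arity2_rel : Prop :=
  forall F G T S Q (eF : elem F T S 0) (eG : elem G T Q 1) d (h : e + e == d),
    card T = 3%N -> card F = 2%N -> card G = 2%N ->
    oc eF h (g S) (g F) = ksign k e *: oc eG h (g Q) (g G).

(** Every suboperad of M that contains the two-letter elements of g is all of M, put as an induction
    principle. *)
Definition generates : Prop :=
  forall V : forall T p, M T p -> Prop, (forall T p, subspace (@V T p)) ->
    (forall U (hU : trivial U), V U 0 (ounit M hU)) ->
    (forall r, card r = 2%N -> V r e (g r)) ->
    (forall F T S f i (ef : @elementary F T S f i) p q r (h : p + q == r) x y,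
      V S p x -> V F q y -> V T r (ocomp ef h x y)) ->
    forall T p x, V T p x.

End Generation.

(** Only the existence of the extension; its uniqueness is the business of [generates]. *)
Definition free_on_binary (k : fieldType) e (M : operad k) (g : forall r, M r e) : Prop :=
  forall (N : operad k) (g' : forall r, N r e), arity2_rel g' ->
    exists f : operad_mor M N, forall r, card r = 2%N -> f r e (g r) = g' r.

Section Presented.
Variables (k : fieldType) (D : quadratic_data k).

Definition pcls T p (x : free_operad (qgen D) T p) : presented D T p :=
  qcls (ideal_genP (@qrel k D)) x.

Lemma pclsL T p : linear (@pcls T p).
Proof. exact: qclsL. Qed.

Lemma pclsP T p (x y : free_operad (qgen D) T p) :
  pcls x = pcls y <-> ideal_gen (@qrel k D) (x - y).
Proof. exact: qclsP. Qed.

Lemma pcls_comp F T S f i (ef : @elementary F T S f i) p q r (h : p + q == r) x y :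
  ocomp ef h (pcls x) (pcls y) = pcls (ocomp ef h x y).
Proof. exact: qcompE. Qed.

Lemma pcls_oc F T S i (e : elem F T S i) p q r (h : p + q == r) x y :
  oc e h (pcls x) (pcls y) = pcls (oc e h x y).
Proof. exact: pcls_comp. Qed.

Lemma pcls_rel T p (x y : free_operad (qgen D) T p) : qrel (x - y) -> pcls x = pcls y.
Proof. by move=> R; apply/pclsP => I _; apply. Qed.

Lemma presented_ind (V : forall T p, presented D T p -> Prop) :
  (forall T p, subspace (@V T p)) ->
  (forall U (hU : trivial U), V U 0 (ounit (presented D) hU)) ->
  (forall T p (x : qgen D T p), V T p (pcls (fgen x))) ->
  (forall F T S f i (ef : @elementary F T S f i) p q r (h : p + q == r) x y,
    V S p x -> V F q y -> V T r (ocomp ef h x y)) ->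
  forall T p x, V T p x.
Proof.
move=> Vsub V1 Vg Vc T p; elim/qclsW; elim/fclsW.
elim=> {T p}.
- move=> T p; case: (Vsub T p) => V0 _.
  by move: V0; congr V; symmetry; apply: lin0 (@pclsL _ _).
- move=> T p x IHx y IHy; case: (Vsub T p) => _ /(_ 1 _ _ IHx IHy).
  by rewrite -qclsL /= scale1r -clsD.
- move=> T p c x IHx; case: (Vsub T p) => V0 /(_ c _ _ IHx V0).
  by rewrite addr0 -qclsZ -clsZ.
- by move=> T p x; apply: Vg.
- by move=> U hU; apply: V1.
- move=> F T S f i ef p q r h x IHx y IHy.
  by have := Vc _ _ _ _ _ ef _ _ _ h _ _ IHx IHy; rewrite pcls_comp [ocomp _ _ _ _]fcompE.
Qed.

Section Extension.
Variables (N : operad k) (f : operad_mor (free_operad (qgen D)) N).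
Hypothesis fR : forall T p x, @qrel k D T p x -> f T p x = 0.

Lemma ideal_gen_ker T p x : ideal_gen (@qrel k D) x -> f T p x = 0.
Proof.
move=> /(_ (fun T p x => f T p x = 0)); apply; last exact: fR.
split=> [{p x}T p|F {p x}T S h i ef p q r hd x y fx|F {p x}T S h i ef p q r hd x y fy].
- split=> [|c x y fx fy]; first exact: lin0 (omap_lin f (p := p)).
  by rewrite (omap_lin f) fx fy scaler0 addr0.
- by rewrite omap_comp fx (lin0 (ocomp_linl ef hd _)).
- by rewrite omap_comp fy (lin0 (ocomp_linr ef hd _)).
Qed.

Definition pext_fun T p (u : presented D T p) : N T p :=
  f T p (qrep (idI := ideal_genP (@qrel k D)) u).

Lemma pext_funE T p x : pext_fun (pcls x) = f T p x.
Proof.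
have : ideal_gen (@qrel k D) (qrep (pcls x) - x) by apply/pclsP/repK.
move/ideal_gen_ker => E; apply/eqP; rewrite -subr_eq0; apply/eqP; rewrite -[RHS]E.
by rewrite -[X in _ = f T p X]addrC -scaleN1r (omap_lin f) scaleN1r addrC.
Qed.

Definition presented_ext : operad_mor (presented D) N.
Proof.
apply: (@OperadMor k (presented D) N pext_fun).
- move=> T p c; elim/qclsW => x; elim/qclsW => y.
  by rewrite -[c *: _ + _]pclsL !pext_funE (omap_lin f).
- move=> F T S h i ef p q r hd; elim/qclsW => x; elim/qclsW => y.
  by rewrite pcls_comp !pext_funE omap_comp.
- by move=> U hU; rewrite [ounit _ _]/(pcls (ounit _ hU)) pext_funE omap_unit.
Defined.

Lemma presented_extE T p x : presented_ext T p (pcls x) = f T p x.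
Proof. exact: pext_funE. Qed.

End Extension.
End Presented.

(** * The terminal operad and its binary quadratic presentation *)

Section Terminal.
Variable k : fieldType.

Lemma line0 b (x : line k b) : b = false -> x = 0.
Proof. by move=> b0; subst b; apply/rowP => -[]. Qed.

Lemma coef_terminal_comp F T S f i (ef : @elementary F T S f i) p q r (h : p + q == r)
    (x : terminal k S p) (y : terminal k F q) :
  coef (ocomp ef h x y) = coef x * coef y.
Proof. exact: coef_scal_comp. Qed.

Lemma tone_comp F T S i (e : elem F T S i) (h : 0 + 0 == 0 :> int) :
  oc e h (tone k S) (tone k F) = tone k T.
Proof. by rewrite [LHS]/(scal _ _) !scalK mul1r. Qed.

Lemma terminal_arity2_rel : arity2_rel (tone k).
Proof.
move=> F G T S Q eF eG d h *; have d0 : d = 0 by rewrite -(eqP h).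
by subst d; rewrite scale1r !tone_comp.
Qed.

Lemma terminal_generates : generates (tone k).
Proof.
move=> V Vsub V1 Vg Vc.
have Vtone T : V T 0 (tone k T).
  have [n] := ubnP (card T); elim: n T => // n IH T Tn.
  have T0 := letters_gt0 T; case: (ltngtP (card T) 2) => T2.
  - have hT : trivial T by apply/eqP; lia.
    exact: (V1 T hT).
  - have [||F [S [e cF]]] := @ex_elem T 0 (card T).-1; try lia.
    have cS := elem_card e.
    have h : 0 + 0 == 0 :> int by [].
    by rewrite -(tone_comp e h); apply: Vc; apply: IH; lia.
  - exact: Vg.
move=> T p x; case: (Vsub T p) => V0 VL.
case: (eqVneq p 0) => [p0|/negPf p0]; last by rewrite (line0 x p0).
subst p; have -> : x = coef x *: tone k T + 0.
  rewrite addr0 -[LHS]coefK -[X in scal _ X]mulr1.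
  exact: (lin_scale (@scal_lin k _) (coef x) 1).
exact: VL.
Qed.

Lemma terminal_free_on_binary : free_on_binary (tone k).
Proof.
move=> N g' g'rel; apply: terminal_ext.
move=> F G T S Q eF eG h T3 F2 G2.
by rewrite (g'rel _ _ _ _ _ eF eG 0 h) // scale1r.
Qed.

Lemma terminal_one_connected : one_connected (terminal k).
Proof.
move=> U hU; split=> [|p x /negPf p0]; last exact: line0.
exists (@coef k _) => [c|x].
  by rewrite (lin_scale (@coef_lin k _)) scalK [_ *: _]mulr1.
rewrite -[RHS]coefK -[X in _ = scal _ X]mulr1.
by symmetry; apply: (lin_scale (@scal_lin k _) (coef x) 1).
Qed.

Lemma terminal_binary : binary (terminal_data k).
Proof.
move=> T p x x0; apply/eqP/negPn/negP => T2; apply: x0; apply: line0.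
by apply/negP => /andP [/eqP c2 _]; move: T2; rewrite /grade c2.
Qed.

Definition tgen1 T : tgen k T 0 := scal _ 1.

Lemma tgenE T p (x : tgen k T p) : x <> 0 -> p = 0 /\ card T = 2%N.
Proof.
move=> x0; suff: (card T == 2%N) && (p == 0) by case/andP => /eqP ? /eqP.
by apply/negPn/negP => /negPf h; apply: x0; apply: line0.
Qed.

Lemma tgen_coef T (x : tgen k T 0) : x = coef x *: tgen1 T.
Proof.
rewrite -[LHS]coefK -[X in scal _ X]mulr1.
exact: (lin_scale (@scal_lin k _) (coef x) 1).
Qed.

Lemma coef_tgen1 T : card T = 2%N -> coef (tgen1 T) = 1.
Proof.
have h (b : bool) : b -> coef (scal b (1 : k)) = 1 by move=> ->; apply: scalK.
by move=> T2; apply: h; rewrite T2.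
Qed.

Definition pgen T : presented (terminal_data k) T 0 :=
  pcls (D := terminal_data k) (fgen (tgen1 T)).

Lemma pgen_generates : generates pgen.
Proof.
move=> V Vsub V1 Vg Vc; apply: presented_ind => // T p x.
case: (Vsub T p) => V0 VL.
have L : linear (fun x : tgen k T p => pcls (D := terminal_data k) (fgen x)).
  by move=> c u v; rewrite fgen_lin pclsL.
have [->|x0] := pselect (x = 0); first by rewrite (lin0 L).
have [p0 T2] := tgenE x0; subst p.
by rewrite (tgen_coef x) (lin_scale L) -[_ *: _]addr0; apply: VL => //; apply: Vg.
Qed.

Lemma tproj_gen T p (x : tgen k T p) : tproj k T p (fgen x) = tincl x.
Proof. exact: free_ext_gen. Qed.

Lemma fweight_oc F T S i (e : elem F T S i) p q r (h : p + q == r)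
    (x : tgen k S p) (y : tgen k F q) :
  fweight 2 (oc (M := free_operad (tgen k)) e h (fgen x) (fgen y)).
Proof. by apply: (fweight_comp (n := 1) (m := 1)); constructor. Qed.

(** The difference of the two composites has weight two, and [tproj] kills it because both
    composites map to 1. *)
Lemma pgen_rel : arity2_rel pgen.
Proof.
move=> F G T S Q eF eG d h T3 F2 G2; have d0 : d = 0 by rewrite -(eqP h).
have cS := elem_card eF; have cQ := elem_card eG.
subst d; rewrite scale1r !pcls_oc; apply: pcls_rel; split.
  rewrite addrC -scaleN1r; apply: fweight_lin; exact: fweight_oc.
rewrite addrC -scaleN1r (omap_lin (tproj k)) !omap_oc !tproj_gen.
have E R : card R = 2%N -> tincl (tgen1 R) = tone k R.
  by move=> R2; rewrite /tincl coef_tgen1.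
by rewrite !E ?tone_comp ?scaleN1r ?addNr //; lia.
Qed.

(** The projection descends to the presented operad, and freeness of the terminal operad gives a
    morphism back. Both composites fix generators, hence are identities by [generates]. *)
Lemma terminal_presents : presents (terminal_data k) (terminal k).
Proof.
have kill T p x : @qrel k (terminal_data k) T p x -> tproj k T p x = 0 by case.
have [f fg] := terminal_free_on_binary pgen_rel.
exists (presented_ext kill) => T p; exists (f T p).
- move: T p; apply: (pgen_generates
    (V := fun T p x => f T p (presented_ext kill T p x) = x)).
  + move=> T p; split=> [|c x y hx hy].
      by rewrite (lin0 (omap_lin (presented_ext kill) (p := p))) (lin0 (omap_lin f (p := p))).
    by rewrite omap_lin omap_lin hx hy.
  + by move=> U hU; rewrite !omap_unit.
  + move=> r r2; rewrite presented_extE tproj_gen -(fg r r2); congr (f r 0 _).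
    by rewrite /tincl coef_tgen1.
  + by move=> F T S h i ef p q r hd x y hx hy; rewrite !omap_comp hx hy.
- move: T p; apply: (terminal_generates
    (V := fun T p x => presented_ext kill T p (f T p x) = x)).
  + move=> T p; split=> [|c x y hx hy].
      by rewrite (lin0 (omap_lin f (p := p))) (lin0 (omap_lin (presented_ext kill) (p := p))).
    by rewrite omap_lin omap_lin hx hy.
  + by move=> U hU; rewrite !omap_unit.
  + by move=> r r2; rewrite fg // presented_extE tproj_gen /tincl coef_tgen1.
  + by move=> F T S h i ef p q r hd x y hx hy; rewrite !omap_comp hx hy.
Qed.

End Terminal.

(** * The Koszul dual *)

Section KoszulDual.
Variable k : fieldType.
Notation E := (tgen k).
Notation E' := (sdual (tgen k)).
Notation KD := (koszul_dual (terminal_data k)).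

Lemma dual_fun_lin (V : lmodType k) (x : dual V) : linear (dual_fun x).
Proof. by case: x => f /= /asboolP. Qed.

Lemma seval_same T p (x : E' T p) (y : E T (p - 1)) : seval x y = dual_fun x y.
Proof.
rewrite /seval; case: pselect => [e|[]//].
by rewrite (Prop_irrelevance e erefl).
Qed.

Lemma seval_neq T p (x : E' T p) S q (y : E S q) : S <> T -> seval x y = 0.
Proof. by move=> ST; rewrite /seval; case: pselect => // e; case: ST; case: e. Qed.

(** The coordinate of x with respect to [one_dual], and zero where the component vanishes. *)
Definition dcoef T p (x : E' T p) : k := dual_fun x (scal _ 1).

Lemma dcoef_lin T p : linear (@dcoef T p : E' T p -> k^o).
Proof. by []. Qed.

Lemma dual0 T p (x : E' T p) : (p != 1) || (card T != 2%N) -> x = 0.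
Proof.
move=> h; apply/val_inj/funext => y /=.
have -> : y = 0.
  by apply: line0; move: h; case: (card T == 2%N) => //=; lia.
exact: (lin0 (dual_fun_lin x)).
Qed.

Lemma dcoefE T (x : E' T 1) : x = dcoef x *: one_dual k T.
Proof.
apply/val_inj/funext => y /=.
rewrite [LHS](_ : _ = dual_fun x (coef y *: tgen1 k T)); last by rewrite -tgen_coef.
by rewrite (lin_scale (dual_fun_lin x)) [RHS]mulrC.
Qed.

Lemma dcoef0 T p (x : E' T p) : (p != 1) || (card T != 2%N) -> dcoef x = 0.
Proof. by move=> h; rewrite (dual0 x h). Qed.

Lemma dual_gen_generates : generates (dual_gen k).
Proof.
move=> V Vsub V1 Vg Vc; apply: presented_ind => // T p x.
case: (Vsub T p) => V0 VL.
have L : linear (fun x : E' T p => pcls (D := dual_data (terminal_data k)) (fgen x)).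
  by move=> c u v; rewrite fgen_lin pclsL.
have [h|] := boolP ((p != 1) || (card T != 2%N)); first by rewrite (dual0 x h) (lin0 L).
rewrite negb_or !negbK => /andP [/eqP p1 /eqP T2]; subst p.
by rewrite (dcoefE x) (lin_scale L) -[_ *: _]addr0; apply: VL => //; apply: Vg.
Qed.

Lemma seval_tgen1 T p (x : E' T p) c : seval x (c *: tgen1 k T) = c * dcoef x.
Proof.
have [p1|p1] := eqVneq p 1; last first.
  rewrite dcoef0 ?p1 // mulr0 /seval; case: pselect => // e; exfalso.
  by case: e => e; move/eqP: p1; lia.
subst p; rewrite (seval_same x) (lin_scale (dual_fun_lin x)) //.
Qed.

Lemma seval_one_dual T q (y : E T q) : seval (one_dual k T) y = coef y.
Proof.
have [q0|/eqP q0] := pselect (q = 0); last first.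
  rewrite /seval; case: pselect => [e|_].
    by exfalso; case: e => e; move/eqP: q0; lia.
  have h : (card T == 2%N) && (q == 0) = false by rewrite (negPf q0) andbF.
  by rewrite (line0 y h); symmetry; apply: lin0 (@coef_lin k _).
by subst q; apply: (seval_same (p := 1)).
Qed.

(* An object with three letters has exactly two elementary quotients with two
   letters. *)
Section ThreeLetters.
Variables (F G T S Q : per) (eF : elem F T S 0) (eG : elem G T Q 1).
Hypotheses (T3 : card T = 3%N) (F2 : card F = 2%N) (G2 : card G = 2%N).

Lemma quotients_neq : S <> Q.
Proof. by move=> SQ; subst Q; have := elem_index eF eG. Qed.

Lemma tens2_elem (E0 : collection1 k) p (t : tens2 E0 T p) :
  elem (t2fib t) T (t2tgt t) (t2idx t).
Proof. exact: elem_of (t2elem t). Qed.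

Lemma tens2_cases (E0 : collection1 k) p (t : tens2 E0 T p) :
  card (t2fib t) = 2%N ->
  (t2fib t = F /\ t2tgt t = S /\ t2idx t = 0%N :> nat) \/
  (t2fib t = G /\ t2tgt t = Q /\ t2idx t = 1%N :> nat).
Proof.
move=> t2; have e := tens2_elem t; have [_ _ _] := e; rewrite t2 T3 => i1.
have : (t2idx t = 0%N :> nat) \/ (t2idx t = 1%N :> nat) by lia.
case=> ti; rewrite ti in e; [left|right].
  by have [? ?] : t2fib t = F /\ t2tgt t = S by apply: elem_uniq e eF _; lia.
by have [? ?] : t2fib t = G /\ t2tgt t = Q by apply: elem_uniq e eG _; lia.
Qed.

End ThreeLetters.


Definition elem_tens2 (E0 : collection1 k) F T S i (e : elem F T S i)
    (S0 : (0 < grade S)%N) p dx dy (h : dy + dx == p) (x : E0 F dx) (y : E0 S dy) :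
    tens2 E0 T p :=
  let f := cid (elemP e) in
  let j := cid (svalP f) in Tens2 (proj2 (svalP j)) S0 h x y.

Lemma realize_cons (E0 : collection1 k) T p (t : tens2 E0 T p) u :
  realize (t :: u) = ksign k (t2degx t * t2degy t) *:
    ocomp (o := free_operad E0) (t2elem t) (t2deg t) (fgen (t2y t)) (fgen (t2x t)) + realize u.
Proof. exact: big_cons. Qed.

Lemma realize_nil (E0 : collection1 k) T p : realize ([::] : seq (tens2 E0 T p)) = 0.
Proof. exact: big_nil. Qed.

Lemma coef_tincl T p (x : E T p) : coef (tincl x) = coef x.
Proof.
rewrite /tincl; have [->|x0] := pselect (x = 0).
  by rewrite (lin0 (@coef_lin k _)) coef_scal0.
by have [p0 _] := tgenE x0; subst p; rewrite scalK.
Qed.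

(** The generators of the terminal operad have degree 0, so the signs in [realize] disappear and the
    value of v is the plain sum of its coefficients. *)
Lemma coef_tproj_realize T p (v : seq (tens2 E T p)) :
  coef (tproj k T p (realize v)) = \sum_(t <- v) coef (t2x t) * coef (t2y t).
Proof.
elim: v => [|t v IH].
  by rewrite realize_nil big_nil (lin0 (omap_lin (tproj k) (p := p))) (lin0 (@coef_lin k _)).
rewrite realize_cons big_cons (omap_lin (tproj k)) (@coef_lin k _) IH; congr (_ + _).
rewrite omap_comp coef_terminal_comp !tproj_gen !coef_tincl.
have [->|x0] := pselect (t2x t = 0); first
  by rewrite (lin0 (@coef_lin k _)) mul0r mulr0 scaler0.
have [p0 _] := tgenE x0.
have -> : ksign k (t2degx t * t2degy t) = 1 by rewrite p0 mul0r.
by rewrite [LHS]mul1r mulrC.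
Qed.

Lemma seval_one_dual_eq T S q (y : E S q) :
  seval (one_dual k T) y = if `[< S = T >] then coef y else 0.
Proof.
case: asboolP => [ST|ST]; last exact: seval_neq.
by subst S; apply: seval_one_dual.
Qed.

Lemma seval_tgen1_eq T p (x : E' T p) S c :
  seval x (c *: tgen1 k S) = if `[< S = T >] then c * dcoef x else 0.
Proof.
case: asboolP => [ST|ST]; last exact: seval_neq.
by subst S; apply: seval_tgen1.
Qed.

Lemma dual_genE T :
  dual_gen k T = pcls (D := dual_data (terminal_data k)) (fgen (one_dual k T)).
Proof. by []. Qed.

Lemma dual_gen_rel : arity2_rel (dual_gen k).
Proof.
move=> F G T S Q eF eG d h T3 F2 G2; have cS := elem_card eF; have cQ := elem_card eG.
have SQ := quotients_neq eF eG.
have d2 : d = 1 + 1 by rewrite -(eqP h).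
subst d; rewrite !dual_genE.
rewrite !pcls_oc -(lin_scale (@pclsL _ _ _ _)); apply: pcls_rel.
have S0 : (0 < grade S)%N by rewrite /grade; lia.
have Q0 : (0 < grade Q)%N by rewrite /grade; lia.
pose t0 := elem_tens2 eF S0 h (one_dual k F : E' F 1) (one_dual k S).
pose t1 := elem_tens2 eG Q0 h (one_dual k G : E' G 1) (one_dual k Q).
(* For e = 1 the difference to be killed is o_0 + o_1. Each summand acquires the sign (-1)^(1 * 1)
   in [realize], which the factor -1 cancels. *)
exists (map (tens2_scale (-1)) [:: t0; t1]).
  rewrite realize_scale !realize_cons realize_nil addr0 scalerDr !scalerA /=.
  have -> : -1 * ksign k (1 * 1) = 1 by rewrite /ksign /= expr1 mulrNN mulr1.
  by rewrite /ksign expr1 !scaleN1r opprK !scale1r.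
move=> q v [_ Rv]; rewrite pairing_scale (_ : pairing _ _ = 0) ?mulr0 //.
rewrite /pairing !big_cons big_nil addr0 -big_split /=.
(* Every nonzero term of v lies on one of the two quotients, so pairing with t0 and t1 adds up all
   coefficients of v, which is its value in the terminal operad. *)
have Ec : \sum_(t <- v) coef (t2x t) * coef (t2y t) = 0.
  by rewrite -coef_tproj_realize Rv (lin0 (@coef_lin k _)).
rewrite -[RHS]Ec; apply: eq_bigr => t _; rewrite /pair1 /=.
rewrite !seval_one_dual_eq.
have [->|x0] := pselect (t2x t = 0).
  by rewrite (lin0 (@coef_lin k _)) !if_same !mul0r !mulr0 addr0.
have [p0 x2] := tgenE x0.
have -> : ksign k (1 * t2degx t) = 1 by rewrite p0.
rewrite !mul1r.
case: (tens2_cases eF eG T3 F2 G2 x2) => -[hF [hS _]].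
  have hQ : t2tgt t <> Q by rewrite hS.
  by rewrite (asboolT hF) (asboolT hS) (asboolF hQ) mulr0 addr0.
have hQ : t2tgt t <> S by rewrite hS; apply: nesym.
by rewrite (asboolT hF) (asboolT hS) (asboolF hQ) mulr0 add0r.
Qed.

(** * Extending a family with the relation to the Koszul dual *)

Section Universal.
Variables (N : operad k) (g : forall r, N r 1).
Hypothesis g_rel : arity2_rel g.

Definition gdeg T p : N T p := if 1 =P p is ReflectT e then ecast p (N T p) e (g T) else 0.

Lemma gdeg1 T : gdeg T 1 = g T.
Proof. by rewrite /gdeg; case: eqP => // e; rewrite (eq_irrelevance e erefl). Qed.

Definition gmap T p (x : E' T p) : N T p := dcoef x *: gdeg T p.

Lemma gmap_lin T p : linear (@gmap T p).
Proof. by move=> c x y; rewrite /gmap dcoef_lin scalerDl scalerA. Qed.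

Let f := free_ext gmap_lin.

Definition tens2_val T p (t : tens2 E' T p) : N T p :=
  ksign k (t2degx t * t2degy t) *: ocomp (t2elem t) (t2deg t) (gmap (t2y t)) (gmap (t2x t)).

Lemma free_ext_realize T p (u : seq (tens2 E' T p)) :
  f T p (realize u) = \sum_(t <- u) tens2_val t.
Proof.
elim: u => [|t u IH]; first by rewrite realize_nil big_nil (lin0 (omap_lin f (p := p))).
by rewrite realize_cons big_cons (omap_lin f) IH omap_comp !free_ext_gen.
Qed.

Lemma tens2_val0 T p (t : tens2 E' T p) :
  [|| t2degx t != 1, t2degy t != 1, card (t2fib t) != 2%N | card (t2tgt t) != 2%N] ->
  tens2_val t = 0.
Proof.
move=> h; rewrite /tens2_val.
have [hx|hx] := boolP ((t2degx t != 1) || (card (t2fib t) != 2%N)).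
  by rewrite {2}/gmap (dcoef0 _ hx) scale0r (lin0 (ocomp_linr _ _ _)) scaler0.
rewrite {1}/gmap dcoef0 ?scale0r ?(lin0 (ocomp_linl _ _ _)) ?scaler0 //.
by move: h hx; do 4!case: (_ == _).
Qed.

Section ThreeLettersValue.
Variables (F G T S Q : per) (eF : elem F T S 0) (eG : elem G T Q 1).
Hypotheses (T3 : card T = 3%N) (F2 : card F = 2%N) (G2 : card G = 2%N).
Hypotheses (S0 : (0 < grade S)%N) (Q0 : (0 < grade Q)%N).

Let h0 : 0 + 0 == 0 :> int. Proof. by []. Qed.
(* [t0; t1] represents a relation of the terminal operad; it tests annihilators. *)
Let t0 := elem_tens2 (E0 := E) eF S0 h0 (1 *: tgen1 k F) (1 *: tgen1 k S).
Let t1 := elem_tens2 (E0 := E) eG Q0 h0 (-1 *: tgen1 k G) (1 *: tgen1 k Q).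

Lemma test_rel : trel (realize [:: t0; t1]).
Proof.
split; first exact: realize_weight.
rewrite -[LHS]coefK coef_tproj_realize !big_cons big_nil addr0 /=.
have cS := elem_card eF; have cQ := elem_card eG.
rewrite !(lin_scale (@coef_lin k _)) !coef_tgen1 //; try lia.
rewrite [_ *: _]mulr1 [-1 *: _]mulr1 mulr1 mulr1 subrr.
by apply/rowP => j; rewrite !mxE.
Qed.

(** By [g_rel] the summands over both quotients are multiples of the single element o_1 (g, g), and
    the multiple is exactly the pairing of t with the test relation. *)
Lemma tens2_valE (h : 1 + 1 == 1 + 1 :> int) (t : tens2 E' T (1 + 1)) :
  tens2_val t = (pair1 t t0 + pair1 t t1) *: oc eG h (g Q) (g G).
Proof.
have SQ := quotients_neq eF eG.
rewrite /pair1 !seval_tgen1_eq /= !mulr0 !mul1r.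
case: t => F' S' m i e gS dx dy dd x y /=.
rewrite /tens2_val /=.
have [hx|] := boolP ((dx != 1) || (card F' != 2%N)).
  rewrite {2}/gmap !(dcoef0 _ hx) scale0r (lin0 (ocomp_linr _ _ _)) scaler0 mulr0 !if_same.
  by rewrite !mul0r addr0 scale0r.
rewrite negb_or !negbK => /andP [/eqP dx1 /eqP x2].
have [hy|] := boolP ((dy != 1) || (card S' != 2%N)).
  rewrite {1}/gmap !(dcoef0 _ hy) scale0r (lin0 (ocomp_linl _ _ _)) scaler0 !if_same.
  by rewrite !mulr0 addr0 scale0r.
rewrite negb_or !negbK => /andP [/eqP dy1 _]; subst dx dy.
rewrite (bool_irrelevance dd h) /gmap !gdeg1.
rewrite (lin_scale (ocomp_linl _ _ _)) (lin_scale (ocomp_linr _ _ _)) !scalerA.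
have k1 : ksign k 1 = -1 by rewrite /ksign expr1.
case: (tens2_cases eF eG T3 F2 G2 (t := Tens2 e gS h x y) x2) => /= -[? [? i01]].
  subst F' S'; rewrite (ocE e eF) // (g_rel eF eG h) // k1 scalerA.
  rewrite (asboolT (erefl F)) (asboolT (erefl S)) (asboolF (nesym SQ)) mulr0 addr0.
  by rewrite mulrN1 mulN1r opprK mulrC.
subst F' S'; rewrite (ocE e eG) //.
rewrite (asboolT (erefl G)) (asboolT (erefl Q)) (asboolF SQ) mulr0 add0r k1.
by rewrite !mulN1r mulNr mulrC.
Qed.

End ThreeLettersValue.

(** Outside degree 2 and three letters all summands vanish. Otherwise the value is the pairing of u
    with the test relation times a fixed element, and that pairing is zero. *)
Lemma free_ext_annihilator T p w : @annihilator k (terminal_data k) T p w -> f T p w = 0.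
Proof.
case=> u -> hu; rewrite free_ext_realize.
have [p2|p2] := pselect (p = 1 + 1); last first.
  apply: big1 => t _; apply: tens2_val0; apply/negPn/negP.
  rewrite !negb_or !negbK => /and4P [/eqP x1 /eqP y1 _ _]; apply: p2.
  by have := t2deg t; rewrite x1 y1 => /eqP.
have [T3|T3] := pselect (card T = 3%N); last first.
  apply: big1 => t _; apply: tens2_val0; apply/negPn/negP.
  rewrite !negb_or !negbK => /and4P [_ _ /eqP c1 /eqP c2]; apply: T3.
  by have := elem_card (elem_of (t2elem t)); lia.
subst p; have [||F [S [eF F2]]] := @ex_elem T 0 2; try lia.
have [||G [Q [eG G2]]] := @ex_elem T 1 2; try lia.
have cS := elem_card eF; have cQ := elem_card eG.
have S0 : (0 < grade S)%N by rewrite /grade; lia.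
have Q0 : (0 < grade Q)%N by rewrite /grade; lia.
have h : 1 + 1 == 1 + 1 :> int by [].
under eq_bigr do rewrite (tens2_valE eF eG T3 F2 G2 S0 Q0 h).
rewrite -scaler_suml; have := hu 0 _ (test_rel eF eG T3 F2 G2 S0 Q0).
rewrite /pairing; under eq_bigr do rewrite !big_cons big_nil addr0.
by move=> ->; rewrite scale0r.
Qed.

Lemma koszul_dual_ext : exists f : operad_mor KD N,
  forall r, card r = 2%N -> f r 1 (dual_gen k r) = g r.
Proof.
exists (presented_ext (D := dual_data (terminal_data k)) free_ext_annihilator).
move=> r r2; rewrite presented_extE free_ext_gen /gmap gdeg1 /dcoef /=.
by rewrite (coef_tgen1 k r2) scale1r.
Qed.

End Universal.

Lemma koszul_dual_free_on_binary : free_on_binary (dual_gen k).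
Proof. by move=> N g /koszul_dual_ext. Qed.

End KoszulDual.

(** * Algebras and permutads *)

Section Categories.

Lemma inj_surj_bij (A B : Type) (f : A -> B) :
  injective f -> (forall y, exists x, f x = y) -> bijective f.
Proof.
move=> fi fs; exists (fun y => sval (cid (fs y))) => x; last by case: cid.
by apply: fi; case: cid.
Qed.

Variables (k : fieldType) (K : functor (coll_cat k) (coll_cat k)).
Variables (C D : structure k) (phi : forall P, str C P -> str D (K P)).
Hypothesis phiP : forall P Q (s : str C P) (t : str C Q) (f : cmap P Q),
  smor s t f -> smor (phi s) (phi t) (@fmap _ _ K P Q f).
Hypotheses (K_bij : bijective K) (K_full : forall P Q, bijective (@fmap _ _ K P Q)).
Hypothesis phi_refl : forall P Q (s : str C P) (t : str C Q) (f : cmap P Q),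
  smor (phi s) (phi t) (@fmap _ _ K P Q f) -> smor s t f.
Hypothesis str_eq : forall P (s t : str C P), smor s t (cmap_id P) -> s = t.
Hypothesis phi_surj : forall P (t : str D (K P)), exists s, phi s = t.

(** If s and t have the same image, the identity is a morphism between the images; it is reflected
    to a morphism from s to t, which forces equality. *)
Lemma phi_inj P : injective (@phi P).
Proof.
move=> s t st; apply: str_eq; apply: phi_refl; rewrite st.
by have := fmap_id K P => /= ->; apply: smor_id.
Qed.

Lemma struct_cat_iso : cat_iso (struct_functor phiP).
Proof.
split=> [|A B].
  apply: inj_surj_bij.
  - move=> [P s] [Q t] /= E.
    have EP : P = Q by apply: (bij_inj K_bij); exact: (congr1 (@scoll _ _) E).
    subst Q; congr Sobj; apply: phi_inj.
    (* An equality of objects yields one of structures up to transport. Since any proof e is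
       allowed, [erefl] can be taken and the transport disappears. *)
    have h (A B : sobj D) (AB : A = B) (e : scoll A = scoll B) :
        ecast X (str D X) e (sstr A) = sstr B.
      by subst B; rewrite (Prop_irrelevance e erefl).
    exact: (h _ _ E erefl).
  - move=> [Q t]; have [K' KK' K'K] := K_bij.
    have [P PQ] : exists P, K P = Q by exists (K' Q).
    subst Q; have [s st] := phi_surj t; exists (Sobj s).
    by rewrite -st.
apply: inj_surj_bij.
- move=> f g E; apply: shom_eq; apply: (bij_inj (K_full _ _)).
  exact: (congr1 (@shom_map _ _ _ _) E).
- move=> g; have [f fg] : exists f, @fmap _ _ K _ _ f = shom_map g.
    by have [h hK Kh] := K_full (scoll A) (scoll B); exists (h (shom_map g)).
  have sf : smor (sstr A) (sstr B) f.
    apply: phi_refl; rewrite fg.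
    exact: (shomP (g : shom (Sobj (phi (sstr A))) (Sobj (phi (sstr B))))).
  by exists (Shom sf); apply: shom_eq.
Qed.

End Categories.

(** * Morphisms of algebras, tested on generators *)

Section Intertwining.
Variables (k : fieldType) (P Q : coll k) (f : cmap P Q).

Definition intertwines T p (x : endo P T p) (y : endo Q T p) : Prop :=
  forall a n (ha : fits T a n) (hfa : fits T (map (emap f) a) n) d
    (hd : p + tdeg a == d) (hfd : p + tdeg (map (emap f) a) == d),
  f n d (x a n ha d hd) = y _ n hfa d hfd.

Lemma emap_eproj n d z : f n d (eproj n d z) = eproj n d (emap f z).
Proof.
case: z => m j x; rewrite /eproj /=; case: eqP => [e|_]; last
  exact: lin0 (cfun_lin f (n := n) (d := d)).
case: eqP => [e'|_]; last exact: lin0 (cfun_lin f (n := n) (d := d)).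
by subst m j.
Qed.

Lemma intertwines_lin T p c (x x' : endo P T p) y y' :
  intertwines x y -> intertwines x' y' -> intertwines (c *: x + x') (c *: y + y').
Proof.
move=> h h' a n ha hfa d hd hfd.
by rewrite !evL (cfun_lin f) (h _ _ _ hfa _ _ hfd) (h' _ _ _ hfa _ _ hfd).
Qed.

Lemma intertwines0 T p : intertwines (0 : endo P T p) 0.
Proof. by move=> a n ha hfa d hd hfd; apply: lin0 (cfun_lin f (n := n) (d := d)). Qed.

Lemma intertwines_unit U (hU : trivial U) :
  intertwines (endo_unit P hU) (endo_unit Q hU).
Proof.
move=> a n ha hfa d hd hfd; rewrite /= /unit_fun.
case: a {ha hfa hd hfd} => [|z [|z' a]] /=; last exact: lin0 (cfun_lin f (n := n) (d := d)).
  exact: lin0 (cfun_lin f (n := n) (d := d)).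
exact: emap_eproj.
Qed.

Lemma intertwines_comp F T S i (e : elem F T S i) p q r (h : p + q == r) x y x' y' :
  intertwines x x' -> intertwines y y' ->
  intertwines (endo_comp e h x y : endo P T r) (endo_comp e h x' y').
Proof.
move=> hx hy a n ha hfa d hd hfd.
have [a1 [b [a2 [aE sa hF]]]] := ex_split e ha hd; subst a.
have hb : q + tdeg b == q + tdeg b by [].
have hfF : fits F (map (emap f) b) (arp F) by rewrite emap_fits.
have hfb : q + tdeg (map (emap f) b) == q + tdeg b by rewrite emap_tdeg.
pose v := Elt (y b _ hF _ hb); pose v' := Elt (y' _ _ hfF _ hfb).
have vv' : emap f v = v' by rewrite /emap /= (hy _ _ _ hfF _ _ hfb).
have E : map (emap f) (a1 ++ b ++ a2) = map (emap f) a1 ++ map (emap f) b ++ map (emap f) a2.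
  by rewrite !map_cat.
have E' : map (emap f) (a1 ++ v :: a2) = map (emap f) a1 ++ v' :: map (emap f) a2.
  by rewrite map_cat /= vv'.
have hS : fits S (a1 ++ v :: a2) n by apply: (fits_collapse e ha).
have dS : p + tdeg (a1 ++ v :: a2) == d by apply: (tdeg_collapse h hd).
have hfS' : fits S (map (emap f) (a1 ++ v :: a2)) n by rewrite emap_fits.
have dfS' : p + tdeg (map (emap f) (a1 ++ v :: a2)) == d by rewrite emap_tdeg.
have hfS := hfS'; have dfS := dfS'; rewrite E' in hfS dfS.
rewrite (endo_compE e h _ ha hd hS dS erefl sa).
rewrite (endo_compE e h _ hfa hfd hfS dfS E); last by rewrite size_map.
rewrite (lin_scale (cfun_lin f (n := n) (d := d))) emap_tdeg; congr (_ *: _).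
by rewrite (hx _ _ _ hfS' _ _ dfS'); apply: ev_congr.
Qed.

End Intertwining.

Section AlgMor.
Variables (k : fieldType) (e : int) (M : operad k) (g : forall r, M r e).

Lemma alg_eq (P : coll k) (s t : alg_str M P) :
  (forall T a n (ha : fits T a n) p d (hd : p + tdeg a == d) m,
    act s ha hd m = act t ha hd m) -> s = t.
Proof.
move=> st; have E : act s = act t.
  apply: functional_extensionality_dep => T; apply: functional_extensionality_dep => a.
  apply: functional_extensionality_dep => n; apply: functional_extensionality_dep => ha.
  apply: functional_extensionality_dep => p; apply: functional_extensionality_dep => d.
  by apply: functional_extensionality_dep => hd; apply/funext => m; apply: st.
case: s t E {st} => [s s1 s2 s3 s4] [t t1 t2 t3 t4] /= E; subst t.
by congr AlgStr; apply: Prop_irrelevance.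
Qed.

Lemma alg_mor_id_eq (P : coll k) (s t : alg_str M P) : alg_mor s t (cmap_id P) -> s = t.
Proof.
move=> st; apply: alg_eq => T a n ha p d hd m.
have hfa : fits T (map (emap (cmap_id P)) a) n by rewrite emap_fits.
have hfd : p + tdeg (map (emap (cmap_id P)) a) == d by rewrite emap_tdeg.
rewrite [LHS](st _ _ _ ha hfa _ _ hd hfd); apply: act_eq.
by rewrite -[RHS]map_id; apply: eq_map => -[].
Qed.

(** The elements of M whose actions on P and Q are intertwined by f form a suboperad. *)
Lemma alg_mor_generators (P Q : coll k) (s : alg_str M P) (t : alg_str M Q) f :
  generates g ->
  (forall r, card r = 2%N ->
    intertwines f (mor_of_alg s r e (g r)) (mor_of_alg t r e (g r))) ->
  alg_mor s t f.
Proof.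
move=> gen fg T a n ha hfa p d hd hfd m.
suff : intertwines f (mor_of_alg s T p m) (mor_of_alg t T p m) by apply.
move: T p m {a n ha hfa d hd hfd}; apply: gen => //.
- move=> T p; split=> [|c x y hx hy].
    rewrite (lin0 (omap_lin (mor_of_alg s) (p := p))).
    rewrite (lin0 (omap_lin (mor_of_alg t) (p := p))).
    exact: intertwines0.
  rewrite (omap_lin (mor_of_alg s)) (omap_lin (mor_of_alg t)).
  exact: intertwines_lin.
- move=> U hU; rewrite (omap_unit (mor_of_alg s)) (omap_unit (mor_of_alg t)).
  exact: intertwines_unit.
- move=> F T S h i ef p q r hr x y hx hy.
  rewrite (omap_comp (mor_of_alg s)) (omap_comp (mor_of_alg t)).
  exact: intertwines_comp.
Qed.

End AlgMor.

(** * The three-letter relation as associativity *)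

Section Associativity.
Variables (k : fieldType) (P : coll k) (e : int) (g : forall r, endo P r e).

(** Of the exponent e (1 + |x|), the summand e comes from [arity2_rel] and e |x| from moving the
    inner operation on y, z past x. *)
Definition binary_assoc : Prop :=
  forall a s t u v, elem s a t 0 -> elem v a u 1 -> card a = 3%N ->
  card s = 2%N -> card v = 2%N ->
  forall (x y z : elt P) n12 n23 n (d12 d23 d : int)
    (hs : fits s [:: x; y] n12) (ds : e + tdeg [:: x; y] == d12)
    (hv : fits v [:: y; z] n23) (dv : e + tdeg [:: y; z] == d23),
    let xy := Elt (g s _ _ hs _ ds) in let yz := Elt (g v _ _ hv _ dv) in
  forall (ht : fits t [:: xy; z] n) (dt : e + tdeg [:: xy; z] == d)
    (hu : fits u [:: x; yz] n) (du : e + tdeg [:: x; yz] == d),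
  g t _ _ ht _ dt = ksign k (e * (1 + edeg x)) *: g u _ _ hu _ du.

Lemma oc_end F T S i (h : elem F T S i) p q r (hd : p + q == r)
    (x : endo P S p) (y : endo P F q) :
  oc (M := end_operad P) h hd x y = endo_comp h hd x y.
Proof.
have [f [j [ji ef]]] := elemP h; rewrite -(ocE ef h) //=; subst i.
by rewrite (Prop_irrelevance (elem_of ef) h).
Qed.

Lemma fits_comp F T S i (h : elem F T S i) (a1 b a2 : seq (elt P)) n z :
  size a1 = i -> fits F b (earity z) -> fits S (a1 ++ z :: a2) n ->
  fits T (a1 ++ b ++ a2) n.
Proof.
have [A [C [sA fT fS]]] := elem_fibs h.
have arS : ar S = ar T by case: h => wS _ _ _; rewrite -!size_word wS size_map.
move=> sa; rewrite !fitsE fT fS arS /arities !map_cat => /andP [/eqP -> _] /andP [h' ->].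
move: h'; rewrite eqseq_cat ?size_map ?sA //= => /andP [/eqP -> /eqP [_ ->]].
by rewrite eqxx.
Qed.

Lemma rel_binary_assoc : arity2_rel (M := end_operad P) g -> binary_assoc.
Proof.
move=> rel a s t u v es ev a3 s2 v2 x y z n12 n23 n d12 d23 d hs ds hv dv xy yz ht dt hu du.
have hee : e + e == e + e by [].
have ha : fits a [:: x; y; z] n.
  apply: (fits_comp es (a1 := [::]) (b := [:: x; y]) (z := xy)) => //.
have da : (e + e) + tdeg [:: x; y; z] == d.
  rewrite -(eqP dt) !tdeg_cons tdeg_nil /= -(eqP ds) !tdeg_cons tdeg_nil.
  by apply/eqP; lia.
have := rel _ _ _ _ _ es ev _ hee a3 s2 v2; rewrite !oc_end.
move/(congr1 (fun w : endo P a (e + e) => w _ _ ha _ da)); rewrite evZ.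
rewrite (endo_compE es hee _ ha da (a1 := [::]) (b := [:: x; y]) ht dt) //.
rewrite (endo_compE ev hee _ ha da (a1 := [:: x]) (b := [:: y; z]) hu du) //.
rewrite [X in ksign k (e * X) *: _ = _]tdeg_nil mulr0 scale1r => ->.
by rewrite scalerA; congr (_ *: _); rewrite -ksignD tdeg_cons tdeg_nil addr0 mulrDr mulr1.
Qed.

Lemma binary_assoc_rel : binary_assoc -> arity2_rel (M := end_operad P) g.
Proof.
move=> assoc F G T S Q eF eG d0 h T3 F2 G2; rewrite !oc_end.
apply: endo_eq => a n ha d da; rewrite evZ.
have := fits_size ha; rewrite T3; case: a ha da => [|x [|y [|z [|? ?]]]] // ha da _.
have hF : fits F [:: x; y] (arp F).
  by apply: (fits_fiber eF (a1 := [::]) (b := [:: x; y]) ha).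
have hG : fits G [:: y; z] (arp G).
  by apply: (fits_fiber eG (a1 := [:: x]) (b := [:: y; z]) (a2 := [::]) ha).
pose xy := Elt (g F _ _ hF _ (eqxx (e + tdeg [:: x; y]))).
pose yz := Elt (g G _ _ hG _ (eqxx (e + tdeg [:: y; z]))).
have hS : fits S [:: xy; z] n.
  by apply: (fits_collapse eF (a1 := [::]) (b := [:: x; y]) ha).
have hQ : fits Q [:: x; yz] n.
  by apply: (fits_collapse eG (a1 := [:: x]) (b := [:: y; z]) (a2 := [::]) ha).
have dS : e + tdeg [:: xy; z] == d.
  by apply: (tdeg_collapse h (a1 := [::]) (b := [:: x; y]) da).
have dQ : e + tdeg [:: x; yz] == d.
  by apply: (tdeg_collapse h (a1 := [:: x]) (b := [:: y; z]) (a2 := [::]) da).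
rewrite (endo_compE eF h _ ha da (a1 := [::]) (b := [:: x; y]) hS dS) //.
rewrite (endo_compE eG h _ ha da (a1 := [:: x]) (b := [:: y; z]) hQ dQ) //.
rewrite (assoc _ _ _ _ _ eF eG T3 F2 G2 _ _ _ _ _ _ _ _ _ _ _ _ _ hS dS hQ dQ).
rewrite !scalerA; congr (_ *: _).
by rewrite tdeg_cons !tdeg_nil mulr0 mul1r -ksignD addr0 mulrDr mulr1.
Qed.

End Associativity.

Section Binary.
Variables (k : fieldType) (P : coll k).

Lemma fits_binary r (x y : elt P) n :
  fits r [:: x; y] n = binary_arity r (earity x) (earity y) n.
Proof.
rewrite /fits /binary_arity /=; case: (card r) => [|[|[|c]]] //=.
- by rewrite !eqseq_cons !andbF.
- by rewrite !eqseq_cons eqxx andbT -!andbA !(eq_sym (fib r _)).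
- by rewrite !eqseq_cons !andbF.
Qed.

Lemma tdeg2 (x y : elt P) : tdeg [:: x; y] = edeg x + edeg y.
Proof. by rewrite !tdeg_cons tdeg_nil addr0. Qed.

Lemma tev0 T p (f : endo P T p) a n d : ~ (fits T a n /\ p + tdeg a == d) -> tev f a n d = 0.
Proof. by rewrite /tev; case: pselect => // ?; case: pselect => // ? []. Qed.

Lemma tev_lin T p (f : endo P T p) a1 a2 n' d' c (x y : P n' d') n d :
  tev f (a1 ++ Elt (c *: x + y) :: a2) n d =
  c *: tev f (a1 ++ Elt x :: a2) n d + tev f (a1 ++ Elt y :: a2) n d.
Proof.
set w := c *: x + y.
have fe (z : P n' d') : fits T (a1 ++ Elt z :: a2) n =
    fits T (a1 ++ Elt w :: a2) n by exact: fits_same_arity.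
have de (z : P n' d') : tdeg (a1 ++ Elt z :: a2) =
    tdeg (a1 ++ Elt w :: a2) by exact: tdeg_same.
have [[h hd]|h] := pselect (fits T (a1 ++ Elt w :: a2) n /\ p + tdeg (a1 ++ Elt w :: a2) == d).
  have hx : fits T (a1 ++ Elt x :: a2) n by rewrite fe.
  have hy : fits T (a1 ++ Elt y :: a2) n by rewrite fe.
  have dx : p + tdeg (a1 ++ Elt x :: a2) == d by rewrite de.
  have dy : p + tdeg (a1 ++ Elt y :: a2) == d by rewrite de.
  by rewrite (tevE f h hd) (tevE f hx dx) (tevE f hy dy) (ev_lin f h hx hy hd dx dy).
by rewrite !tev0 ?fe ?de // scaler0 addr0.
Qed.

Lemma perm_str_eq (s t : perm_str P) :
  (forall r n1 n2 n (hr : binary_arity r n1 n2 n) p q d (hd : p + q == d) x y,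
    pcirc s hr hd x y = pcirc t hr hd x y) -> s = t.
Proof.
move=> st; have E : pcirc s = pcirc t.
  do 4!(apply: functional_extensionality_dep => ?).
  apply: functional_extensionality_dep => hr.
  do 3!(apply: functional_extensionality_dep => ?).
  apply: functional_extensionality_dep => hd.
  by apply/funext => x; apply/funext => y; apply: st.
case: s t E {st} => [s s1 s2 s3] [t t1 t2 t3] /= E; subst t.
by congr PermStr; apply: Prop_irrelevance.
Qed.

Lemma card_interval n (a : pred nat) :
  #|[set i : 'I_n | a i]| = count a (iota 0 n).
Proof. by rewrite card_count -val_enum_ord count_map. Qed.

(** On the letters 0, 1, 2 the map [predn] is [squash 0 2], so the left bracketing of a permutad is
    an elementary collapse. *)
Lemma elem_of_left a s t (a12 : [set i : 'I_(card a) | (i < 2)%N] != set0) :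
  card a = 3%N -> s = restr a12 -> is_composite predn a t -> elem s a t 0 /\ card s = 2%N.
Proof.
move=> a3 sE [art ht].
have s2 : card s = 2%N by rewrite sE /= (card_interval _ (fun i => i < 2)%N) a3.
split=> //; split; rewrite ?s2 //; last by rewrite a3.
  apply: (@eq_from_nth _ 0%N); first by rewrite size_map !size_word art.
  move=> l; rewrite size_word => lt; have la : (l < ar a)%N by rewrite -art.
  rewrite (nth_map 0%N) ?size_word // (@nth_word t (Ordinal lt)) (@nth_word a (Ordinal la)).
  rewrite (ht (Ordinal la)) //; have := ltn_ord (sur a (Ordinal la)).
  by rewrite [X in (_ < X)%N]a3; squash_lia.
by rewrite sE; apply: word_restr => [i|]; rewrite ?inE ?a3.
Qed.

(** Likewise [minn 1] is [squash 1 2] on the letters 0, 1, 2. *)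
Lemma elem_of_right a v u (a23 : [set i : 'I_(card a) | (0 < i)%N] != set0) :
  card a = 3%N -> v = restr a23 -> is_composite (minn 1) a u ->
  elem v a u 1 /\ card v = 2%N.
Proof.
move=> a3 sE [art ht].
have s2 : card v = 2%N by rewrite sE /= (card_interval _ (fun i => 0 < i)%N) a3.
split=> //; split; rewrite ?s2 //; last by rewrite a3.
  apply: (@eq_from_nth _ 0%N); first by rewrite size_map !size_word art.
  move=> l; rewrite size_word => lt; have la : (l < ar a)%N by rewrite -art.
  rewrite (nth_map 0%N) ?size_word // (@nth_word u (Ordinal lt)) (@nth_word a (Ordinal la)).
  rewrite (ht (Ordinal la)) //; have := ltn_ord (sur a (Ordinal la)).
  by rewrite [X in (_ < X)%N]a3; squash_lia.
rewrite sE; apply: word_restr => [i|]; last by rewrite a3.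
by rewrite inE; have := ltn_ord i; rewrite [X in (_ < X)%N]a3; lia.
Qed.

Lemma left_of_elem a s t : card a = 3%N -> card s = 2%N -> elem s a t 0 ->
  is_composite predn a t /\
  exists a12 : [set i : 'I_(card a) | (i < 2)%N] != set0, s = restr a12.
Proof.
move=> a3 s2 [wt ws _ _]; rewrite s2 in wt ws.
have art : ar t = ar a by rewrite -!size_word wt size_map.
split.
  split=> // x y xy; rewrite -(nth_word y) wt -xy (nth_map 0%N) ?size_word // nth_word.
  by have := ltn_ord (sur a x); rewrite [X in (_ < X)%N]a3; squash_lia.
have h0 : (0 < card a)%N by rewrite a3.
have a12 : [set i : 'I_(card a) | (i < 2)%N] != set0.
  by apply/set0Pn; exists (Ordinal h0); rewrite inE.
exists a12; apply: word_inj; rewrite ws; symmetry; apply: word_restr; last by rewrite a3.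
by move=> i; rewrite inE.
Qed.

Lemma right_of_elem a v u : card a = 3%N -> card v = 2%N -> elem v a u 1 ->
  is_composite (minn 1) a u /\
  exists a23 : [set i : 'I_(card a) | (0 < i)%N] != set0, v = restr a23.
Proof.
move=> a3 s2 [wt ws _ _]; rewrite s2 in wt ws.
have art : ar u = ar a by rewrite -!size_word wt size_map.
split.
  split=> // x y xy; rewrite -(nth_word y) wt -xy (nth_map 0%N) ?size_word // nth_word.
  by have := ltn_ord (sur a x); rewrite [X in (_ < X)%N]a3; squash_lia.
have h0 : (1 < card a)%N by rewrite a3.
have a23 : [set i : 'I_(card a) | (0 < i)%N] != set0.
  by apply/set0Pn; exists (Ordinal h0); rewrite inE.
exists a23; apply: word_inj; rewrite ws; symmetry; apply: word_restr; last by rewrite a3.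
by move=> i; rewrite inE; have := ltn_ord i; rewrite [X in (_ < X)%N]a3; lia.
Qed.

End Binary.

Section BinaryEndo.
Variables (k : fieldType) (P : coll k) (e : int).
Variable B : forall (r : per) (x y : elt P) (n : posn) (d : int), P n d.
Hypothesis B_linl : forall r n1 p c (x x' : P n1 p) y n d,
  B r (Elt (c *: x + x')) y n d = c *: B r (Elt x) y n d + B r (Elt x') y n d.
Hypothesis B_linr : forall r x n2 q c (y y' : P n2 q) n d,
  B r x (Elt (c *: y + y')) n d = c *: B r x (Elt y) n d + B r x (Elt y') n d.

Definition binary_fun r a n (_ : fits r a n) d (_ : e + tdeg a == d) : P n d :=
  if a is [:: x; y] then B r x y n d else 0.

Lemma binary_fun_multilinear r : multilinear (@binary_fun r).
Proof.
move=> a1 a2 n n' d' c x y hxy hx hy d dxy dx dy; rewrite /binary_fun.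
case: a1 {hxy hx hy dxy dx dy} => [|x1 [|x2 [|x3 a1]]] /=.
- by case: a2 => [|y1 [|y2 a2]]; rewrite ?B_linl ?scaler0 ?addr0.
- by case: a2 => [|y1 a2]; rewrite ?B_linr ?scaler0 ?addr0.
- by rewrite scaler0 addr0.
- by rewrite scaler0 addr0.
Qed.

Definition binary_endo r : endo P r e := Endo (@binary_fun_multilinear r).

End BinaryEndo.

Section PermTotal.
Variables (k : fieldType) (P : coll k) (t : perm_str P).

(* Junk value: zero if the arities or the degrees do not match. *)
Definition tpc r (x y : elt P) n d : P n d :=
  match pselect (binary_arity r (earity x) (earity y) n),
        pselect (edeg x + edeg y == d) with
  | left hr, left hd => pcirc t hr hd (evec x) (evec y)
  | _, _ => 0
  end.

Lemma tpcE r n1 n2 n (hr : binary_arity r n1 n2 n) p q d (hd : p + q == d) x y :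
  tpc r (Elt x) (Elt y) n d = pcirc t hr hd x y.
Proof.
rewrite /tpc /=; case: pselect => // hr'; case: pselect => // hd'.
by rewrite (bool_irrelevance hr hr') (bool_irrelevance hd hd').
Qed.

Lemma tpc_linl r n1 p c (x x' : P n1 p) y n d :
  tpc r (Elt (c *: x + x')) y n d = c *: tpc r (Elt x) y n d + tpc r (Elt x') y n d.
Proof.
rewrite /tpc /=; case: pselect => [hr|_]; last by rewrite scaler0 addr0.
case: pselect => [hd|_]; last by rewrite scaler0 addr0.
exact: pcirc_linl.
Qed.

Lemma tpc_linr r x n2 q c (y y' : P n2 q) n d :
  tpc r x (Elt (c *: y + y')) n d = c *: tpc r x (Elt y) n d + tpc r x (Elt y') n d.
Proof.
rewrite /tpc /=; case: pselect => [hr|_]; last by rewrite scaler0 addr0.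
case: pselect => [hd|_]; last by rewrite scaler0 addr0.
exact: pcirc_linr.
Qed.

Lemma tpcA a s t' u v : elem s a t' 0 -> elem v a u 1 -> card a = 3%N ->
  card s = 2%N -> card v = 2%N ->
  forall n1 n2 n3 n12 n23 n (hs : binary_arity s n1 n2 n12)
    (ht : binary_arity t' n12 n3 n) (hu : binary_arity u n1 n23 n)
    (hv : binary_arity v n2 n3 n23) p q r pq qr d (hpq : p + q == pq)
    (hqr : q + r == qr) (hl : pq + r == d) (hr : p + qr == d)
    (x : P n1 p) (y : P n2 q) (z : P n3 r),
  tpc t' (Elt (tpc s (Elt x) (Elt y) n12 pq)) (Elt z) n d =
  tpc u (Elt x) (Elt (tpc v (Elt y) (Elt z) n23 qr)) n d.
Proof.
move=> es ev a3 s2 v2 n1 n2 n3 n12 n23 n hs ht hu hv p q r pq qr d hpq hqr hl hr x y z.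
rewrite (tpcE hs hpq) (tpcE hv hqr) (tpcE ht hl) (tpcE hu hr).
have [ct [a12 sE]] := left_of_elem a3 s2 es.
have [cu [a23 vE]] := right_of_elem a3 v2 ev.
exact: (pcircA t hs ht hu hv hpq hqr hl hr x y z a3 sE ct cu vE).
Qed.

End PermTotal.

Lemma arity2_rel_mor (k : fieldType) e (M N : operad k) (f : operad_mor M N)
    (g : forall r, M r e) :
  arity2_rel g -> arity2_rel (fun r => f r e (g r)).
Proof.
move=> rel F G T S Q eF eG d h T3 F2 G2.
by rewrite -!omap_oc (rel _ _ _ _ _ eF eG d h) // (lin_scale (omap_lin f (T := T) (p := d))).
Qed.

(** * Algebras over the terminal operad *)

Section Unsuspended.
Variables (k : fieldType) (P : coll k).

Section FromAlg.
Variable s : alg_str (terminal k) P.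

Let g r : endo P r 0 := mor_of_alg s r 0 (tone k r).

Let g_assoc : binary_assoc g.
Proof. exact/rel_binary_assoc/(arity2_rel_mor (mor_of_alg s))/terminal_arity2_rel. Qed.

Definition perm_of_alg : perm_str P.
Proof.
apply: (@PermStr k P (fun r n1 n2 n _ p q d _ x y => tev (g r) [:: Elt x; Elt y] n d)).
- by move=> r n1 n2 n hr p q d hd y c x x'; apply: (tev_lin (g r) [::]).
- by move=> r n1 n2 n hr p q d hd x c y y'; apply: (tev_lin (g r) [:: Elt x]).
move=> a b t u v a12 a23 n1 n2 n3 n12 n23 n hs ht hu hv p q r pq qr d.
move=> hpq hqr hl hr x y z a3 bE ct cu vE.
have [es s2] := elem_of_left a3 bE ct; have [ev v2] := elem_of_right a3 vE cu.
have fs : fits b [:: Elt x; Elt y] n12 by rewrite fits_binary.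
have fv : fits v [:: Elt y; Elt z] n23 by rewrite fits_binary.
have ds : 0 + tdeg [:: Elt x; Elt y] == pq by rewrite tdeg2 add0r.
have dv : 0 + tdeg [:: Elt y; Elt z] == qr by rewrite tdeg2 add0r.
rewrite (tevE (g b) fs ds) (tevE (g v) fv dv).
have ft : fits t [:: Elt (g b _ _ fs _ ds); Elt z] n by rewrite fits_binary.
have fu : fits u [:: Elt x; Elt (g v _ _ fv _ dv)] n by rewrite fits_binary.
have dt : 0 + tdeg [:: Elt (g b _ _ fs _ ds); Elt z] == d by rewrite tdeg2 add0r.
have du : 0 + tdeg [:: Elt x; Elt (g v _ _ fv _ dv)] == d by rewrite tdeg2 add0r.
rewrite (tevE (g t) ft dt) (tevE (g u) fu du).
by rewrite (g_assoc es ev a3 s2 v2 ft dt fu du) mul0r scale1r.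
Defined.

Lemma perm_of_algE r n1 n2 n (hr : binary_arity r n1 n2 n) p q d (hd : p + q == d)
    (x : P n1 p) (y : P n2 q) (hf : fits r [:: Elt x; Elt y] n)
    (hd' : 0 + tdeg [:: Elt x; Elt y] == d) :
  pcirc perm_of_alg hr hd x y = act s hf hd' (tone k r).
Proof. exact: tevE. Qed.

End FromAlg.

(** The operations of t form a family in the endomorphism operad. The permutad axiom is its relation
    with e = 0, so freeness of the terminal operad extends it. *)
Lemma perm_of_alg_surj (t : perm_str P) : exists s, perm_of_alg s = t.
Proof.
pose g := binary_endo 0 (tpc_linl t) (tpc_linr t).
have [|f fg] := @terminal_free_on_binary k (end_operad P) g.
  apply: binary_assoc_rel => a s t' u v es ev a3 s2 v2.
  move=> [n1 p x] [n2 q y] [n3 r z] n12 n23 n d12 d23 d.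
  move=> hs ds hv dv xy yz ht dt hu du; rewrite mul0r scale1r.
  have hs' := hs; have hv' := hv; have ht' := ht; have hu' := hu.
  rewrite fits_binary in hs'; rewrite fits_binary in hv'.
  rewrite fits_binary in ht'; rewrite fits_binary in hu'.
  have ds' := ds; have dv' := dv; have dt' := dt; have du' := du.
  rewrite tdeg2 add0r in ds'; rewrite tdeg2 add0r in dv'.
  rewrite tdeg2 add0r in dt'; rewrite tdeg2 add0r in du'.
  exact: (tpcA t es ev a3 s2 v2 hs' ht' hu' hv' ds' dv' dt' du').
exists (alg_of_mor f); apply: perm_str_eq => r n1 n2 n hr p q d hd x y.
have hf : fits r [:: Elt x; Elt y] n by rewrite fits_binary.
have hd' : 0 + tdeg [:: Elt x; Elt y] == d by rewrite tdeg2 add0r.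
rewrite (perm_of_algE _ hr hd hf hd') /= fg; last by case/and4P: hr => /eqP.
exact: tpcE.
Qed.

End Unsuspended.

(** * Algebras over the Koszul dual *)

Section Suspended.
Variables (k : fieldType) (P : coll k).

(** An operation of degree 1 on P has degree 0 on the suspension of P. *)
Lemma susp_deg (p q d : int) : p + q = d -> 1 + ((p - 1) + (q - 1)) = d - 1.
Proof. by move=> <-; lia. Qed.

Lemma tev_scale T p (f : endo P T p) a1 a2 n' d' c (x : P n' d') n d :
  tev f (a1 ++ Elt (c *: x) :: a2) n d = c *: tev f (a1 ++ Elt x :: a2) n d.
Proof.
have z : tev f (a1 ++ Elt (0 : P n' d') :: a2) n d = 0.
  have := tev_lin f a1 a2 (-1) (0 : P n' d') 0 n d.
  by rewrite scaler0 addr0 scaleN1r addNr.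
by rewrite -[c *: x]addr0 tev_lin z addr0.
Qed.

Section FromAlg.
Variable s : alg_str (koszul_dual (terminal_data k)) P.

Let g r : endo P r 1 := mor_of_alg s r 1 (dual_gen k r).

Let g_assoc : binary_assoc g.
Proof. exact/rel_binary_assoc/(arity2_rel_mor (mor_of_alg s))/dual_gen_rel. Qed.

Definition susp_perm_of_alg : perm_str (susp P).
Proof.
apply: (@PermStr k (susp P) (fun r n1 n2 n _ p q d _ (x : P n1 (p - 1)) (y : P n2 (q - 1)) =>
  ksign k (p - 1) *: tev (g r) [:: Elt x; Elt y] n (d - 1))).
- move=> r n1 n2 n hr p q d hd y c x x'.
  rewrite (tev_lin (g r) [::] [:: @Elt k P n2 (q - 1) y] c (x : P n1 (p - 1)) x').
  by rewrite scalerDr !scalerA mulrC.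
- move=> r n1 n2 n hr p q d hd x c y y'.
  rewrite (tev_lin (g r) [:: @Elt k P n1 (p - 1) x] [::] c (y : P n2 (q - 1)) y').
  by rewrite scalerDr !scalerA mulrC.
move=> a b t u v a12 a23 n1 n2 n3 n12 n23 n hs ht hu hv p q r pq qr d.
move=> hpq hqr hl hr x y z a3 bE ct cu vE.
have [es s2] := elem_of_left a3 bE ct; have [ev v2] := elem_of_right a3 vE cu.
pose X := @Elt k P n1 (p - 1) x; pose Y := @Elt k P n2 (q - 1) y.
pose Z := @Elt k P n3 (r - 1) z.
rewrite (tev_scale (g t) [::] [:: Z]) (tev_scale (g u) [:: X] [::]).
have fs : fits b [:: X; Y] n12 by rewrite fits_binary.
have fv : fits v [:: Y; Z] n23 by rewrite fits_binary.
have ds : 1 + tdeg [:: X; Y] == pq - 1 by rewrite tdeg2 (susp_deg (eqP hpq)).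
have dv : 1 + tdeg [:: Y; Z] == qr - 1 by rewrite tdeg2 (susp_deg (eqP hqr)).
rewrite -/X -/Y -/Z (tevE (g b) fs ds) (tevE (g v) fv dv).
have ft : fits t [:: Elt (g b _ _ fs _ ds); Z] n by rewrite fits_binary.
have fu : fits u [:: X; Elt (g v _ _ fv _ dv)] n by rewrite fits_binary.
have dt : 1 + tdeg [:: Elt (g b _ _ fs _ ds); Z] == d - 1.
  by rewrite tdeg2 (susp_deg (eqP hl)).
have du : 1 + tdeg [:: X; Elt (g v _ _ fv _ dv)] == d - 1.
  by rewrite tdeg2 (susp_deg (eqP hr)).
rewrite (tevE (g t) ft dt) (tevE (g u) fu du) (g_assoc es ev a3 s2 v2 ft dt fu du).
(* The left side carries p + q - 1 and p - 1 from the two products and p from [g_assoc], the right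
   side p - 1 and q - 1; both sums have the parity of p + q. *)
rewrite !scalerA; congr (_ *: _); rewrite -(eqP hpq) /X /= mul1r.
by rewrite -!ksignD !ksignE; congr (_ ^+ (nat_of_bool _)); lia.
Defined.

Lemma susp_perm_of_algE r n1 n2 n (hr : binary_arity r n1 n2 n) p q d (hd : p + q == d)
    (x : P n1 (p - 1)) (y : P n2 (q - 1)) (hf : fits r [:: Elt x; Elt y] n)
    (hd' : 1 + tdeg [:: Elt x; Elt y] == d - 1) :
  pcirc susp_perm_of_alg hr hd x y = ksign k (p - 1) *: act s hf hd' (dual_gen k r).
Proof.
rewrite /=; congr (_ *: _).
exact: (tevE (mor_of_alg s r 1 (dual_gen k r)) hf hd').
Qed.

End FromAlg.

(** The suspension of z. Its component has index d + 1 - 1, equal to d only by proof, whence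
    [eproj]. *)
Definition elt_susp (z : elt P) : elt (susp P) :=
  @Elt k (susp P) (earity z) (edeg z + 1) (eproj (earity z) (edeg z + 1 - 1) z).

Lemma elt_suspE n p (x : P n (p - 1)) :
  elt_susp (@Elt k P n (p - 1) x) = @Elt k (susp P) n p x.
Proof.
rewrite /elt_susp /=; have : p - 1 + 1 = p by lia.
by move: (p - 1 + 1) => p' E; subst p'; rewrite eprojK.
Qed.

(** With degrees written as p - 1, operations on the suspension apply without transport. *)
Lemma ex_elt_susp (z : elt P) : exists n p (x : P n (p - 1)), z = Elt x.
Proof.
case: z => n d x; exists n, (d + 1); have : d = d + 1 - 1 by lia.
by move: (d + 1 - 1) => d' E; subst d'; exists x.
Qed.

Section ToAlg.
Variable t : perm_str (susp P).

(** Inverts x o y = (-1)^|x| m(x, y); the same sign appears because it is its own inverse. *)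
Definition desusp_op r (x y : elt P) n (d : int) : P n d :=
  ksign k (edeg x) *:
    eproj n d (@Elt k P n (d + 1 - 1) (tpc t r (elt_susp x) (elt_susp y) n (d + 1))).

Lemma desusp_opE r n1 n2 n (hr : binary_arity r n1 n2 n) p q d (hd : p + q == d)
    (x : P n1 (p - 1)) (y : P n2 (q - 1)) :
  desusp_op r (Elt x) (Elt y) n (d - 1) = ksign k (p - 1) *: pcirc t hr hd x y.
Proof.
rewrite /desusp_op !elt_suspE -(tpcE t hr hd); congr (_ *: _).
have : d - 1 + 1 = d by lia.
by move: (d - 1 + 1) => d' E; subst d'; rewrite eprojK.
Qed.

Lemma elt_susp_lin n d c (x x' : P n d) : exists y y' : susp P n (d + 1),
  [/\ elt_susp (Elt x) = Elt y, elt_susp (Elt x') = Elt y' &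
      elt_susp (Elt (c *: x + x')) = Elt (c *: y + y')].
Proof.
exists (eproj n (d + 1 - 1) (Elt x)), (eproj n (d + 1 - 1) (Elt x')); split=> //.
by rewrite /elt_susp /= eproj_lin.
Qed.

Lemma desusp_op_linl r n1 p c (x x' : P n1 p) y n d :
  desusp_op r (Elt (c *: x + x')) y n d =
  c *: desusp_op r (Elt x) y n d + desusp_op r (Elt x') y n d.
Proof.
rewrite /desusp_op; have [u [u' [-> -> ->]]] := elt_susp_lin c x x'.
by rewrite tpc_linl eproj_lin /= scalerDr !scalerA mulrC.
Qed.

Lemma desusp_op_linr r x n2 q c (y y' : P n2 q) n d :
  desusp_op r x (Elt (c *: y + y')) n d =
  c *: desusp_op r x (Elt y) n d + desusp_op r x (Elt y') n d.
Proof.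
rewrite /desusp_op; have [u [u' [-> -> ->]]] := elt_susp_lin c y y'.
by rewrite tpc_linr eproj_lin /= scalerDr !scalerA mulrC.
Qed.

Lemma desusp_op_scalel r n1 p c (x : P n1 p) y n d :
  desusp_op r (Elt (c *: x)) y n d = c *: desusp_op r (Elt x) y n d.
Proof.
have L : linear (fun x : P n1 p => desusp_op r (Elt x) y n d).
  by move=> b u v; exact: desusp_op_linl r n1 p b u v y n d.
exact: (lin_scale L).
Qed.

Lemma desusp_op_scaler r x n2 q c (y : P n2 q) n d :
  desusp_op r x (Elt (c *: y)) n d = c *: desusp_op r x (Elt y) n d.
Proof.
have L : linear (fun y : P n2 q => desusp_op r x (Elt y) n d).
  by move=> b u v; exact: desusp_op_linr r x n2 q b u v n d.
exact: (lin_scale L).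
Qed.

(** With its sign, [desusp_op] turns the permutad axiom into the relation with e = 1, and freeness
    of the Koszul dual extends the family to an algebra. *)
Lemma susp_perm_of_alg_surj : exists s, susp_perm_of_alg s = t.
Proof.
pose g := binary_endo 1 desusp_op_linl desusp_op_linr.
have [|f fg] := @koszul_dual_free_on_binary k (end_operad P) g.
  apply: binary_assoc_rel => a s t' u v es ev a3 s2 v2 x0 y0 z0.
  have [n1 [p [x ->]]] := ex_elt_susp x0; have [n2 [q [y ->]]] := ex_elt_susp y0.
  have [n3 [r [z ->]]] := ex_elt_susp z0 => {x0 y0 z0} n12 n23 n d12 d23 d.
  move=> hs ds hv dv.
  have E12 : d12 = (p + q) - 1 by rewrite -(eqP ds) tdeg2 (susp_deg erefl).
  have E23 : d23 = (q + r) - 1 by rewrite -(eqP dv) tdeg2 (susp_deg erefl).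
  subst d12 d23 => xy yz ht dt hu du.
  have Ed : d = (p + q + r) - 1 by rewrite -(eqP dt) tdeg2 (susp_deg erefl).
  subst d; have hs' := hs; have hv' := hv; have ht' := ht; have hu' := hu.
  rewrite fits_binary in hs'; rewrite fits_binary in hv'.
  rewrite fits_binary in ht'; rewrite fits_binary in hu'.
  have [hpq hqr] : (p + q == p + q) /\ (q + r == q + r) by [].
  have hl : p + q + r == p + q + r by [].
  have hr : p + (q + r) == p + q + r by rewrite addrA.
  have xyE : xy = Elt (ksign k (p - 1) *: (pcirc t hs' hpq x y : P n12 (p + q - 1))).
    by congr Elt; apply: desusp_opE.
  have yzE : yz = Elt (ksign k (q - 1) *: (pcirc t hv' hqr y z : P n23 (q + r - 1))).
    by congr Elt; apply: desusp_opE.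
  have gL : g t' _ _ ht _ dt = desusp_op t' xy (Elt z) n (p + q + r - 1) by [].
  have gR : g u _ _ hu _ du = desusp_op u (Elt x) yz n (p + q + r - 1) by [].
  rewrite gL gR xyE yzE desusp_op_scalel desusp_op_scaler.
  rewrite (desusp_opE ht' hl) (desusp_opE hu' hr).
  have [ct [a12 sE]] := left_of_elem a3 s2 es.
  have [cu [a23 vE]] := right_of_elem a3 v2 ev.
  rewrite (pcircA t hs' ht' hu' hv' hpq hqr hl hr x y z a3 sE ct cu vE).
  rewrite !scalerA; congr (_ *: _); rewrite /= mul1r.
  by rewrite -!ksignD !ksignE; congr (_ ^+ (nat_of_bool _)); lia.
exists (alg_of_mor f); apply: perm_str_eq => r n1 n2 n hr p q d hd x y.
have hf : fits r [:: @Elt k P n1 (p - 1) x; @Elt k P n2 (q - 1) y] n by rewrite fits_binary.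
have hd' : 1 + tdeg [:: @Elt k P n1 (p - 1) x; @Elt k P n2 (q - 1) y] == d - 1.
  by rewrite tdeg2 (susp_deg (eqP hd)).
rewrite (susp_perm_of_algE _ hr hd hf hd') /= fg; last by case/and4P: hr => /eqP.
rewrite /= (desusp_opE hr hd) scalerA ksignK; exact: scale1r.
Qed.

End ToAlg.
End Suspended.

Section Functors.
Variable k : fieldType.

Lemma perm_of_alg_mor (P Q : coll k) (s : alg_str (terminal k) P)
    (t : alg_str (terminal k) Q) f :
  alg_mor s t f -> perm_mor (perm_of_alg s) (perm_of_alg t) f.
Proof.
move=> st r n1 n2 n hr p q d hd x y.
have hf : fits r [:: Elt x; Elt y] n by rewrite fits_binary.
have hd' : 0 + tdeg [:: Elt x; Elt y] == d by rewrite tdeg2 add0r.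
have hff : fits r (map (emap f) [:: Elt x; Elt y]) n by rewrite emap_fits.
have hdf : 0 + tdeg (map (emap f) [:: Elt x; Elt y]) == d by rewrite emap_tdeg.
by rewrite (perm_of_algE s hr hd hf hd') (perm_of_algE t hr hd hff hdf); apply: st.
Qed.

Lemma perm_of_alg_refl (P Q : coll k) (s : alg_str (terminal k) P)
    (t : alg_str (terminal k) Q) f :
  perm_mor (perm_of_alg s) (perm_of_alg t) f -> alg_mor s t f.
Proof.
move=> st; apply: (alg_mor_generators (@terminal_generates k)) => r r2.
move=> a n ha hfa d hd hfd; have := fits_size ha; rewrite r2.
case: a ha hfa hd hfd => [|[n1 p x] [|[n2 q y] [|? ?]]] //= ha hfa hd hfd _.
have hr := ha; rewrite fits_binary in hr.
have hpq := hd; rewrite tdeg2 add0r in hpq.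
by have := st _ _ _ _ hr _ _ _ hpq x y; rewrite (perm_of_algE s hr hpq ha hd)
  (perm_of_algE t hr hpq hfa hfd).
Qed.

Lemma susp_perm_of_alg_mor (P Q : coll k) (s : alg_str (koszul_dual (terminal_data k)) P)
    (t : alg_str (koszul_dual (terminal_data k)) Q) f :
  alg_mor s t f -> perm_mor (susp_perm_of_alg s) (susp_perm_of_alg t) (susp_map f).
Proof.
move=> st r n1 n2 n hr p q d hd x y.
pose a := [:: @Elt k P n1 (p - 1) x; @Elt k P n2 (q - 1) y].
have hf : fits r a n by rewrite fits_binary.
have hd' : 1 + tdeg a == d - 1 by rewrite tdeg2 (susp_deg (eqP hd)).
have hff : fits r (map (emap f) a) n by rewrite emap_fits.
have hdf : 1 + tdeg (map (emap f) a) == d - 1 by rewrite emap_tdeg.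
rewrite (susp_perm_of_algE s hr hd hf hd') (susp_perm_of_algE t hr hd hff hdf) /=.
rewrite (lin_scale (cfun_lin f (n := n) (d := d - 1))); congr (_ *: _).
exact: st.
Qed.

Lemma susp_perm_of_alg_refl (P Q : coll k) (s : alg_str (koszul_dual (terminal_data k)) P)
    (t : alg_str (koszul_dual (terminal_data k)) Q) f :
  perm_mor (susp_perm_of_alg s) (susp_perm_of_alg t) (susp_map f) -> alg_mor s t f.
Proof.
move=> st; apply: (alg_mor_generators (@dual_gen_generates k)) => r r2.
move=> a n ha hfa d hd hfd; have := fits_size ha; rewrite r2.
case: a ha hfa hd hfd => [|x0 [|y0 [|? ?]]] // ha hfa hd hfd _.
have [n1 [p [x xE]]] := ex_elt_susp x0; have [n2 [q [y yE]]] := ex_elt_susp y0.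
subst x0 y0; have hr := ha; rewrite fits_binary in hr.
have dE : d = (p + q) - 1 by rewrite -(eqP hd) tdeg2 (susp_deg erefl).
subst d; have hpq : p + q == p + q by [].
have := st _ _ _ _ hr _ _ _ hpq x y.
rewrite (susp_perm_of_algE s hr hpq ha hd) (susp_perm_of_algE t hr hpq hfa hfd) /=.
rewrite (lin_scale (cfun_lin f (n := n) (d := p + q - 1))).
move/(congr1 (fun v : Q n (p + q - 1) => ksign k (p - 1) *: v)).
by rewrite !scalerA ksignK !scale1r.
Qed.

Lemma id_functor_bij : bijective (id_functor k).
Proof. by exists id. Qed.

Lemma id_functor_full P Q : bijective (@fmap _ _ (id_functor k) P Q).
Proof. by exists id. Qed.

(** Strict isomorphism needs an inverse on objects up to equality; the shift back is one, by d + 1 -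
    1 = d and extensionality. *)
Lemma susp_functor_bij : bijective (susp_functor k).
Proof.
exists (fun (P : coll k) n d => P n (d + 1)) => P /=; rewrite /susp;
  apply: functional_extensionality_dep => n; apply: functional_extensionality_dep => d.
  by rewrite addrK.
by rewrite subrK.
Qed.

Lemma susp_functor_full P Q : bijective (@fmap _ _ (susp_functor k) P Q).
Proof.
pose h (g : cmap (susp P) (susp Q)) n d (x : P n d) : Q n d :=
  eproj n d (@Elt k Q n (d + 1 - 1) (g n (d + 1) (eproj n (d + 1 - 1) (Elt x)))).
have hL g n d : linear (@h g n d).
  by move=> c x y; rewrite /h eproj_lin (cfun_lin g) eproj_lin.
exists (fun g => Cmap (hL g)) => [f|g]; apply: cmap_eq => n d x /=; rewrite /h.
  rewrite /=; have : d + 1 - 1 = d by lia.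
  by move: (d + 1 - 1) => d' E; subst d'; rewrite !eprojK.
have : d - 1 + 1 = d by lia.
by move: (d - 1 + 1) => d' E; subst d'; rewrite !eprojK.
Qed.

End Functors.

Theorem theorem7p4 (k : fieldType) (hk : [pchar k] =i pred0) :
  (* Algebras over the terminal operad are permutads. *)
  (exists (phi : forall P, str (alg (terminal k)) P ->
                   str (permutad k) (id_functor k P))
          (phiP : forall P Q (s : str (alg (terminal k)) P)
                    (t : str (alg (terminal k)) Q) (f : cmap P Q),
                  smor s t f -> smor (phi P s) (phi Q t) (fmap (id_functor k) f)),
     (forall (P : coll k) (s : alg_str (terminal k) P)
         (r : per) (n1 n2 n : posn) (hr : binary_arity r n1 n2 n)
         (p q d : int) (hd : p + q == d) (x : P n1 p) (y : P n2 q)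
         (hf : fits r [:: Elt x; Elt y] n)
         (hd' : 0 + tdeg [:: Elt x; Elt y] == d),
       pcirc (phi P s : perm_str P) hr hd x y = act s hf hd' (tone k r))
     /\ cat_iso (struct_functor phiP))
  /\
  (* The terminal operad is binary quadratic, with the standard presentation. *)
  (binary_quadratic (terminal k) /\
   binary (terminal_data k) /\ presents (terminal_data k) (terminal k))
  /\
  (* Algebras over its Koszul dual are permutads on the suspended collection. *)
  (exists (phi : forall P, str (alg (koszul_dual (terminal_data k))) P ->
                   str (permutad k) (susp_functor k P))
          (phiP : forall P Q (s : str (alg (koszul_dual (terminal_data k))) P)
                    (t : str (alg (koszul_dual (terminal_data k))) Q)
                    (f : cmap P Q),
                  smor s t f -> smor (phi P s) (phi Q t) (fmap (susp_functor k) f)),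
     (forall (P : coll k) (s : alg_str (koszul_dual (terminal_data k)) P)
         (r : per) (n1 n2 n : posn) (hr : binary_arity r n1 n2 n)
         (p q d : int) (hd : p + q == d)
         (x : P n1 (p - 1)) (y : P n2 (q - 1))
         (hf : fits r [:: Elt x; Elt y] n)
         (hd' : 1 + tdeg [:: Elt x; Elt y] == d - 1),
       pcirc (phi P s : perm_str (susp P)) hr hd x y
         = ksign k (p - 1) *: act s hf hd' (dual_gen k r))
     /\ cat_iso (struct_functor phiP)).
Proof.
split; [|split; [split; [|split]|]].
- exists (@perm_of_alg k), (@perm_of_alg_mor k); split; first by move=> *; apply: perm_of_algE.
  apply: struct_cat_iso; first exact: id_functor_bij.
  + exact: id_functor_full.
  + exact: perm_of_alg_refl.
  + by move=> P s t; apply: alg_mor_id_eq.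
  + by move=> P t; apply: perm_of_alg_surj.
- split; first exact: terminal_one_connected.
  by exists (terminal_data k); split; [apply: terminal_binary | apply: terminal_presents].
- exact: terminal_binary.
- exact: terminal_presents.
- exists (@susp_perm_of_alg k), (@susp_perm_of_alg_mor k); split.
    by move=> *; apply: susp_perm_of_algE.
  apply: struct_cat_iso; first exact: susp_functor_bij.
  + exact: susp_functor_full.
  + exact: susp_perm_of_alg_refl.
  + by move=> P s t; apply: alg_mor_id_eq.
  + by move=> P t; apply: susp_perm_of_alg_surj.
Qed.
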